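(* Let $0<\alpha_1<\alpha_2$, and for $i=1,2$ let $u_i$ be the minimizer of $$J(u)=\int_\Omega|\nabla u|^2\,dx+2\int_D v^+\,dx',\qquad v(x')=\int_0^1u(x',x_n)\,dx_n,$$ among functions $u\in\alpha_i+W^{1,2}_0(\Omega)$ (that is, with constant boundary data $\alpha_i$), and let $v_i(x')=\int_0^1u_i(x',x_n)\,dx_n$. Then the comparison principle does not hold for the functions $u_1$ and $u_2$ (the comparison principle being the assertion $u_1\le u_2$ in $\Omega$). Particularly, it does not hold in the set $\{v_2=0\}\subset\{v_1=0\}$ (i.e. in $\{v_2=0\}\times(0,1)$), where $$\int_0^1u_1(x',x_n)\,dx_n=\int_0^1u_2(x',x_n)\,dx_n=0,$$ but $u_1\not\equiv u_2$.
   Context: $\Omega=D\times(0,1)$ is a bounded domain in $\mathbb{R}^n$ with piecewise smooth boundary; points are written $x=(x',x_n)$ with $x'\in D\subset\mathbb{R}^{n-1}$, $x_n\in(0,1)$. $s^+=\max(s,0)$. The sets $\{v_i=0\}$ are subsets of $D$.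
   Formalization: Failure of comparison and u_1≢u_2 are asserted only when {v_2=0} has positive measure (for large α_1 this set is empty and u_1≤u_2, so the claim fails as stated); the inequality, the equality and the inclusion {v_2=0}⊂{v_1=0} are read almost everywhere. *)

(* Defs.v *)
From HB Require Import structures.
From mathcomp Require Import all_boot all_order all_algebra.
From mathcomp Require Import all_classical all_reals all_analysis.

Set Implicit Arguments.
Unset Strict Implicit.
Unset Printing Implicit Defensive.

Import Order.TTheory GRing.Theory Num.Theory.
Import numFieldNormedType.Exports.

Local Open Scope classical_set_scope.
Local Open Scope ring_scope.

(* The product sigma-algebra on R^n, generated by the coordinate maps; it is
   the Borel sigma-algebra of R^n. *)
Definition row_display : measure_display. Proof. exact. Qed.

Section measurable_row.
Context {R : realType} {n : nat}.

Definition row_coord (i : 'I_n) (x : 'rV[R]_n) : measurableTypeR R := x ord0 i.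

Let row_measurable0 : g_sigma_preimage row_coord set0.
Proof. exact: sigma_algebra0. Qed.

Let row_measurableC A :
  g_sigma_preimage row_coord A -> g_sigma_preimage row_coord (~` A).
Proof. exact: sigma_algebraC. Qed.

Let row_measurable_bigcup (F : (set 'rV[R]_n)^nat) :
  (forall i, g_sigma_preimage row_coord (F i)) ->
  g_sigma_preimage row_coord (\bigcup_i F i).
Proof. exact: sigma_algebra_bigcup. Qed.

HB.instance Definition _ := @isMeasurable.Build row_display 'rV[R]_n
  (g_sigma_preimage row_coord)
  row_measurable0 row_measurableC row_measurable_bigcup.

End measurable_row.

Section row_snoc.
Context {R : realType} {m : nat}.

(* (x', t) |-> x in R^m x R = R^(m+1); the last coordinate has index ord_max,
   and x' is recovered as col' ord_max x. *)
Definition row_snoc (p : 'rV[R]_m * measurableTypeR R) : 'rV[R]_m.+1 :=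
  \row_i oapp (p.1 ord0) p.2 (unlift ord_max i).

Lemma col'_row_snoc p : col' ord_max (row_snoc p) = p.1.
Proof. by apply/rowP => j; rewrite !mxE liftK. Qed.

Lemma row_snoc_max p : row_snoc p ord0 ord_max = p.2.
Proof. by rewrite mxE unlift_none. Qed.

Lemma row_snocK (x : 'rV[R]_m.+1) :
  row_snoc (col' ord_max x, x ord0 ord_max) = x.
Proof.
by apply/rowP => i; rewrite !mxE/=; case: unliftP => [j|] -> //=; rewrite mxE.
Qed.

Lemma measurable_row_coord n (i : 'I_n) :
  measurable_fun [set: 'rV[R]_n] (@row_coord R n i).
Proof.
move=> _ Y mY; rewrite setTI; apply: sub_sigma_algebra => /=.
rewrite -bigcup_seq/=; exists i => /=; first by rewrite mem_index_enum.
by exists Y => //; rewrite setTI.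
Qed.

Lemma measurable_fun_row d (T : measurableType d) n (f : T -> 'rV[R]_n) :
  (forall i, measurable_fun [set: T] (@row_coord R n i \o f)) ->
  measurable_fun [set: T] f.
Proof.
move=> mf _ A; rewrite setTI; move: A.
apply: smallest_sub.
  split=> [|A mA|F mF].
  - by rewrite preimage_set0.
  - by rewrite setTD preimage_setC; exact: measurableC.
  - by rewrite preimage_bigcup; exact: bigcup_measurable.
move=> A; rewrite -bigcup_seq => -[i _ [B mB <-]].
by rewrite setTI -comp_preimage -[X in measurable X]setTI; exact: mf.
Qed.

Lemma measurable_row_snoc :
  measurable_fun [set: 'rV[R]_m * measurableTypeR R] row_snoc.
Proof.
apply: measurable_fun_row => i.
have -> : row_coord i \o row_snoc =
    if unlift ord_max i is Some j then row_coord j \o fst else snd.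
  by apply/funext => p /=; rewrite /row_coord mxE; case: unlift.
case: unlift => [j|]; last exact: measurable_snd.
apply: measurableT_comp; [exact: measurable_row_coord|exact: measurable_fst].
Qed.

Lemma measurable_row_split : measurable_fun [set: 'rV[R]_m.+1]
  (fun x => (col' ord_max x, x ord0 ord_max : measurableTypeR R)).
Proof.
apply/measurable_fun_pairP; split => /=; last exact: measurable_row_coord.
apply: measurable_fun_row => j.
have -> : row_coord j \o (fst \o (fun x : 'rV[R]_m.+1 =>
    (col' ord_max x, x ord0 ord_max : measurableTypeR R))) =
    row_coord (lift ord_max j).
  by apply/funext => x; rewrite /row_coord /= mxE.
exact: measurable_row_coord.
Qed.

End row_snoc.

Section lebesgue_row.
Context {R : realType}.

Section step.
Variables (m : nat) (mu : {sigma_finite_measure set 'rV[R]_m -> \bar R}).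
Local Open Scope ereal_scope.

Definition lebesgue_row_step : set 'rV[R]_m.+1 -> \bar R :=
  pushforward (mu \x @lebesgue_measure R) row_snoc.

Let step0 : lebesgue_row_step set0 = 0.
Proof. by rewrite /lebesgue_row_step /pushforward preimage_set0 measure0. Qed.

Let step_ge0 A : 0 <= lebesgue_row_step A.
Proof. by rewrite /lebesgue_row_step /pushforward; exact: measure_ge0. Qed.

Let step_sigma_additive : semi_sigma_additive lebesgue_row_step.
Proof.
move=> F mF tF mUF; rewrite /lebesgue_row_step /pushforward preimage_bigcup.
have mpre A : measurable A -> measurable (@row_snoc R m @^-1` A).
  by move=> mA; rewrite -[X in measurable X]setTI; exact: measurable_row_snoc.
apply: measure_semi_sigma_additive => [i||]; first exact: mpre.
- apply/trivIsetP => /= i j _ _ ij; rewrite -preimage_setI.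
  by move/trivIsetP : tF => /(_ _ _ _ _ ij) ->//; rewrite preimage_set0.
- by rewrite -preimage_bigcup; exact: mpre.
Qed.

HB.instance Definition _ := isMeasure.Build _ _ _ lebesgue_row_step
  step0 step_ge0 step_sigma_additive.

Let step_sigma_finite : sigma_finite setT lebesgue_row_step.
Proof.
have /sigma_finiteP[F [TF ndF Foo]] := sigma_finiteT mu.
have /sigma_finiteP[G [TG ndG Goo]] := sigma_finiteT (@lebesgue_measure R).
pose split (x : 'rV[R]_m.+1) : 'rV[R]_m * measurableTypeR R :=
  (col' ord_max x, x ord0 ord_max).
exists (fun k => split @^-1` (F k `*` G k)).
  rewrite -preimage_bigcup [X in _ @^-1` X](_ : _ = setT) ?preimage_setT//.
  rewrite -subTset -setXTT TF TG => -[x y] [/= [i _ Fix] [k _ Gky]].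
  exists (maxn i k) => //; split.
  - by move: x Fix; exact/subsetPset/ndF/leq_maxl.
  - by move: y Gky; exact/subsetPset/ndG/leq_maxr.
move=> k; have [? ?] := Foo k; have [? ?] := Goo k; split.
  rewrite -[X in measurable X]setTI; apply: measurable_row_split => //.
  exact: measurableX.
rewrite /lebesgue_row_step /pushforward -comp_preimage.
rewrite (_ : split \o row_snoc = id); last first.
  by apply/funext => -[x t] /=; rewrite /split col'_row_snoc row_snoc_max.
by rewrite product_measure1E// lte_mul_pinfty// ge0_fin_numE.
Qed.

HB.instance Definition _ := Measure_isSigmaFinite.Build _ _ _ lebesgue_row_step
  step_sigma_finite.

End step.

(* n-dimensional Lebesgue measure on (Borel subsets of) R^n *)
Fixpoint lebesgue_row (n : nat) :
    {sigma_finite_measure set 'rV[R]_n -> \bar R} :=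
  match n with
  | 0 => dirac (0 : 'rV[R]_0)
  | m.+1 => lebesgue_row_step (lebesgue_row m)
  end.

End lebesgue_row.
Arguments lebesgue_row {R} n.

Section sobolev.
Context {R : realType} {n : nat}.
Implicit Types (A : set 'rV[R]_n) (u g phi : 'rV[R]_n -> R).

Definition partial (i : 'I_n) (f : 'rV[R]_n -> R) : 'rV[R]_n -> R :=
  fun x => 'D_(delta_mx ord0 i) f x.

(* C^infty(R^n): all iterated partial derivatives are differentiable
   everywhere, hence continuous. *)
Definition smooth (f : 'rV[R]_n -> R) : Prop :=
  forall (s : seq 'I_n) (x : 'rV[R]_n), differentiable (foldr partial f s) x.

(* C_c^infty(A), functions being extended by 0 outside A *)
Definition test_function A phi : Prop :=
  smooth phi /\
  exists K, [/\ compact K, K `<=` A & forall x, ~ K x -> phi x = 0].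

Definition square_integrable A u : Prop :=
  u \_ A \in Lfun (lebesgue_row n) 2%:E.

Definition L2norm A u : \bar R :=
  'N[lebesgue_row n]_2%:E[EFin \o (u \_ A)].

Definition weak_partial A (i : 'I_n) u g : Prop :=
  forall phi, test_function A phi ->
    \int[lebesgue_row n]_(x in A) (u x * partial i phi x) =
    - \int[lebesgue_row n]_(x in A) (g x * phi x).

(* u is in W^{1,2}(A) and G is its weak gradient; G is determined by u up to
   a null set. Only the values on A of u and G matter. *)
Definition W12 A u (G : 'I_n -> 'rV[R]_n -> R) : Prop :=
  square_integrable A u /\
  forall i, square_integrable A (G i) /\ weak_partial A i u (G i).

(* W^{1,2}_0(A), the closure of C_c^infty(A) in W^{1,2}(A) *)
Definition W12_0 A u : Prop :=
  exists2 G, W12 A u G &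
    forall e : R, 0 < e -> exists2 phi, test_function A phi &
      (L2norm A (fun x => u x - phi x)%R < e%:E)%E /\
      forall i, (L2norm A (fun x => G i x - partial i phi x)%R < e%:E)%E.

(* The boundary of A is a finite union of compact pieces of smooth
   hypersurfaces, each given as a regular level set. No transversality
   condition is imposed where the pieces meet. *)
Definition piecewise_smooth_boundary A : Prop :=
  exists (N : nat) (K : 'I_N -> set 'rV[R]_n) (g : 'I_N -> 'rV[R]_n -> R),
    closure A `\` interior A = \bigcup_i K i /\
    forall i, [/\ compact (K i), smooth (g i) &
      forall x, K i x -> g i x = 0 /\ exists j, partial j (g i) x != 0].

(* pointwise inequality between elements of L^2, that is, almost everywhere *)
Definition le_on A u1 u2 : Prop :=
  {ae lebesgue_row n, forall x, A x -> u1 x <= u2 x}.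

Definition eq_on A u1 u2 : Prop :=
  {ae lebesgue_row n, forall x, A x -> u1 x = u2 x}.

End sobolev.

Section functional.
Context {R : realType} {m : nat}.
Implicit Types (D : set 'rV[R]_m) (u w : 'rV[R]_m.+1 -> R).

(* D x (0, 1) *)
Definition cylinder D : set 'rV[R]_m.+1 :=
  [set x | D (col' ord_max x) /\ 0 < x ord0 ord_max < 1].

(* v(x') = \int_0^1 u(x', t) dt *)
Definition fiber_integral u (x' : 'rV[R]_m) : R :=
  \int[@lebesgue_measure R]_(t in `]0, 1[) u (row_snoc (x', t)).

Definition zero_set D u : set 'rV[R]_m :=
  [set x' | D x' /\ fiber_integral u x' = 0].

(* J(u), where G is the weak gradient of u *)
Definition J D u (G : 'I_m.+1 -> 'rV[R]_m.+1 -> R) : \bar R :=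
  (\int[lebesgue_row m.+1]_(x in cylinder D) (\sum_i G i x ^+ 2)%:E +
   2%:E * \int[lebesgue_row m]_(x' in D) (Num.max (fiber_integral u x') 0)%:E)%E.

(* alpha + W^{1,2}_0(D x (0, 1)) *)
Definition admissible D (alpha : R) u : Prop :=
  W12_0 (cylinder D) (fun x => u x - alpha).

Definition minimizer D (alpha : R) u : Prop :=
  admissible D alpha u /\
  exists2 G, W12 (cylinder D) u G &
    forall w H, admissible D alpha w -> W12 (cylinder D) w H ->
      (J D u G <= J D w H)%E.

End functional.

(* Main.v *)
Require Import Defs.
From mathcomp Require Import all_boot all_order all_algebra.
From mathcomp Require Import all_classical all_reals all_analysis.
From mathcomp Require Import measurable_realfun.
From mathcomp Require Import ring lra.
Import Order.TTheory GRing.Theory Num.Theory.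
Import numFieldNormedType.Exports.
Set Implicit Arguments.
Unset Strict Implicit.
Unset Printing Implicit Defensive.
Local Open Scope classical_set_scope.
Local Open Scope ring_scope.

(* Write [v i] for the fiber integral of [u i] and [p] for the positive part of
   [v 1 - v 2]. Moving [eps * psi] from [u 1] to [u 2] does not lower the sum of
   the two energies, and it does not raise the sum of the obstacle terms if
   the fiber mean of the test function [psi] is [p]; hence the pairing of
   [grad (u 1 - u 2)] with [grad psi] is bounded by the [L^1] distance of that
   mean to [p].
   A suitable [psi] exists because positive parts of fiber means can be
   realized with control of the energy: for a test function [g] and [c >= 0]
   there is a test function [psi], a finite sum of products [d q x' * S q t]
   with plateaus [S q] symmetric about [t = 1/2], whose fiber mean approximates
   the positive part of the mean of [g] minus [c], and such that on each fiber
   the Dirichlet energy of [psi] is at most a constant times the pairing of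
   [grad g] and [grad psi]. Taking [g] close to [(u 1 - a1) - (u 2 - a2)] and
   [c = a2 - a1] forces [p = 0], so [v 1 <= v 2]. Comparison with the minimizer
   [0] gives [0 <= v i], so that [v 2 = 0] entails [v 1 = 0].
   Over the zero set of [v 2] the inequality [u 1 <= u 2] would thus give
   [u 1 = u 2], that is, [(u 1 - a1) - (u 2 - a2)] would be the positive
   constant [a2 - a1], which is impossible near the base [t = 0] unless this
   zero set is null. *)

(** * Smooth functions *)

(** The positive part of [u 1 - u 2] has the wrong fiber mean, and a function of [x'] alone does not
    vanish at the two bases, so neither can serve as [psi]. The fiber mean is truncated as the last
    member of a family instead. For [g] even about [t = 1/2], with [s] the distance to [1/2], let
    [M(s)] be the integral of [g - g(s)] over [[0, s]]. Then [M' = - s g'], half of the fiber mean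
    is [M(1/2)] when [g] vanishes at the ends, and [M / w] with [w' = s^2] is a weighted average of
    [- g' / s]. The function [psi] is the one whose moments are [w b(M / w)], where [b] is
    nondecreasing, 1-Lipschitz and zero at 0. Vertically, the energy is a Dirichlet form in [M / w],
    on which [b] acts as a contraction; horizontally, a derivative of the new moment is that of [M]
    times a factor in [[0, 1]]. Both signs are favourable. For the truncation at [c] to fix 0 one
    needs [c >= 0]: this is where the order of the boundary data enters. Discretizing [s] makes
    [psi] a finite sum of smooth products, as the definition of [W12_0] demands. *)

Section smooth_calculus.
Context {R : realType} {n : nat}.
Implicit Types (f g : 'rV[R]_n -> R) (k : nat) (i : 'I_n).

(** [smooth] quantifies over lists of iterated derivatives, on which the product and chain rules do
    not iterate directly. Grading by the order of differentiability permits induction on [k]. *)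
Fixpoint diffn k f : Prop :=
  if k is k'.+1 then
    (forall x, differentiable f x) /\ forall i, diffn k' (partial i f)
  else True.

Lemma smooth_partial f i : smooth f -> smooth (partial i f).
Proof. by move=> sf s x; have := sf (rcons s i) x; rewrite foldr_rcons. Qed.

Lemma smooth_differentiable f x : smooth f -> differentiable f x.
Proof. by move=> /(_ [::] x). Qed.

Lemma smooth_diffn f : smooth f <-> forall k, diffn k f.
Proof.
split=> [sf k|].
  elim: k f sf => // k ih f sf; split; first by move=> x; exact: (sf [::]).
  by move=> i; apply/ih/smooth_partial.
(* In [foldr] the last index of the list is differentiated first, so the list is taken apart from
   its end. *)
move=> df s; elim/last_ind: s f df => [|s i ih] f df x.
  by have [] := df 1%N.
by rewrite foldr_rcons; apply: ih => k; have [_] := df k.+1; exact.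
Qed.

Lemma diffnW k f : diffn k.+1 f -> diffn k f.
Proof.
by elim: k f => // k ih f [df pf]; split => // i; apply: ih; exact: pf.
Qed.

Lemma eq_diffn k f g : f =1 g -> diffn k f -> diffn k g.
Proof. by move=> /funext ->. Qed.

Lemma partial_cst i (a : R) : partial i (cst a) = cst 0.
Proof. by apply/funext => x; exact: derive_cst. Qed.

Lemma diffn_cst k (a : R) : diffn k (cst a).
Proof.
elim: k a => // k ih a; split; first by move=> x; exact: differentiable_cst.
by move=> i; rewrite partial_cst.
Qed.

Lemma partialD i f g : (forall x, differentiable f x) ->
  (forall x, differentiable g x) ->
  partial i (fun x => f x + g x) = (fun x => partial i f x + partial i g x).
Proof.
by move=> df dg; apply/funext => x; rewrite /partial deriveD//;
  exact: diff_derivable.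
Qed.

Lemma partialZ i (a : R) f : (forall x, differentiable f x) ->
  partial i (fun x => a * f x) = (fun x => a * partial i f x).
Proof.
by move=> df; apply/funext => x; rewrite /partial deriveZ//;
  exact: diff_derivable.
Qed.

Lemma partialM i f g : (forall x, differentiable f x) ->
  (forall x, differentiable g x) ->
  partial i (fun x => f x * g x) =
  (fun x => f x * partial i g x + g x * partial i f x).
Proof.
by move=> df dg; apply/funext => x; rewrite /partial deriveM//;
  exact: diff_derivable.
Qed.

Lemma partialB i f g : smooth f -> smooth g ->
  partial i (fun x => f x - g x) = (fun x => partial i f x - partial i g x).
Proof.
by move=> sf sg; apply/funext => x; rewrite /partial deriveB//;
  apply: diff_derivable; exact: smooth_differentiable.
Qed.

Lemma diffnD k f g : diffn k f -> diffn k g -> diffn k (fun x => f x + g x).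
Proof.
elim: k f g => // k ih f g [df pf] [dg pg]; split.
  by move=> x; apply: differentiableD.
by move=> i; rewrite partialD//; apply: ih; [exact: pf|exact: pg].
Qed.

Lemma diffnM k f g : diffn k f -> diffn k g -> diffn k (fun x => f x * g x).
Proof.
elim: k f g => // k ih f g kf kg; have [df pf] := kf; have [dg pg] := kg.
split; first by move=> x; apply: differentiableM.
move=> i; rewrite partialM//.
apply: diffnD; apply: ih; [exact: diffnW kf|exact: pg|exact: diffnW kg|exact: pf].
Qed.

Lemma diffnZ k (a : R) f : diffn k f -> diffn k (fun x => a * f x).
Proof. by move=> kf; apply: diffnM => //; exact: diffn_cst. Qed.

Lemma differentiable_comp1 (h : R -> R) f x : derivable h (f x) 1 ->
  differentiable f x -> differentiable (h \o f) x.
Proof.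
by move=> dh df; apply: differentiable_comp => //; exact/derivable1_diffP.
Qed.

Lemma partial_comp i (h : R -> R) f x : derivable h (f x) 1 ->
  differentiable f x ->
  partial i (h \o f) x = derive1 h (f x) * partial i f x.
Proof.
move=> dh df; rewrite /partial deriveE; last exact: differentiable_comp1.
rewrite diff_comp//; last exact/derivable1_diffP.
by rewrite /= deriv1E// -deriveE// mulrC.
Qed.

(* Chain rule for a family of functions of one variable that is closed under
   differentiation up to multiplication by smooth functions of [f]. *)
Lemma diffn_comp_family (I : Type) (h : I -> R -> R) (P : set R)
    (J : I -> seq (R * I)) k f :
  (forall x, P (f x)) ->
  (forall a y, P y -> is_derive y 1 (h a) (\sum_(b <- J a) b.1 * h b.2 y)) ->
  (forall x, differentiable f x) ->
  (forall i, diffn k (partial i f)) ->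
  forall a, diffn k.+1 (h a \o f).
Proof.
move=> Pf dh df; elim: k => [|k ih] pf a.
  split=> // x; apply: differentiable_comp1 => //.
  by have [] := dh a (f x) (Pf x).
have {}ih b : diffn k.+1 (h b \o f) by apply: ih => i; apply: diffnW.
split=> [x|i].
  apply: differentiable_comp1 => //.
  by have [] := dh a (f x) (Pf x).
have -> : partial i (h a \o f) =
    fun x => (\sum_(b <- J a) b.1 * (h b.2 \o f) x) * partial i f x.
  apply/funext => x; have [dx ex] := dh a (f x) (Pf x).
  by rewrite partial_comp// derive1E ex.
apply: diffnM => //.
elim: (J a) => [|b s ihs].
  by apply: eq_diffn (diffn_cst k.+1 0) => x; rewrite big_nil.
apply: (@eq_diffn _ (fun x => b.1 * (h b.2 \o f) x +
    (\sum_(b0 <- s) b0.1 * (h b0.2 \o f) x))).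
  by move=> x; rewrite big_cons.
by apply: diffnD => //; exact: (@diffnZ k.+1 b.1 (h b.2 \o f) (ih b.2)).
Qed.

Lemma diffnV k f : (forall x, f x != 0) -> diffn k f ->
  diffn k (fun x => (f x)^-1).
Proof.
move=> f0; elim: k f f0 => // k ih f f0 kf; have [df pf] := kf; split.
  by move=> x; apply: differentiableV.
move=> i; have -> : partial i (fun x => (f x)^-1) =
    fun x => -1 * ((f x)^-1 * (f x)^-1) * partial i f x.
  apply/funext => x; rewrite /partial deriveV//; last exact: diff_derivable.
  by rewrite /GRing.scale/= -exprVn expr2 mulN1r.
have kV := ih f f0 (diffnW kf).
apply: (diffnM _ (pf i)).
exact: (@diffnZ k (-1) _ (diffnM kV kV)).
Qed.

Lemma diffn_sqrt k f : (forall x, 0 < f x) -> diffn k f ->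
  diffn k (fun x => Num.sqrt (f x)).
Proof.
move=> f0; elim: k f f0 => // k ih f f0 kf; have [df pf] := kf; split.
  move=> x; apply: (@differentiable_comp1 Num.sqrt) => //.
  by have [] := is_derive1_sqrt (f0 x).
move=> i; have -> : partial i (fun x => Num.sqrt (f x)) =
    fun x => (2 * Num.sqrt (f x))^-1 * partial i f x.
  apply/funext => x; have [dx ex] := is_derive1_sqrt (f0 x).
  by rewrite (@partial_comp _ Num.sqrt)// derive1E ex.
apply: (diffnM _ (pf i)); apply: diffnV.
  by move=> x; rewrite mulf_neq0// gt_eqF// sqrtr_gt0.
by apply/diffnZ/ih => //; exact: diffnW.
Qed.

Lemma smooth_cst (a : R) : smooth (fun _ : 'rV[R]_n => a).
Proof. by apply/smooth_diffn => k; exact: diffn_cst. Qed.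

Lemma smoothD f g : smooth f -> smooth g -> smooth (fun x => f x + g x).
Proof.
by move=> /smooth_diffn sf /smooth_diffn sg; apply/smooth_diffn => k;
  exact: diffnD.
Qed.

Lemma smoothM f g : smooth f -> smooth g -> smooth (fun x => f x * g x).
Proof.
by move=> /smooth_diffn sf /smooth_diffn sg; apply/smooth_diffn => k;
  exact: diffnM.
Qed.

Lemma smoothZ (a : R) f : smooth f -> smooth (fun x => a * f x).
Proof. by apply: smoothM; exact: smooth_cst. Qed.

Lemma smoothB f g : smooth f -> smooth g -> smooth (fun x => f x - g x).
Proof.
move=> sf sg; under eq_fun do rewrite -mulN1r.
by apply: smoothD => //; exact: smoothZ.
Qed.

Lemma smoothV f : (forall x, f x != 0) -> smooth f ->
  smooth (fun x => (f x)^-1).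
Proof.
by move=> f0 /smooth_diffn sf; apply/smooth_diffn => k; exact: diffnV.
Qed.

Lemma smooth_sqrt f : (forall x, 0 < f x) -> smooth f ->
  smooth (fun x => Num.sqrt (f x)).
Proof.
by move=> f0 /smooth_diffn sf; apply/smooth_diffn => k; exact: diffn_sqrt.
Qed.

Lemma smooth_sum (I : Type) (s : seq I) (F : I -> 'rV[R]_n -> R) :
  (forall a, smooth (F a)) -> smooth (fun x => \sum_(a <- s) F a x).
Proof.
move=> sF; elim: s => [|a s ih].
  by under eq_fun do rewrite big_nil; exact: smooth_cst.
by under eq_fun do rewrite big_cons; exact: smoothD.
Qed.

Lemma smooth_continuous f : smooth f -> continuous f.
Proof.
by move=> sf x; apply: differentiable_continuous; exact: smooth_differentiable.
Qed.

Lemma smooth_coord i : smooth (fun x : 'rV[R]_n => x ord0 i).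
Proof.
apply/smooth_diffn => -[//|k]; split; first by move=> x; exact: differentiable_coord.
move=> j; suff -> : partial j (fun x : 'rV[R]_n => x ord0 i) = cst ((i == j)%:R).
  exact: diffn_cst.
apply/funext => x; rewrite /partial /derive.
apply: (@cvg_lim _ (@Rhausdorff R)).
apply: (@cvg_trans _ ((fun=> (i == j)%:R : R) @ 0^')); last exact: cvg_cst.
apply: near_eq_cvg; near=> h.
rewrite /= !mxE/=.
by rewrite addrK /GRing.scale/= mulrA mulVf ?mul1r//;
  near: h; exact: nbhs_dnbhs_neq.
Unshelve. all: by end_near. Qed.

End smooth_calculus.

Section smooth_affine.
Context {R : realType} {n p : nat}.
Variables (L : 'rV[R]_p -> 'rV[R]_n) (L0 : 'rV[R]_p -> 'rV[R]_n).
Hypothesis LE : forall x v (h : R), L (h *: v + x) = h *: L0 v + L x.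
Hypothesis dL : forall x, differentiable L x.

Lemma derive_affine (f : 'rV[R]_n -> R) v x :
  'D_v (f \o L) x = 'D_(L0 v) f (L x).
Proof. by rewrite /derive; do 2 f_equal; apply/funext => h /=; rewrite LE. Qed.

(** [L0] is the linear part of [L], and [idx] says that it sends each basis vector to a basis vector
    or to 0. A partial derivative of [f \o L] is then 0 or some [partial i f \o L], and induction
    applies. Slices and the projection [col'] are both of this kind. *)
Lemma smooth_affine (idx : 'I_p -> option 'I_n) (f : 'rV[R]_n -> R) :
  (forall j, L0 (delta_mx ord0 j) = oapp (delta_mx ord0) 0 (idx j)) ->
  smooth f -> smooth (f \o L).
Proof.
move=> LI /smooth_diffn sf; apply/smooth_diffn => k.
elim: k f sf => // k ih f sf; split.
  by move=> x; apply: differentiable_comp => //; have [] := sf 1%N.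
move=> j; have -> : partial j (f \o L) =
    if idx j is Some i then partial i f \o L else cst 0.
  apply/funext => x; rewrite /partial derive_affine LI.
  by case: (idx j) => [i//|] /=; rewrite derive0.
case: (idx j) => [i|]; last exact: diffn_cst.
by apply: ih => l; have [_] := sf l.+1; exact.
Qed.

End smooth_affine.

(** * A smooth step function *)

Section smooth_step.
Context {R : realType}.

(* The factor [y^-1 ^+ k] makes the family closed under differentiation: the
   derivative of [flat k] is [flat k.+2 - k * flat k.+1]. *)
Definition flat (k : nat) (y : R) : R :=
  if 0 < y then y^-1 ^+ k * expR (- y^-1) else 0.

Lemma flat_ge0 k y : 0 <= flat k y.
Proof.
rewrite /flat; case: ifPn => // y0.
by rewrite mulr_ge0 ?expR_ge0// exprn_ge0// invr_ge0 ltW.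
Qed.

(** One term of the exponential series at [1 / y] suffices. The exponent 2 is what makes the
    difference quotient of [flat k] at 0 tend to 0. *)
Lemma flat_le k y : flat k y <= (k.+2)`!%:R * y ^+ 2.
Proof.
rewrite /flat; case: ifPn => y0; last by rewrite mulr_ge0// sqr_ge0.
have z0 : 0 < y^-1 by rewrite invr_gt0.
have := @expR_ge1Dxn R y^-1 k.+1 (ltW z0); move=> /(le_trans _) -/(_ (y^-1 ^+ k.+2 / k.+2`!%:R)).
rewrite lerDr => /(_ ler01); rewrite ler_pdivrMr ?ltr0n ?fact_gt0// => e.
rewrite expRN ler_pdivrMr ?expR_gt0// mulrAC mulrC.
have -> : y^-1 ^+ k = y ^+ 2 * y^-1 ^+ k.+2.
  have -> : y^-1 ^+ k.+2 = y^-1 ^+ k * y^-1 ^+ 2 by rewrite -exprD addn2.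
  by rewrite mulrCA -exprMn mulfV ?gt_eqF// expr1n mulr1.
by rewrite ler_wpM2l ?sqr_ge0// mulrC.
Qed.

Lemma is_derive_flat k (y : R) :
  is_derive y 1 (flat k) (flat k.+2 y - k%:R * flat k.+1 y).
Proof.
have [y0|y0|->] := ltgtP y 0.
- have e0 : \forall z \near y, cst 0 z = flat k z.
    near=> z; rewrite /flat ifF//; apply/negbTE; rewrite -leNgt ltW//.
    by near: z; exact: lt_nbhsl.
  have -> : flat k.+2 y - k%:R * flat k.+1 y = 0.
    by rewrite /flat !ifF ?mulr0 ?subr0//; apply/negbTE; rewrite -leNgt ltW.
  apply: (near_eq_is_derive e0).
- have e0 : \forall z \near y, (fun z => z^-1 ^+ k * expR (- z^-1)) z = flat k z.
    near=> z; rewrite /flat ifT//.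
    by near: z; exact: lt_nbhsr.
  apply: (near_eq_is_derive e0).
  have yn0 : y != 0 by rewrite gt_eqF.
  have dV : is_derive y 1 (fun z : R => z^-1) (- (y^-1 ^+ 2)).
    apply: DeriveDef; first exact: derivableV.
    by rewrite deriveV// derive_id /GRing.scale/= mulr1 exprVn.
  have dE : is_derive y 1 (fun z : R => expR (- z^-1)) (y^-1 ^+ 2 * expR (- y^-1)).
    have dN := is_deriveN dV.
    have := @is_derive1_comp R expR (- (fun z : R => z^-1)) y _ _
      (is_derive_expR _) dN.
    by rewrite opprK mulrC.
  have dX := is_deriveX k dV.
  have -> : (fun z : R => z^-1 ^+ k * expR (- z^-1)) =
      (fun z : R => z^-1) ^+ k * (fun z => expR (- z^-1)).
    by apply/funext => z; rewrite [RHS]/GRing.mul/= exprfctE.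
  apply: is_derive_eq.
  rewrite /flat y0 /GRing.scale/= exprfctE.
  by case: k {e0 dX} => [|k]; rewrite /= ?exprS ?expr0; ring.
- have -> : flat k.+2 0 - k%:R * flat k.+1 0 = 0.
    by rewrite /flat ltxx mulr0 subr0.
  have cv : h^-1 *: (flat k (h *: (1:R) + 0) - flat k 0) @[h --> 0^'] --> (0 : R).
    apply/cvgr0Pnorm_lt => e e0; near=> h.
    have h0 : h != 0 by near: h; exact: nbhs_dnbhs_neq.
    rewrite /GRing.scale/= mulr1 addr0 /(flat k 0) ltxx subr0 normrM.
    rewrite (ger0_norm (flat_ge0 _ _)) normfV ltr_pdivrMl ?normr_gt0//.
    apply: le_lt_trans (flat_le _ _) _.
    rewrite -real_normK ?num_real// expr2 mulrCA ltr_pM2l ?normr_gt0//.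
    rewrite -ltr_pdivlMl ?ltr0n ?fact_gt0//.
    near: h; apply: dnbhs0_lt.
    by rewrite mulr_gt0// invr_gt0 ltr0n fact_gt0.
  apply: DeriveDef; first by apply/cvg_ex; exists 0.
  exact/cvg_lim.
Unshelve. all: by end_near. Qed.

Lemma smooth_flat n (f : 'rV[R]_n -> R) k : smooth f -> smooth (flat k \o f).
Proof.
move=> sf; apply/smooth_diffn => l; apply: diffnW.
apply: (@diffn_comp_family _ _ nat flat setT
    (fun k => [:: (1, k.+2); (- k%:R, k.+1)])) => //.
- move=> a y _; rewrite !big_cons big_nil/= mul1r mulNr addr0.
  exact: is_derive_flat.
- by move=> x; exact: smooth_differentiable.
- by move=> i; have /smooth_diffn := smooth_partial i sf; exact.
Qed.

(** The rise starts at 1/3 and not at 0: the gap keeps the plateaus built from [step] supported in a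
    compact part of the open unit interval. *)
Definition step (s : R) : R :=
  flat 0 (s - 3^-1) / (flat 0 (s - 3^-1) + flat 0 (1 - s)).

Lemma flat0_gt0 (y : R) : 0 < y -> 0 < flat 0 y.
Proof. by move=> y0; rewrite /flat y0 expr0 mul1r expR_gt0. Qed.

Lemma flat0_eq0 (y : R) : y <= 0 -> flat 0 y = 0.
Proof. by move=> y0; rewrite /flat ltNge y0. Qed.

Lemma step_den_gt0 (s : R) : 0 < flat 0 (s - 3^-1) + flat 0 (1 - s).
Proof.
have [s1|s1] := ltP s 1.
  by rewrite ltr_wpDl ?flat_ge0// flat0_gt0// subr_gt0.
by rewrite ltr_wpDr ?flat_ge0// flat0_gt0//; lra.
Qed.

Lemma step_ge0 s : 0 <= step s.
Proof. by rewrite /step divr_ge0// ?flat_ge0// addr_ge0// flat_ge0. Qed.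

Lemma step_le1 s : step s <= 1.
Proof.
by rewrite /step ler_pdivrMr ?step_den_gt0// mul1r lerDl flat_ge0.
Qed.

Lemma step_eq0 s : s <= 3^-1 -> step s = 0.
Proof. by move=> s3; rewrite /step flat0_eq0 ?mul0r// subr_le0. Qed.

Lemma step_eq1 s : 1 <= s -> step s = 1.
Proof.
move=> s1; rewrite /step (@flat0_eq0 (1 - s)) ?subr_le0// addr0 divff//.
by rewrite gt_eqF// flat0_gt0//; lra.
Qed.

Lemma smooth_step n (f : 'rV[R]_n -> R) : smooth f -> smooth (step \o f).
Proof.
move=> sf; have s1 : smooth (fun x => f x - 3^-1).
  by apply: smoothB => //; exact: smooth_cst.
have s2 : smooth (fun x => 1 - f x) by apply: smoothB => //; exact: smooth_cst.
apply: smoothM; first exact: (smooth_flat 0 s1).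
apply: smoothV => [x|]; first by rewrite gt_eqF// step_den_gt0.
by apply: smoothD; [exact: (smooth_flat 0 s1)|exact: (smooth_flat 0 s2)].
Qed.

(** [smooth] concerns functions of row vectors. Reading [step] as a function on ['rV_1] gives its
    derivative and the continuity of that derivative. *)
Lemma derive_row1 (F : 'rV[R]_1 -> R) (t : R) :
  derive1 (fun s => F (\row__ s)) t = partial ord0 F (\row__ t).
Proof.
rewrite derive1E /partial /derive; do 2 f_equal; apply/funext => h /=.
do 3 f_equal; apply/rowP => i.
by rewrite !mxE (ord1 i) !eqxx.
Qed.

Lemma row1_continuous : continuous (fun s : R => \row_(_ < 1) s).
Proof.
have -> : (fun s : R => \row_(_ < 1) s) = fun s => s *: const_mx 1.
  by apply/funext => s; apply/rowP => i; rewrite !mxE mulr1.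
by move=> s; exact: scalel_continuous.
Qed.

Lemma step_row1 : step = (fun s => (step \o (fun x : 'rV[R]_1 => x ord0 ord0)) (\row__ s)).
Proof. by apply/funext => s /=; rewrite mxE. Qed.

Let F1 := step \o (fun x : 'rV[R]_1 => x ord0 ord0).

Let smooth_F1 : smooth F1. Proof. exact/smooth_step/smooth_coord. Qed.

Lemma derive1_step_continuous : continuous (derive1 step).
Proof.
have -> : derive1 step = fun t => partial ord0 F1 (\row__ t).
  by apply/funext => t; rewrite [in LHS]step_row1 derive_row1.
move=> t; apply: (@continuous_comp _ _ _ (fun s : R => \row_(_ < 1) s)).
  exact: row1_continuous.
exact/smooth_continuous/smooth_partial.
Qed.

Lemma derivable_step t : derivable step t 1.
Proof.
apply/derivable1_diffP; rewrite step_row1.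
apply: (@differentiable_comp _ _ _ _ (fun s : R => \row_(_ < 1) s)).
  have -> : (fun s : R => \row_(_ < 1) s) = fun s => s *: const_mx 1.
    by apply/funext => s; apply/rowP => i; rewrite !mxE mulr1.
  exact: differentiableZl.
exact: smooth_differentiable.
Qed.

Lemma derive1_step_eq0 t : ~~ (3^-1 <= t <= 1) -> derive1 step t = 0.
Proof.
rewrite negb_and -!ltNge => /orP[t0|t1].
  rewrite derive1E -(@derive_cst R R R 0 t 1).
  apply: near_eq_derive.
  by near=> z; rewrite step_eq0// ltW//; near: z; exact: lt_nbhsl.
rewrite derive1E -(@derive_cst R R R 1 t 1).
apply: near_eq_derive.
by near=> z; rewrite step_eq1// ltW//; near: z; exact: lt_nbhsr.
Unshelve. all: by end_near. Qed.

Lemma flat0_homo : {homo flat 0 : x y / x <= y}.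
Proof.
move=> x y xy; have [x0|x0] := leP x 0; first by rewrite flat0_eq0// flat_ge0.
have y0 := lt_le_trans x0 xy.
by rewrite /flat x0 y0 !expr0 !mul1r ler_expR lerN2 lef_pV2.
Qed.

Lemma step_homo : {homo step : x y / x <= y}.
Proof.
move=> x y xy; rewrite /step ler_pdivrMr ?step_den_gt0// mulrAC.
rewrite ler_pdivlMr ?step_den_gt0//.
have h1 : flat 0 (x - 3^-1) <= flat 0 (y - 3^-1) by apply: flat0_homo; lra.
have h2 : flat 0 (1 - y) <= flat 0 (1 - x) by apply: flat0_homo; lra.
have := flat_ge0 0 (x - 3^-1); have := flat_ge0 0 (1 - y); nra.
Qed.

Lemma derive1_step_ge0 t : 0 <= derive1 step t.
Proof.
rewrite derive1E; apply: limr_ge; first exact: derivable_step.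
near=> h; have h0 : h != 0 by near: h; exact: nbhs_dnbhs_neq.
rewrite /GRing.scale/= mulr1; have [h1|h1] := ltP 0 h.
  by rewrite mulr_ge0 ?invr_ge0 ?(ltW h1)// subr_ge0 step_homo// lerDr ltW.
have h2 : h < 0 by rewrite lt_neqAle h0.
by rewrite mulr_le0 ?invr_le0// subr_le0 step_homo// gerDr.
Unshelve. all: by end_near. Qed.

Lemma derive1_step_bounded : exists2 C : R, 0 < C & forall t, `|derive1 step t| <= C.
Proof.
have cn : {within `[0, 1], continuous (fun t => `|derive1 step t|)}.
  apply: continuous_subspaceT => t.
  by apply: continuous_comp; [exact: derive1_step_continuous|exact: norm_continuous].
have [c _ cM] := EVT_max (@ler01 R) cn.
exists (`|derive1 step c| + 1); first by rewrite ltr_wpDl.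
move=> t; have [/andP[t0 t1]|t01] := boolP (3^-1 <= t <= 1).
  rewrite (le_trans (cM t _)) ?lerDl// in_itv/= t1 andbT.
  by rewrite (le_trans _ t0)// invr_ge0.
by rewrite derive1_step_eq0// normr0 addr_ge0.
Qed.

End smooth_step.

(** * Lebesgue measure on row vectors *)

Section row_borel.
Context {R : realType}.

(** The sigma-algebra is generated by the coordinates, so an open set is exhibited as the countable
    union of the rational boxes that it contains. *)
Lemma open_row_measurable n (A : set 'rV[R]_n) : open A -> measurable A.
Proof.
move=> oA.
pose box (p : 'rV[rat]_n * 'rV[rat]_n) : set 'rV[R]_n :=
  \bigcap_(i in [set: 'I_n])
    (@row_coord R n i @^-1` `]ratr (p.1 ord0 i), ratr (p.2 ord0 i)[).
have mbox p : measurable (box p).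
  apply: fin_bigcap_measurable; first exact: finite_finset.
  move=> i _; rewrite -[X in measurable X]setTI.
  by apply: measurable_row_coord => //; exact: measurable_itv.
pose F p := if `[< box p `<=` A >] then box p else set0.
have -> : A = \bigcup_p F p.
  apply/seteqP; split=> [x Ax|x [p _]]; last first.
    by rewrite /F; case: asboolP => // pA /pA.
  have /nbhs_ballP[e/= e0 eA] := open_nbhs_nbhs (conj oA Ax).
  have xa (i : 'I_n) : exists q : rat, x ord0 i - e < ratr q < x ord0 i.
    have /rat_in_itvoo[q /itvP qx] : x ord0 i - e < x ord0 i by rewrite ltrBlDr ltrDl.
    by exists q; rewrite !qx.
  have xb (i : 'I_n) : exists q : rat, x ord0 i < ratr q < x ord0 i + e.
    have /rat_in_itvoo[q /itvP qx] : x ord0 i < x ord0 i + e by rewrite ltrDl.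
    by exists q; rewrite !qx.
  have [a ha] := choice xa; have [b hb] := choice xb.
  pose p := (\row_i a i, \row_i b i).
  have px : box p x.
    move=> i _ /=; rewrite /row_coord in_itv/= !mxE.
    by have /andP[_ ->] := ha i; have /andP[] := hb i.
  exists p => //; rewrite /F; case: asboolP => //; case=> y py; apply: eA.
  split=> // i j; rewrite ord1; have := py j I; rewrite /= /row_coord in_itv/= !mxE.
  have /andP[a1 a2] := ha j; have /andP[b1 b2] := hb j => /andP[y1 y2].
  by rewrite /ball/= ltr_distlC; apply/andP; split; lra.
apply: countable_bigcupT_measurable => // p.
by rewrite /F; case: ifP.
Qed.

Lemma continuous_row_measurable n (f : 'rV[R]_n -> R) : continuous f ->
  measurable_fun [set: 'rV[R]_n] f.
Proof.
move=> /continuousP cf; apply: (measurability _ (RGenOpens.measurableE R)).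
move=> _ [_ [a [b ->]] <-]; rewrite setTI.
by apply: open_row_measurable; apply: cf; exact: interval_open.
Qed.

Definition row_cube n (M : R) : set 'rV[R]_n :=
  \bigcap_(i in [set: 'I_n]) (@row_coord R n i @^-1` `[- M, M]).
Arguments row_cube : clear implicits.

Lemma row_cube_measurable n M : measurable (row_cube n M).
Proof.
apply: fin_bigcap_measurable; first exact: finite_finset.
move=> i _; rewrite -[X in measurable X]setTI.
by apply: measurable_row_coord => //; exact: measurable_itv.
Qed.

Lemma row_cube_finite n M : (lebesgue_row n (row_cube n M) < +oo)%E.
Proof.
elim: n => [|m ih].
  by rewrite /= diracE; case: (_ \in _); rewrite ltry.
rewrite /= /lebesgue_row_step /pushforward.
have -> : @row_snoc R m @^-1` row_cube m.+1 M = row_cube m M `*` `[- M, M].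
  apply/seteqP; split=> [[x t] xt|[x t] [/= xM tM] i _].
    split=> /= [i _|].
      by have := xt (lift ord_max i) I; rewrite /= /row_coord mxE liftK.
    by have := xt ord_max I; rewrite /= /row_coord row_snoc_max.
  rewrite /row_coord/= mxE; case: unliftP => [j|] _ //=.
  exact: xM.
rewrite product_measure1E//; last exact: row_cube_measurable.
rewrite lte_mul_pinfty//; first by rewrite ge0_fin_numE.
have := @lebesgue_measure_itv R `[- M, M]; rewrite /= => ->.
by case: ifP => _; rewrite ?ltry.
Qed.

Lemma row_coord_le n (x : 'rV[R]_n) i : `|x ord0 i| <= `|x|.
Proof.
rewrite [leRHS]/Num.norm /= mx_normrE; apply/bigmax_geP; right => /=.
by exists (ord0, i).
Qed.

Lemma bounded_row_cube n (A : set 'rV[R]_n) : bounded_set A ->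
  exists M, A `<=` row_cube n M.
Proof.
move=> [M [Mreal AM]]; exists (M + 1) => x Ax i _ /=.
rewrite /row_coord in_itv/= -ler_norml.
by apply: le_trans (row_coord_le x i) _; apply: AM => //; rewrite ltrDl.
Qed.

Lemma bounded_row_finite n (A : set 'rV[R]_n) : measurable A -> bounded_set A ->
  (lebesgue_row n A < +oo)%E.
Proof.
move=> mA /bounded_row_cube[M AM].
apply: le_lt_trans (row_cube_finite n M).
by apply: le_measure; rewrite ?inE//; exact: row_cube_measurable.
Qed.

End row_borel.
Arguments row_cube {R} n M.

(** * Fubini's theorem along the last coordinate *)

Section row_fubini.
Context {R : realType} {m : nat}.
Local Open Scope ereal_scope.
Notation leb := (@lebesgue_measure R).

Lemma integrable_rowS (f : 'rV[R]_m.+1 -> \bar R) :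
  (lebesgue_row m.+1).-integrable [set: 'rV[R]_m.+1] f ->
  (@lebesgue_row R m \x leb).-integrable
    [set: 'rV[R]_m * measurableTypeR R] (f \o row_snoc).
Proof.
move=> /integrableP[mf foo]; apply/integrableP; split.
  by apply: measurableT_comp => //; exact: measurable_row_snoc.
apply: le_lt_trans foo.
rewrite [leRHS](_ : _ =
   \int[@lebesgue_row R m \x leb]_p ((abse \o f) \o row_snoc) p)//.
rewrite -(@ge0_integral_pushforward _ _ _ _ R row_snoc measurable_row_snoc
    (@lebesgue_row R m \x leb) setT (abse \o f))//.
  exact: measurableT_comp.
by move=> y _; exact: abse_ge0.
Qed.

Lemma integral_rowS_prod (f : 'rV[R]_m.+1 -> \bar R) :
  (lebesgue_row m.+1).-integrable [set: 'rV[R]_m.+1] f ->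
  \int[lebesgue_row m.+1]_x f x =
  \int[@lebesgue_row R m \x leb]_p (f \o row_snoc) p.
Proof.
move=> fi; have fi2 := integrable_rowS fi.
have mf := measurable_int _ fi.
exact: (@integral_pushforward _ _ _ _ R row_snoc measurable_row_snoc
    (@lebesgue_row R m \x leb) setT f mf fi2 measurableT).
Qed.

Lemma integral_rowS (f : 'rV[R]_m.+1 -> \bar R) :
  (lebesgue_row m.+1).-integrable [set: 'rV[R]_m.+1] f ->
  \int[lebesgue_row m.+1]_x f x =
  \int[lebesgue_row m]_x \int[leb]_t f (row_snoc (x, t)).
Proof.
move=> fi; rewrite integral_rowS_prod//.
by rewrite -integral12_prod_meas1//; exact: integrable_rowS.
Qed.

Lemma integral_rowS_swap (f : 'rV[R]_m.+1 -> \bar R) :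
  (lebesgue_row m.+1).-integrable [set: 'rV[R]_m.+1] f ->
  \int[lebesgue_row m.+1]_x f x =
  \int[leb]_t \int[lebesgue_row m]_x f (row_snoc (x, t)).
Proof.
move=> fi; rewrite integral_rowS_prod//.
by rewrite -integral21_prod_meas1//; exact: integrable_rowS.
Qed.

End row_fubini.

(** * Real-valued integrals *)

Section real_integrals.
Context d (T : measurableType d) {R : realType}.
Variable mu : {measure set T -> \bar R}.
Variable A : set T.
Hypothesis mA : measurable A.
Implicit Types f g : T -> R.

Definition rintable f : Prop := mu.-integrable A (EFin \o f).

Definition sqintable f : Prop :=
  measurable_fun A f /\ rintable (fun x => f x ^+ 2).

Lemma rintable_measurable f : rintable f -> measurable_fun A f.
Proof. by move=> /measurable_int/measurable_EFinP. Qed.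

Lemma eq_rintable f g : {in A, f =1 g} -> rintable f -> rintable g.
Proof.
move=> fg; apply: eq_integrable => // x xA; by rewrite /= fg.
Qed.

Lemma rintableD f g : rintable f -> rintable g -> rintable (fun x => f x + g x).
Proof.
move=> fi gi; have := integrableD mA fi gi.
by apply: eq_integrable => // x _ /=; rewrite EFinD.
Qed.

Lemma rintableZ (a : R) f : rintable f -> rintable (fun x => a * f x).
Proof.
move=> fi; have := integrableZl mA a fi.
by apply: eq_integrable => // x _ /=; rewrite EFinM.
Qed.

Lemma rintableB f g : rintable f -> rintable g -> rintable (fun x => f x - g x).
Proof.
move=> fi gi; have := rintableD fi (rintableZ (-1) gi).
by apply: eq_rintable => x _; rewrite mulN1r.
Qed.

Lemma rintable0 : rintable (fun=> 0).
Proof. exact: integrable0. Qed.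

Lemma rintable_sum (I : Type) (s : seq I) (F : I -> T -> R) :
  (forall i, rintable (F i)) -> rintable (fun x => \sum_(i <- s) F i x).
Proof.
move=> Fi; elim: s => [|i s ih].
  by apply: eq_rintable rintable0 => x _; rewrite big_nil.
apply: eq_rintable (rintableD (Fi i) ih) => x _; by rewrite big_cons.
Qed.

Lemma le_rintable f g : measurable_fun A f ->
  (forall x, A x -> `|f x| <= g x) -> rintable g -> rintable f.
Proof.
move=> mf fg gi; apply: (le_integrable mA _ _ gi).
  exact/measurable_EFinP.
by move=> x Ax /=; rewrite lee_fin (le_trans (fg x Ax))// ler_norm.
Qed.

Lemma rintable_norm f : rintable f -> rintable (fun x => `|f x|).
Proof. by move=> fi; exact: integrable_norm. Qed.

Lemma sqintableD f g : sqintable f -> sqintable g ->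
  sqintable (fun x => f x + g x).
Proof.
move=> [mf fi] [mg gi]; split; first exact: measurable_funD.
apply: (@le_rintable _ (fun x => 2 * f x ^+ 2 + 2 * g x ^+ 2)).
- by apply: measurable_funX; exact: measurable_funD.
- by move=> x _; rewrite ger0_norm ?sqr_ge0//; have := sqr_ge0 (f x - g x); nra.
- by apply: rintableD; exact: rintableZ.
Qed.

Lemma sqintableZ (a : R) f : sqintable f -> sqintable (fun x => a * f x).
Proof.
move=> [mf fi]; split; first exact: measurable_funM.
apply: eq_rintable (rintableZ (a ^+ 2) fi) => x _; by rewrite exprMn.
Qed.

Lemma sqintableB f g : sqintable f -> sqintable g ->
  sqintable (fun x => f x - g x).
Proof.
move=> sf sg; have := sqintableD sf (sqintableZ (-1) sg).
by under eq_fun do rewrite mulN1r.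
Qed.

Lemma sqintableM f g : sqintable f -> sqintable g ->
  rintable (fun x => f x * g x).
Proof.
move=> [mf fi] [mg gi].
apply: (@le_rintable _ (fun x => f x ^+ 2 + g x ^+ 2)).
- exact: measurable_funM.
- move=> x _; rewrite ler_norml.
  by have := sqr_ge0 (f x - g x); have := sqr_ge0 (f x + g x) => *;
    apply/andP; split; nra.
- exact: rintableD.
Qed.

Lemma rint_le f g : rintable f -> rintable g ->
  (forall x, A x -> f x <= g x) ->
  \int[mu]_(x in A) f x <= \int[mu]_(x in A) g x.
Proof. by move=> fi gi fg; exact: le_Rintegral. Qed.

Lemma rintD f g : rintable f -> rintable g ->
  \int[mu]_(x in A) (f x + g x) = \int[mu]_(x in A) f x + \int[mu]_(x in A) g x.
Proof. by move=> fi gi; exact: RintegralD. Qed.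

Lemma rintB f g : rintable f -> rintable g ->
  \int[mu]_(x in A) (f x - g x) = \int[mu]_(x in A) f x - \int[mu]_(x in A) g x.
Proof. by move=> fi gi; exact: RintegralB. Qed.

Lemma rintZ (a : R) f : rintable f ->
  \int[mu]_(x in A) (a * f x) = a * \int[mu]_(x in A) f x.
Proof. by move=> fi; exact: RintegralZl. Qed.

Lemma rint_sum (I : Type) (s : seq I) (F : I -> T -> R) :
  (forall i, rintable (F i)) ->
  \int[mu]_(x in A) (\sum_(i <- s) F i x) =
  \sum_(i <- s) \int[mu]_(x in A) F i x.
Proof.
move=> Fi; elim: s => [|i s ih].
  rewrite big_nil; under eq_Rintegral do rewrite big_nil.
  by rewrite Rintegral_cst// mul0r.
rewrite big_cons -ih -rintD//; last exact: rintable_sum.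
by under eq_Rintegral do rewrite big_cons.
Qed.

Lemma rint_ae_eq f g : measurable_fun A f -> measurable_fun A g ->
  {ae mu, forall x, A x -> f x = g x} ->
  \int[mu]_(x in A) f x = \int[mu]_(x in A) g x.
Proof.
move=> mf mg fg; rewrite /Rintegral; congr fine; apply: ae_eq_integral => //.
- exact/measurable_EFinP.
- exact/measurable_EFinP.
- by apply: filterS fg => x /= fg Ax; rewrite fg.
Qed.

Lemma rint_eq0_ae f : rintable f -> (forall x, A x -> 0 <= f x) ->
  \int[mu]_(x in A) f x <= 0 -> {ae mu, forall x, A x -> f x = 0}.
Proof.
move=> fi f0 le0.
have mf := measurable_int _ fi.
have : (\int[mu]_(x in A) `|(f x)%:E| = 0)%E.
  rewrite -(@fineK _ (\int[mu]_(x in A) `|(f x)%:E|)%E); last first.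
    by apply: integrable_fin_num => //; exact: integrable_abse.
  apply/eqP; rewrite eqe eq_le; apply/andP; split.
    apply: le_trans le0; rewrite /Rintegral le_eqVlt; apply/orP; left.
    apply/eqP; congr fine; apply: eq_integral => x /set_mem Ax.
    by rewrite gee0_abs// lee_fin f0.
  by apply: fine_ge0; apply: integral_ge0.
move/(ae_eq_integral_abs mu mA mf); apply: filterS => x /= h Ax.
by have /= := h Ax => -[].
Qed.

Lemma rint_ge0 f : (forall x, A x -> 0 <= f x) -> 0 <= \int[mu]_(x in A) f x.
Proof. exact: Rintegral_ge0. Qed.

Lemma le_norm_rint f : rintable f ->
  `|\int[mu]_(x in A) f x| <= \int[mu]_(x in A) `|f x|.
Proof. by move=> fi; exact: le_normr_Rintegral. Qed.

Hypothesis Aoo : (mu A < +oo)%E.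

Lemma rintable_cst (a : R) : rintable (fun=> a).
Proof.
apply: (@eq_rintable (fun=> a * 1)); first by move=> x _; rewrite mulr1.
apply: rintableZ; apply/integrableP; split; first exact: measurable_cst.
under eq_integral do rewrite /= normr1.
by rewrite integral_cst// mul1e.
Qed.

Lemma sqintable_rintable f : sqintable f -> rintable f.
Proof.
move=> [mf fi]; apply: (@le_rintable _ (fun x => 1 + f x ^+ 2)) => //.
  move=> x _; rewrite ler_norml.
  by have := sqr_ge0 (f x - 1); have := sqr_ge0 (f x + 1) => *;
    apply/andP; split; nra.
by apply: rintableD => //; exact: rintable_cst.
Qed.

Lemma bounded_rintable f (M : R) : measurable_fun A f ->
  (forall x, A x -> `|f x| <= M) -> rintable f.
Proof. by move=> mf fM; apply: le_rintable (rintable_cst M). Qed.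

Lemma bounded_sqintable f (M : R) : measurable_fun A f ->
  (forall x, A x -> `|f x| <= M) -> sqintable f.
Proof.
move=> mf fM; split=> //; apply: (@bounded_rintable _ (M ^+ 2)).
  exact: measurable_funX.
move=> x Ax; rewrite normrX ler_sqr ?nnegrE//; first exact: fM.
exact: le_trans (fM x Ax).
Qed.

End real_integrals.

(** * Fiber integrals over a cylinder *)

Section fiber.
Context {R : realType} {m : nat}.
Variable D : set 'rV[R]_m.
Hypothesis mD : measurable D.
Notation leb := (@lebesgue_measure R).
Notation I01 := (`]0, 1[%classic : set (measurableTypeR R)).

Lemma cylinder_measurable : measurable (cylinder D).
Proof.
have -> : cylinder D =
    (fun x : 'rV[R]_m.+1 => (col' ord_max x, x ord0 ord_max : measurableTypeR R))
      @^-1` (D `*` `]0, 1[).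
  by apply/seteqP; split=> x [/= xD x01]; split=> //=; rewrite in_itv in x01 *.
rewrite -[X in measurable X]setTI; apply: measurable_row_split => //.
by apply: measurableX => //; exact: measurable_itv.
Qed.

Lemma cylinder_snoc x t : cylinder D (row_snoc (x, t)) <-> D x /\ 0 < t < 1.
Proof. by rewrite /cylinder /= col'_row_snoc row_snoc_max. Qed.

Let g (f : 'rV[R]_m.+1 -> R) := (EFin \o f) \_ (cylinder D).

Let gE f x t : D x -> g f (row_snoc (x, t)) =
  ((fun t => (f (row_snoc (x, t)))%:E) \_ I01) t.
Proof.
move=> Dx; rewrite /g /patch; case: ifPn => [/set_mem/cylinder_snoc[_ t01]|].
  by rewrite ifT//; apply: mem_set; rewrite /= in_itv.
move=> /negP nt; rewrite ifF//; apply/negP => /set_mem; rewrite /= in_itv/= => t01.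
by apply: nt; apply: mem_set; apply/cylinder_snoc.
Qed.

Let gF f x : D x -> (\int[leb]_t g f (row_snoc (x, t)) =
  \int[leb]_(t in I01) (f (row_snoc (x, t)))%:E)%E.
Proof.
move=> Dx; rewrite [RHS]integral_mkcond; apply: eq_integral => t _; exact: gE.
Qed.

Variable f : 'rV[R]_m.+1 -> R.
Hypothesis fi : rintable (lebesgue_row m.+1) (cylinder D) f.

Let gi : (lebesgue_row m.+1).-integrable [set: 'rV[R]_m.+1] (g f).
Proof. exact: (iffLR (integrable_mkcond _ cylinder_measurable) fi). Qed.

(** Kept in [\bar R], since Fubini makes it finite only for almost every [x]. Where it is infinite,
    [fiber_integral] is 0, the value of [fine] there. *)
Let F x := (\int[leb]_t g f (row_snoc (x, t)))%E.

Let Fi : (lebesgue_row m).-integrable [set: 'rV[R]_m] F.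
Proof. exact: (integrable_fubini_F (integrable_rowS gi)). Qed.

Let fibE x : D x -> fiber_integral f x = fine (F x).
Proof. by move=> Dx; rewrite /fiber_integral /Rintegral /F gF. Qed.

Let FDi : (lebesgue_row m).-integrable D F.
Proof. exact: integrableS Fi. Qed.

Let fineFi : (lebesgue_row m).-integrable D (fun x => (fine (F x))%:E).
Proof.
apply: le_integrable FDi => //.
  apply/measurable_EFinP; apply: (@measurableT_comp _ _ _ _ _ _ fine) => //.
  exact: measurable_int FDi.
by move=> x _; case: (F x) => [r||]; rewrite /= ?normr0 ?lexx ?leey.
Qed.

Lemma fiber_rintable : rintable (lebesgue_row m) D (fiber_integral f).
Proof.
by apply: eq_integrable fineFi => // x /set_mem Dx; rewrite /= fibE.
Qed.

Lemma rint_fiber : \int[lebesgue_row m.+1]_(x in cylinder D) f x =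
  \int[lebesgue_row m]_(x in D) fiber_integral f x.
Proof.
rewrite /Rintegral integral_mkcond integral_rowS//.
congr fine; transitivity (\int[lebesgue_row m]_(x in D) F x)%E.
  rewrite [RHS]integral_mkcond; apply: eq_integral => x _.
  rewrite /patch; case: ifPn => // /negP nx.
  under eq_integral => t _.
    rewrite /g /patch ifF; first over.
    apply/negP => /set_mem/cylinder_snoc[Dx _]; apply: nx; exact: mem_set.
  by rewrite integral0.
apply: ae_eq_integral => //; first exact: measurable_int FDi.
  exact: measurable_int fiber_rintable.
have := integrable_ae mD FDi; apply: filterS => x /= h Dx.
by rewrite fibE// fineK// h.
Qed.

Lemma ae_fiber_rintable : {ae lebesgue_row m, forall x, D x ->
  rintable leb I01 (fun t => f (row_snoc (x, t)))}.
Proof.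
have := ae_integrable1 (integrable_rowS gi); apply: filterS => x /= h Dx.
have mI : measurable I01 by exact: measurable_itv.
rewrite /rintable; apply: (iffRL (integrable_mkcond _ mI)).
by apply: eq_integrable h => // t _ /=; rewrite gE.
Qed.

End fiber.

(** * Test functions and their slices *)

Section slices.
Context {R : realType}.

Lemma differentiable_row (V : normedModType R) n (L : V -> 'rV[R]_n) (x : V) :
  (forall i, differentiable (fun y => L y ord0 i) x) -> differentiable L x.
Proof.
move=> dL.
have -> : L = \sum_(i < n) (fun y => L y ord0 i *: (delta_mx ord0 i : 'rV[R]_n)).
  apply/funext => y; rewrite fct_sumE [LHS]row_sum_delta.
  by apply: eq_bigr.
apply: differentiable_sum => i; exact: differentiableZl.
Qed.

Context {m : nat}.
Implicit Types (f : 'rV[R]_m.+1 -> R) (h : 'rV[R]_m -> R).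

Lemma differentiable_col' (x : 'rV[R]_m.+1) :
  differentiable (fun y : 'rV[R]_m.+1 => col' ord_max y : 'rV[R]_m) x.
Proof.
apply: differentiable_row => i; under eq_fun do rewrite mxE.
exact: differentiable_coord.
Qed.

Lemma differentiable_row_snoc t (x : 'rV[R]_m) :
  differentiable (fun y : 'rV[R]_m => row_snoc (y, t)) x.
Proof.
apply: differentiable_row => i; under eq_fun do rewrite mxE.
case: unliftP => [j _|_] /=; first exact: differentiable_coord.
exact: differentiable_cst.
Qed.

Lemma row_snoc_affine t (x v : 'rV[R]_m) (a : R) :
  row_snoc (a *: v + x, t) = a *: row_snoc (v, 0) + row_snoc (x, t).
Proof.
apply/rowP => i; rewrite !mxE; case: unliftP => [j _|_] /=; first by rewrite !mxE.
by rewrite mulr0 add0r.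
Qed.

Lemma row_snoc_delta j :
  row_snoc (delta_mx ord0 j : 'rV[R]_m, 0) = delta_mx ord0 (lift ord_max j).
Proof.
apply/rowP => i; rewrite !mxE eqxx/=; case: unliftP => [k ->|->] /=.
  by rewrite !mxE eqxx/= (inj_eq (@lift_inj _ _)).
by rewrite (negbTE (neq_lift _ _)).
Qed.

Lemma col'_affine (x v : 'rV[R]_m.+1) (a : R) :
  col' ord_max (a *: v + x) = a *: col' ord_max v + col' ord_max x.
Proof. by apply/rowP => i; rewrite !mxE. Qed.

Lemma smooth_slice f t : smooth f -> smooth (fun x => f (row_snoc (x, t))).
Proof.
apply: (@smooth_affine _ _ _ (fun x => row_snoc (x, t))
  (fun v => row_snoc (v, 0)) _ _ (fun j => Some (lift ord_max j))).
- by move=> x v h; rewrite row_snoc_affine.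
- exact: differentiable_row_snoc.
- by move=> j; rewrite row_snoc_delta.
Qed.

Lemma partial_slice f t j x : partial j (fun x => f (row_snoc (x, t))) x =
  partial (lift ord_max j) f (row_snoc (x, t)).
Proof.
rewrite /partial -row_snoc_delta.
rewrite -(@derive_affine _ _ _ (fun x => row_snoc (x, t)) (fun v => row_snoc (v, 0)))//.
by move=> y v a; rewrite row_snoc_affine.
Qed.

Lemma smooth_col' h : smooth h -> smooth (h \o (fun y : 'rV[R]_m.+1 => col' ord_max y)).
Proof.
apply: (@smooth_affine _ _ _ _ (fun v => col' ord_max v) _ _
  (fun j => unlift ord_max j)).
- by move=> x v a; rewrite col'_affine.
- exact: differentiable_col'.
move=> j; case: unliftP => [k|] -> /=; apply/rowP => i; rewrite !mxE eqxx/=.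
  by rewrite (inj_eq (@lift_inj _ _)).
by rewrite eq_sym (negbTE (neq_lift _ _)).
Qed.

Lemma row_snoc_deltaE x (t a : R) :
  row_snoc (x, a + t) = a *: delta_mx ord0 ord_max + row_snoc (x, t) :> 'rV[R]_m.+1.
Proof.
apply/rowP => i; rewrite !mxE eqxx/=; case: unliftP => [k ->|->] /=.
  by rewrite eq_sym (negbTE (neq_lift _ _)) mulr0 add0r.
by rewrite eqxx mulr1.
Qed.

Lemma derive1_fiber f x (t : R) :
  derive1 (fun s : R => f (row_snoc (x, s))) t = partial ord_max f (row_snoc (x, t)).
Proof.
rewrite derive1E /partial /derive; do 2 f_equal; apply/funext => a /=.
by rewrite /GRing.scale/= mulr1 row_snoc_deltaE.
Qed.

Lemma differentiable_fiber_snoc x (t : R) :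
  differentiable (fun s : R => row_snoc (x, s) : 'rV[R]_m.+1) t.
Proof.
apply: differentiable_row => i; under eq_fun do rewrite mxE.
case: unliftP => [j _|_] /=; first exact: differentiable_cst.
by apply/derivable1_diffP; exact: derivable_id.
Qed.

Lemma derivable_fiber f x (t : R) : smooth f ->
  derivable (fun s : R => f (row_snoc (x, s))) t 1.
Proof.
move=> sf; apply/derivable1_diffP.
apply: (@differentiable_comp _ _ _ _ (fun s : R => row_snoc (x, s))).
  exact: differentiable_fiber_snoc.
exact: smooth_differentiable.
Qed.

Lemma fiber_snoc_continuous x : continuous (fun s : R => row_snoc (x, s) : 'rV[R]_m.+1).
Proof.
by move=> t; apply: differentiable_continuous; exact: differentiable_fiber_snoc.
Qed.

Lemma continuous_fiber f x : continuous f -> continuous (fun s : R => f (row_snoc (x, s))).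
Proof.
move=> cf t; apply: (@continuous_comp _ _ _ (fun s : R => row_snoc (x, s))).
  exact: fiber_snoc_continuous.
exact: cf.
Qed.

Lemma col'_continuous : continuous (fun y : 'rV[R]_m.+1 => col' ord_max y : 'rV[R]_m).
Proof.
by move=> t; apply: differentiable_continuous; exact: differentiable_col'.
Qed.

End slices.

Section test_functions.
Context {R : realType} {n : nat}.
Implicit Types (A : set 'rV[R]_n) (f g phi : 'rV[R]_n -> R).

Lemma test_functionD A f g : test_function A f -> test_function A g ->
  test_function A (fun x => f x + g x).
Proof.
move=> [sf [K [cK KA fK]]] [sg [L [cL LA gL]]]; split; first exact: smoothD.
exists (K `|` L); split; first exact: compactU.
  by move=> x [/KA|/LA].
by move=> x /not_orP[nK nL]; rewrite fK// gL// addr0.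
Qed.

Lemma test_functionZ A (a : R) f : test_function A f ->
  test_function A (fun x => a * f x).
Proof.
move=> [sf [K [cK KA fK]]]; split; first exact: smoothZ.
by exists K; split => // x nK; rewrite fK// mulr0.
Qed.

Lemma test_functionB A f g : test_function A f -> test_function A g ->
  test_function A (fun x => f x - g x).
Proof.
move=> tf tg; have := test_functionD tf (test_functionZ (-1) tg).
by under eq_fun do rewrite mulN1r.
Qed.

Lemma test_functionM A f g : test_function A f -> test_function A g ->
  test_function A (fun x => f x * g x).
Proof.
move=> [sf [K [cK KA fK]]] [sg _]; split; first exact: smoothM.
by exists K; split => // x nK; rewrite fK// mul0r.
Qed.

Lemma test_function_partial A i f : test_function A f ->
  test_function A (partial i f).
Proof.
move=> [sf [K [cK KA fK]]]; split; first exact: smooth_partial.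
exists K; split => // x nK.
have oK : open (~` K).
  by apply: closed_openC; apply: compact_closed => //; exact: norm_hausdorff.
rewrite /partial -(@derive_cst _ _ _ (0 : R) x (delta_mx ord0 i)).
apply: near_eq_derive.
have : nbhs x (~` K) by apply: open_nbhs_nbhs.
by apply: filterS => y nKy; rewrite fK.
Qed.

Lemma test_function_out A f x : test_function A f -> ~ A x -> f x = 0.
Proof. by move=> [_ [K [_ KA fK]]] nA; apply: fK => /KA. Qed.

Lemma test_function_continuous A f : test_function A f -> continuous f.
Proof. by move=> [/smooth_continuous]. Qed.

Lemma test_function_bounded A f : test_function A f ->
  exists2 M : R, 0 < M & forall x, `|f x| <= M.
Proof.
move=> tf; have [_ [K [cK KA fK]]] := tf.
have cfK : {within K, continuous f}.
  by apply: continuous_subspaceT; exact: test_function_continuous tf.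
have := compact_bounded (continuous_compact cfK cK) => -[M [Mr KM]].
exists (`|M| + 1); first by rewrite ltr_wpDl.
move=> x; have [Kx|nKx] := pselect (K x); last by rewrite fK// normr0 addr_ge0.
by apply: KM; [rewrite (le_lt_trans (ler_norm M))// ltrDl|exists x].
Qed.

Lemma test_function_measurable A f : test_function A f ->
  measurable_fun [set: 'rV[R]_n] f.
Proof. by move=> /test_function_continuous; exact: continuous_row_measurable. Qed.

Lemma test_function_sqintable A B f : measurable B ->
  (lebesgue_row n B < +oo)%E -> test_function A f ->
  sqintable (lebesgue_row n) B f.
Proof.
move=> mB Boo tf; have [M _ fM] := test_function_bounded tf.
apply: (@bounded_sqintable _ _ _ _ _ mB Boo _ M) => //.
exact: measurable_funTS (test_function_measurable tf).
Qed.

Lemma test_function_rintableT A f : test_function A f ->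
  rintable (lebesgue_row n) setT f.
Proof.
move=> tf; have [_ [K [cK KA fK]]] := tf.
have [M KM] := bounded_row_cube (compact_bounded cK).
have mQ := @row_cube_measurable R n M.
have iQ : rintable (lebesgue_row n) (row_cube n M) f.
  apply: sqintable_rintable => //; first exact: row_cube_finite.
  by apply: test_function_sqintable tf => //; exact: row_cube_finite.
have := iffLR (integrable_mkcond _ mQ) iQ.
apply: eq_integrable => // x _; rewrite /patch; case: ifPn => // /negP nx.
by rewrite /= fK// => /KM Kx; apply: nx; exact: mem_set.
Qed.

End test_functions.

Section slice_test.
Context {R : realType} {m : nat}.

Lemma test_function_slice (A : set 'rV[R]_m.+1) (f : 'rV[R]_m.+1 -> R) t :
  test_function A f ->
  test_function [set: 'rV[R]_m] (fun x => f (row_snoc (x, t))).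
Proof.
move=> [sf [K [cK KA fK]]]; split; first exact: smooth_slice.
exists ((fun y : 'rV[R]_m.+1 => col' ord_max y) @` K); split => //.
  apply: continuous_compact => //; apply: continuous_subspaceT.
  exact: col'_continuous.
move=> x nx; apply: fK => Kx; apply: nx; exists (row_snoc (x, t)) => //.
by rewrite col'_row_snoc.
Qed.

Lemma integral_fiber_partial0 (A : set 'rV[R]_m.+1) (f : 'rV[R]_m.+1 -> R) x :
  test_function A f ->
  (\int[@lebesgue_measure R]_t (partial ord_max f (row_snoc (x, t)))%:E = 0)%E.
Proof.
move=> tf; have tp := test_function_partial ord_max tf.
have [sf [K [cK _ fK]]] := tf; have [M KM] := bounded_row_cube (compact_bounded cK).
have KM' y t : K (row_snoc (y, t)) -> - M <= t <= M.
  by move=> /KM/(_ ord_max I); rewrite /= /row_coord row_snoc_max in_itv.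
have [_ [L [cL _ pL]]] := tp; have [M' LM] := bounded_row_cube (compact_bounded cL).
have LM' y t : L (row_snoc (y, t)) -> - M' <= t <= M'.
  by move=> /LM/(_ ord_max I); rewrite /= /row_coord row_snoc_max in_itv.
(* The compact sets found for [f] and for its derivative are unrelated. The interval [[-a, a]]
   contains both fibers, and strictly the first, so that [f] vanishes at its endpoints. *)
pose a : R := `|M| + `|M'| + 1.
have [Ma M'a] : M < a /\ M' < a.
  by rewrite /a; have := ler_norm M; have := ler_norm M';
    have := normr_ge0 M; have := normr_ge0 M'; split; lra.
have a0 : 0 < a by rewrite /a ltr_wpDl// addr_ge0.
have -> : (\int[@lebesgue_measure R]_t (partial ord_max f (row_snoc (x, t)))%:E =
   \int[@lebesgue_measure R]_(t in `[(- a)%R, a]) (partial ord_max f (row_snoc (x, t)))%:E)%E.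
  rewrite [RHS]integral_mkcond; apply: eq_integral => t _.
  rewrite /patch; case: ifPn => // /negP nt; rewrite pL// => /LM' /andP[t1 t2].
  by apply: nt; apply: mem_set; rewrite /= in_itv/=; apply/andP; split; lra.
rewrite (@continuous_FTC2 _ _ (fun t => f (row_snoc (x, t)))).
- by rewrite !fK ?sube0//; move=> /KM' /andP[]; lra.
- by rewrite gtrN.
- apply: continuous_subspaceT; apply: continuous_fiber.
  exact: test_function_continuous tp.
- split.
  + by move=> t _; exact: derivable_fiber.
  + apply: cvg_at_right_filter; apply: continuous_fiber.
    exact: smooth_continuous.
  + apply: cvg_at_left_filter; apply: continuous_fiber.
    exact: smooth_continuous.
- by move=> t _; rewrite derive1_fiber.
Qed.

End slice_test.

(** * Integration by parts for test functions *)

Section divergence.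
Context {R : realType}.

(** Along the last coordinate each fiber already contributes 0 by the fundamental theorem of
    calculus. Along another one, exchanging the integrals leaves a slice of one dimension less. *)
Lemma integral_partial0 n (A : set 'rV[R]_n) (f : 'rV[R]_n -> R) i :
  test_function A f -> (\int[lebesgue_row n]_x (partial i f x)%:E = 0)%E.
Proof.
elim: n A f i => [A f []//|m ih] A f i tf.
have fi := test_function_rintableT (test_function_partial i tf).
case: (unliftP ord_max i) fi => [j|] -> fi.
  rewrite (integral_rowS_swap fi).
  under eq_integral => t _.
    under eq_integral do rewrite /= -partial_slice.
    rewrite (ih _ _ _ (test_function_slice t tf)); over.
  by rewrite integral0.
rewrite (integral_rowS fi).
under eq_integral do rewrite /= (integral_fiber_partial0 _ tf).
by rewrite integral0.
Qed.

Lemma rint_partial0 n (A : set 'rV[R]_n) (f : 'rV[R]_n -> R) i :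
  test_function A f -> \int[lebesgue_row n]_(x in A) partial i f x = 0.
Proof.
move=> tf; rewrite Rintegral_mkcond /Rintegral.
under eq_integral => x _.
  rewrite (_ : patch _ _ _ _ = partial i f x); last first.
    rewrite /patch; case: ifPn => // /negP nA.
    rewrite (test_function_out (test_function_partial i tf))// => Ax.
    by apply: nA; exact: mem_set.
  over.
by rewrite (integral_partial0 _ tf).
Qed.

Lemma test_function_weak_partial n (A : set 'rV[R]_n) (f : 'rV[R]_n -> R) i :
  measurable A -> (lebesgue_row n A < +oo)%E ->
  test_function A f -> weak_partial A i f (partial i f).
Proof.
move=> mA Aoo tf phi tphi.
have := rint_partial0 i (test_functionM tf tphi).
rewrite partialM; last 2 first.
- by move=> x; apply: smooth_differentiable; case: tf.
- by move=> x; apply: smooth_differentiable; case: tphi.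
have sq g : test_function A g -> sqintable (lebesgue_row n) A g.
  exact: test_function_sqintable.
rewrite rintD//.
- under [X in _ + X]eq_Rintegral do rewrite mulrC.
  by move=> /eqP; rewrite addr_eq0 => /eqP.
- by apply: sqintableM => //; apply: sq => //; exact: test_function_partial.
- by apply: sqintableM => //; apply: sq => //; exact: test_function_partial.
Qed.

End divergence.

(** * Chains of averages *)

Section chain.
Context {R : realType}.
Implicit Types (r f g y b : nat -> R) (L : nat).

(** With [r] in the role of the distance [s] to the middle of the fiber, this is the primitive of
    [s^2]. *)
Fixpoint chain_weight r (q : nat) : R :=
  if q is p.+1 then chain_weight r p + r p ^+ 2 else 0.

Lemma chain_weight_ge0 r q : 0 <= chain_weight r q.
Proof. by elim: q => //= q ih; rewrite addr_ge0// sqr_ge0. Qed.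

Lemma chain_weight_gt0 r q : (forall p, 0 < r p) -> 0 < chain_weight r q.+1.
Proof.
by move=> r0; rewrite /= ltr_wpDl ?chain_weight_ge0// exprn_gt0.
Qed.

Fixpoint chain_moment r f (q : nat) : R :=
  if q is p.+1 then chain_moment r f p + r p * (f p - f p.+1) else 0.

(** Increments of [r], preceded by the value 0: the quadrature weights of the nodes. *)
Definition chain_mass r (q : nat) : R := if q is p.+1 then r q - r p else r q.

Lemma sum_chain_mass r L : \sum_(q < L.+1) chain_mass r q = r L.
Proof.
elim: L => [|L ih]; first by rewrite big_ord1.
by rewrite big_ord_recr/= ih addrC subrK.
Qed.

Lemma chain_momentE r f L :
  chain_moment r f L.+1 =
  \sum_(q < L.+1) chain_mass r q * f q - r L * f L.+1.
Proof.
elim: L => [|L ih]; first by rewrite big_ord1/=; ring.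
rewrite [LHS]/= -/(chain_moment r f L.+1) ih [in RHS]big_ord_recr/=; ring.
Qed.

(* With [w = chain_weight r] and [M = chain_moment r f], the difference
   [f q - f q.+1] is [(M q.+1 - M q) / r q] and [r q ^+ 2 = w q.+1 - w q]; so
   the energy [\sum (f q - f q.+1) (g q - g q.+1)] is a Dirichlet form in the
   averages [M q / w q]. *)
Lemma chain_spring_ge0 r e z L : (forall q, 0 < r q) ->
  (forall q, (q <= L)%N -> 0 <= e q * z q) ->
  (forall q, 0 <= (e q.+1 - e q) * (z q.+1 - z q)) ->
  0 <= \sum_(q < L)
    ((chain_weight r q.+1 * e q.+1 - chain_weight r q * e q) / r q *
     ((chain_weight r q.+1 * z q.+1 - chain_weight r q * z q) / r q)).
Proof.
move=> r0 ez dez; set w := chain_weight r.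
(* Discrete form of [(w e)' (w z)' / w' = (w e z)' + w^2 e' z' / w']. The boundary term [w e z] is
   carried along by the induction. *)
suff H p : (p <= L)%N -> w p * (e p * z p) <= \sum_(q < p)
    ((w q.+1 * e q.+1 - w q * e q) / r q *
     ((w q.+1 * z q.+1 - w q * z q) / r q)).
  by apply: le_trans (H L _) => //; rewrite mulr_ge0 ?chain_weight_ge0 ?ez.
elim: p => [|p ih] pL; first by rewrite big_ord0 /w/= mul0r.
rewrite big_ord_recr/=; apply: le_trans (lerD (ih (ltnW pL)) (lexx _)).
have w0 : 0 <= w p by exact: chain_weight_ge0.
have wS : w p.+1 = w p + r p ^+ 2 by [].
have rp := r0 p; have := dez p.
move: (w p) (w p.+1) (r p) (e p) (e p.+1) (z p) (z p.+1) w0 wS rp => W W1 t a a1 c c1 W0 -> t0 H.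
have -> : ((W + t ^+ 2) * a1 - W * a) / t * (((W + t ^+ 2) * c1 - W * c) / t) =
  (W + t ^+ 2) * (a1 * c1) - W * (a * c) +
  W * (W + t ^+ 2) / t ^+ 2 * ((a1 - a) * (c1 - c)).
  by field; rewrite gt_eqF.
have : 0 <= W * (W + t ^+ 2) / t ^+ 2 * ((a1 - a) * (c1 - c)).
  by rewrite mulr_ge0// divr_ge0 ?sqr_ge0// mulr_ge0// addr_ge0// sqr_ge0.
by lra.
Qed.

(** If [Phi] and [Gamma] are the integrals of [f] and [g] over [[0, s]], then
    [(Phi Gamma / s)' = f g - Mf Mg / s^2]. As [f] and [g] vanish at the end, the boundary term is
    also a product of moments, so every contribution is nonnegative. *)
Lemma chain_mass_ge0 r f g L :
  (forall q, 0 < r q) -> (forall q, 0 <= chain_mass r q) ->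
  f L.+1 = 0 -> g L.+1 = 0 ->
  (forall q, (q <= L.+1)%N -> 0 <= chain_moment r f q * chain_moment r g q) ->
  0 <= \sum_(q < L.+1) chain_mass r q * (f q * g q).
Proof.
move=> r0 m0 fL gL MM.
set Mf := chain_moment r f in MM *; set Mg := chain_moment r g in MM *.
pose Phi p := \sum_(q < p) chain_mass r q * f q.
have MfE p : Mf p.+1 = Phi p.+1 - r p * f p.+1 by exact: chain_momentE.
(* The second factor is the average [Gamma / s] of [g], so the left side is [Phi Gamma / s]. *)
suff H p : (p <= L)%N -> Phi p.+1 * (g p.+1 + Mg p.+1 / r p) <=
    \sum_(q < p.+1) chain_mass r q * (f q * g q).
  apply: le_trans (H L _) => //.
  suff -> : Phi L.+1 * (g L.+1 + Mg L.+1 / r L) = Mf L.+1 * Mg L.+1 / r L.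
    by rewrite divr_ge0 ?MM// ltW.
  by rewrite MfE fL gL mulr0 subr0 add0r mulrA.
elim: p => [_|p ih pL].
  rewrite /Phi !big_ord1 /Mg/= add0r.
  have -> : r 0%N * (g 0%N - g 1%N) / r 0%N = g 0%N - g 1%N.
    by field; rewrite gt_eqF.
  by rewrite addrCA subrr addr0 mulrA.
rewrite big_ord_recr/=; apply: le_trans (lerD (ih (ltnW pL)) (lexx _)).
have MgS : Mg p.+2 = Mg p.+1 + r p.+1 * (g p.+1 - g p.+2) by [].
have PhiS : Phi p.+2 = Phi p.+1 + (r p.+1 - r p) * f p.+1.
  by rewrite /Phi big_ord_recr.
have mp : 0 <= r p.+1 - r p by have := m0 p.+1.
rewrite PhiS MgS; have := MM p.+1 (leqW pL); rewrite MfE.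
move: (r0 p) (r0 p.+1) mp.
move: (r p) (r p.+1) (Phi p.+1) (Mg p.+1) (f p.+1) (g p.+1) (g p.+2).
move=> a b P M f1 g1 g2 a0 b0 ab H.
rewrite -subr_ge0.
have -> : P * (g1 + M / a) + (b - a) * (f1 * g1) -
    (P + (b - a) * f1) * (g2 + (M + b * (g1 - g2)) / b) =
    (b - a) / (a * b) * ((P - a * f1) * M).
  by field; rewrite !gt_eqF.
by rewrite mulr_ge0// divr_ge0// mulr_ge0// ltW.
Qed.

End chain.

(** * A smooth substitute for the truncated positive part *)

Section softplus.
Context {R : realType}.
Variables (c e : R).
Hypotheses (c0 : 0 <= c) (e0 : 0 < e).

(* A smooth approximation of [fun s => Num.max (s - c) 0] that vanishes at 0. *)
Definition soft (s : R) : R :=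
  2^-1 * ((s - c) + Num.sqrt ((s - c) ^+ 2 + e ^+ 2)) -
  2^-1 * (- c + Num.sqrt (c ^+ 2 + e ^+ 2)).

Lemma soft0 : soft 0 = 0.
Proof. by rewrite /soft sub0r sqrrN subrr. Qed.

Let rad_gt0 (a : R) : 0 < a ^+ 2 + e ^+ 2.
Proof. by rewrite ltr_wpDl ?sqr_ge0// exprn_gt0. Qed.

Let norm_le_sqrt (a : R) : `|a| <= Num.sqrt (a ^+ 2 + e ^+ 2).
Proof. by rewrite -sqrtr_sqr ler_sqrt ?lerDl ?sqr_ge0// ltW. Qed.

Let sqrt_le_norm (a : R) : Num.sqrt (a ^+ 2 + e ^+ 2) <= `|a| + e.
Proof.
apply: le_trans (_ : Num.sqrt ((`|a| + e) ^+ 2) <= _); last first.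
  by rewrite sqrtr_sqr ger0_norm// addr_ge0// ltW.
rewrite ler_sqrt ?sqr_ge0//.
rewrite sqrrD real_normK ?num_real//.
have : 0 <= `|a| * e by rewrite mulr_ge0// ltW.
by rewrite mulr2n; lra.
Qed.

Lemma soft_approx s : `|soft s - Num.max (s - c) 0| <= e.
Proof.
rewrite /soft; have := norm_le_sqrt (s - c); have := sqrt_le_norm (s - c).
have := norm_le_sqrt c; have := sqrt_le_norm c.
rewrite (ger0_norm c0); move: (Num.sqrt _) (Num.sqrt _) => A B h1 h2 h3 h4.
rewrite ler_norml /Num.max; case: ifPn => h.
  by move: h3 h4; rewrite ltr0_norm// => *; apply/andP; split; lra.
by move: h3 h4; rewrite ger0_norm ?leNgt// => *; apply/andP; split; lra.
Qed.

Definition dsoft (s : R) : R :=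
  2^-1 * (1 + (s - c) / Num.sqrt ((s - c) ^+ 2 + e ^+ 2)).

Lemma is_derive_soft (s : R) : is_derive s 1 soft (dsoft s).
Proof.
have dd : is_derive s 1 (fun t : R => t - c) 1.
  have -> : (fun t : R => t - c) = id - cst c by [].
  by apply: is_derive_eq; rewrite subr0.
have dq : is_derive s 1 (fun t : R => (t - c) ^+ 2 + e ^+ 2) (2 * (s - c)).
  have -> : (fun t : R => (t - c) ^+ 2 + e ^+ 2) =
      (fun t : R => t - c) * (fun t : R => t - c) + cst (e ^+ 2).
    by apply/funext => t; rewrite [RHS]/GRing.add/= [in RHS]/GRing.mul/= expr2.
  by apply: is_derive_eq; rewrite /GRing.scale/=; ring.
have ds := @is_derive1_comp R Num.sqrt (fun t : R => (t - c) ^+ 2 + e ^+ 2) s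
  _ _ (is_derive1_sqrt (rad_gt0 (s - c))) dq.
have -> : soft = 2^-1 *: ((fun t : R => t - c) +
    (Num.sqrt \o (fun t : R => (t - c) ^+ 2 + e ^+ 2))) -
    cst (2^-1 * (- c + Num.sqrt (c ^+ 2 + e ^+ 2))) by [].
apply: is_derive_eq; rewrite subr0 /GRing.scale/= /dsoft; congr (_ * (_ + _)).
by field; rewrite gt_eqF// sqrtr_gt0.
Qed.

Lemma dsoft_ge0 s : 0 <= dsoft s.
Proof.
rewrite mulr_ge0// -lerBlDl sub0r ler_pdivlMr ?sqrtr_gt0// mulN1r lerNl.
by apply: le_trans (norm_le_sqrt _); rewrite -normrN ler_norm.
Qed.

Lemma dsoft_le1 s : dsoft s <= 1.
Proof.
rewrite ler_pdivrMl// mulr1 -lerBrDl ler_pdivrMr ?sqrtr_gt0//.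
have := le_trans (ler_norm _) (norm_le_sqrt (s - c)); lra.
Qed.

Lemma soft_lipschitz s t : s <= t -> 0 <= soft t - soft s <= t - s.
Proof.
move=> st.
have cs : {within `[s, t], continuous soft}.
  apply: continuous_subspaceT => x; apply: differentiable_continuous.
  by apply/derivable1_diffP; have [] := is_derive_soft x.
have [x _ ->] := MVT_segment st (fun x _ => is_derive_soft x) cs.
by rewrite mulr_ge0 ?dsoft_ge0 ?subr_ge0//= ler_piMl ?subr_ge0// dsoft_le1.
Qed.

Lemma smooth_soft n (f : 'rV[R]_n -> R) : smooth f -> smooth (soft \o f).
Proof.
move=> sf; have s1 : smooth (fun x => f x - c).
  by apply: smoothB => //; exact: smooth_cst.
apply: smoothB; last exact: smooth_cst.
apply: smoothZ; apply: smoothD => //.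
apply: (@smooth_sqrt _ _ (fun x => (f x - c) ^+ 2 + e ^+ 2)) => //.
apply: smoothD; last exact: smooth_cst.
by under eq_fun do rewrite expr2; exact: smoothM.
Qed.

Lemma partial_soft n (f : 'rV[R]_n -> R) i x : smooth f ->
  partial i (soft \o f) x = dsoft (f x) * partial i f x.
Proof.
move=> sf; have [d1 d2] := is_derive_soft (f x).
by rewrite partial_comp//; [rewrite derive1E d2|exact: smooth_differentiable].
Qed.

End softplus.

(** * Quadrature on a fiber *)

Section one_dim.
Context {R : realType}.
Notation leb := (@lebesgue_measure R).
Notation I01 := (`]0, 1[%classic : set (measurableTypeR R)).
Notation half := (`[0, 2^-1]%classic : set (measurableTypeR R)).

Lemma measurable_I01 : measurable I01. Proof. exact: measurable_itv. Qed.
Lemma measurable_half : measurable half. Proof. exact: measurable_itv. Qed.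

Lemma continuous_rintable_cc (F : R -> R) (a b : R) : continuous F ->
  rintable leb (`[a, b]%classic : set (measurableTypeR R)) F.
Proof.
move=> cF; apply: continuous_compact_integrable; first exact: segment_compact.
exact: continuous_subspaceT.
Qed.

Lemma continuous_rintable01 (F : R -> R) : continuous F -> rintable leb I01 F.
Proof.
move=> cF; apply: integrableS (continuous_rintable_cc 0 1 cF) => //.
by apply: subset_itvW; rewrite lexx.
Qed.

Lemma continuous_rintable_half (F : R -> R) : continuous F -> rintable leb half F.
Proof. exact: continuous_rintable_cc. Qed.

Lemma continuous_onem (F : R -> R) : continuous F ->
  continuous (fun t : R => F (1 - t)).
Proof.
move=> cF t; apply: (@continuous_comp _ _ _ (fun t : R => 1 - t)); last exact: cF.
by apply: cvgB; [exact: cvg_cst|exact: cvg_id].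
Qed.

Lemma fold_half (F : R -> R) : continuous F ->
  \int[leb]_(t in I01) F t = \int[leb]_(t in half) (F t + F (1 - t)).
Proof.
move=> cF.
have i01 := continuous_rintable_cc 0 1 cF.
have ioc : rintable leb (`]0, 1]%classic : set (measurableTypeR R)) F.
  apply: integrableS i01 => // t; rewrite /= !in_itv/= => /andP[t0 ->].
  by rewrite ltW.
rewrite (Rintegral_itv_bndo_bndc (continuous_rintable01 cF)).
rewrite (Rintegral_itv_obnd_cbnd ioc).
rewrite rintD//; first last.
- exact/continuous_rintable_half/continuous_onem.
- exact: continuous_rintable_half.
have -> : \int[leb]_(t in half) F (1 - t) = \int[leb]_(t in `[2^-1, 1]) F t.
  have := @Rintegration_by_substitution_onem R (fun t => F (1 - t)) 2^-1.
  move=> ->.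
  - rewrite /unstable.onem [X in `[X, _]](_ : _ = 2^-1); last by lra.
    by apply: eq_Rintegral => t _; rewrite opprB addrCA subrr addr0.
  - by apply/andP; split; lra.
  - by apply: continuous_subspaceT; exact: continuous_onem.
have := @Rintegral_itvB _ F (BLeft 0) (BRight 1) 2^-1 i01.
rewrite !bnd_simp invr_ge0 ler0n => /(_ isT) E.
have {}E := E (_ : (2^-1 <= 1 :> R)); move: E; rewrite invf_le1// ler1n.
move=> /(_ isT)/eqP; rewrite subr_eq => /eqP ->.
rewrite addrC; congr (_ + _); apply: Rintegral_itv_obnd_cbnd.
apply: integrableS (continuous_rintable_cc 2^-1 1 cF) => // t.
by rewrite /= !in_itv/= => /andP[t0 ->]; rewrite ltW.
Qed.

Variables (L : nat) (h : R).
Hypotheses (h0 : 0 < h) (hL : L.+1%:R * h = 2^-1).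

(** Nodes are numbered from the middle outwards: node 0 is one cell away from 1/2, and [hL] puts
    node [L] at the end 0 of the fiber. [ramp q] rises from 0 to 1 in the cell between the nodes
    [q.+1] and [q]. *)
Definition lnode (q : nat) : R := 2^-1 - q.+1%:R * h.

Definition ramp (q : nat) (t : R) : R := step ((t - lnode q.+1) / h).

Lemma lnodeS q : lnode q = lnode q.+1 + h.
Proof. by rewrite /lnode -[q.+2]addn1 natrD; ring. Qed.

Lemma lnode_le q : (q <= L)%N -> 0 <= lnode q.
Proof.
by move=> qL; rewrite /lnode subr_ge0 -hL ler_pM2r// ler_nat ltnS.
Qed.

Lemma lnode0E : 2^-1 = lnode 0 + h.
Proof. by rewrite /lnode mul1r subrK. Qed.

Lemma lnode_le_half q : lnode q + h <= 2^-1.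
Proof.
rewrite /lnode -lerBrDr lerD2l lerN2 ler_peMl ?(ltW h0)//.
by rewrite ler1n.
Qed.

Lemma lnodeL : lnode L = 0.
Proof. by rewrite /lnode -hL subrr. Qed.

Lemma ramp_ge0 q t : 0 <= ramp q t. Proof. exact: step_ge0. Qed.
Lemma ramp_le1 q t : ramp q t <= 1. Proof. exact: step_le1. Qed.

Lemma ramp_eq1 q t : lnode q <= t -> ramp q t = 1.
Proof.
move=> ht; rewrite /ramp step_eq1// ler_pdivlMr// mul1r.
by rewrite lerBrDr addrC -lnodeS.
Qed.

Lemma ramp_eq0 q t : t <= lnode q.+1 -> ramp q t = 0.
Proof.
move=> ht; rewrite /ramp step_eq0// ler_pdivrMr//.
by apply: (@le_trans _ _ 0); rewrite ?subr_le0// mulr_ge0// ltW.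
Qed.

Lemma ramp_homo q t : ramp q t <= ramp q.+1 t.
Proof.
apply: step_homo; rewrite ler_pM2r ?invr_gt0// lerD2l lerN2.
by rewrite [leRHS]lnodeS lerDl ltW.
Qed.

Let darg q (t : R) : is_derive t 1 (fun t => (t - lnode q.+1) / h) h^-1.
Proof.
have -> : (fun t => (t - lnode q.+1) / h) = h^-1 *: (id - cst (lnode q.+1)).
  by apply/funext => s; rewrite [RHS]mulrC.
by apply: is_derive_eq; rewrite subr0 /GRing.scale/= mulr1.
Qed.

Lemma is_derive_ramp q (t : R) :
  is_derive t 1 (ramp q) (derive1 step ((t - lnode q.+1) / h) / h).
Proof.
have ds : is_derive ((t - lnode q.+1) / h) 1 step (derive1 step ((t - lnode q.+1) / h)).
  by apply: DeriveDef; [exact: derivable_step|rewrite derive1E].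
exact: (@is_derive1_comp R step (fun t => (t - lnode q.+1) / h) t _ _ ds (darg q t)).
Qed.

Lemma derive1_rampE q t :
  derive1 (ramp q) t = derive1 step ((t - lnode q.+1) / h) / h.
Proof. by have [_ e] := is_derive_ramp q t; rewrite derive1E e. Qed.

Lemma derivable_ramp q (t : R) : derivable (ramp q) t 1.
Proof. by have [] := is_derive_ramp q t. Qed.

Lemma ramp_continuous q : continuous (ramp q).
Proof.
move=> t; apply: differentiable_continuous.
by apply/derivable1_diffP; exact: derivable_ramp.
Qed.

Lemma derive1_ramp_continuous q : continuous (derive1 (ramp q)).
Proof.
have -> : derive1 (ramp q) =
    fun t => derive1 step ((t - lnode q.+1) / h) * h^-1.
  by apply/funext => t; rewrite derive1_rampE.
move=> t; apply: cvgM; last exact: cvg_cst.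
apply: (@continuous_comp _ _ _ (fun t => (t - lnode q.+1) / h)).
  by apply: cvgM; [apply: cvgB; [exact: cvg_id|exact: cvg_cst]|exact: cvg_cst].
exact: derive1_step_continuous.
Qed.

Lemma derive1_ramp_ge0 q t : 0 <= derive1 (ramp q) t.
Proof. by rewrite derive1_rampE divr_ge0 ?derive1_step_ge0// ltW. Qed.

Lemma derive1_ramp_out q t : ~~ (lnode q.+1 < t <= lnode q) ->
  derive1 (ramp q) t = 0.
Proof.
move=> nt; rewrite derive1_rampE derive1_step_eq0 ?mul0r//.
apply: contra nt; rewrite ler_pdivlMr// ler_pdivrMr// mul1r => /andP[t1 t2].
apply/andP; split; last by rewrite lnodeS addrC -lerBlDr.
rewrite -subr_gt0; apply: lt_le_trans t1; rewrite mulr_gt0//.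
Qed.

Lemma rint_derive1_ramp q : (q < L)%N ->
  \int[leb]_(t in half) derive1 (ramp q) t = 1.
Proof.
move=> qL; have := @continuous_FTC2 R (derive1 (ramp q)) (ramp q) 0 2^-1.
rewrite /Rintegral => ->.
- rewrite ramp_eq1; last first.
    by apply: le_trans (lnode_le_half q); rewrite lerDl ltW.
  by rewrite ramp_eq0 ?lnode_le//= subr0.
- by rewrite invr_gt0.
- by apply: continuous_subspaceT; exact: derive1_ramp_continuous.
- split; first by move=> t _; exact: derivable_ramp.
  + by apply: cvg_at_right_filter; exact: ramp_continuous.
  + by apply: cvg_at_left_filter; exact: ramp_continuous.
- by [].
Qed.

Definition plateau_half (q : nat) : R := \int[leb]_(t in half) ramp q t.

Lemma plateau_half_le q : plateau_half q <= 2^-1.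
Proof.
have -> : 2^-1 = \int[leb]_(t in half) (cst 1 : R -> R) t.
  rewrite Rintegral_cst ?mul1r; last exact: measurable_half.
  have := @lebesgue_measure_itv R `[0, 2^-1]; rewrite /= => ->.
  by rewrite lte_fin invr_gt0 ltr0n/= subr0.
apply: rint_le; [exact: measurable_half| | |by move=> t _; exact: ramp_le1].
  exact/continuous_rintable_half/ramp_continuous.
by apply: continuous_rintable_half => t; exact: cvg_cst.
Qed.

Lemma plateau_half_homo q : plateau_half q <= plateau_half q.+1.
Proof.
by apply: rint_le; [exact: measurable_half| | |move=> t _; exact: ramp_homo];
  apply: continuous_rintable_half; exact: ramp_continuous.
Qed.

(** Every ramp dominates [ramp 0], which is 1 on the cell of length [h] next to the middle. *)
Lemma plateau_half_gt0 q : 0 < plateau_half q.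
Proof.
elim: q => [|q ih]; last exact: lt_le_trans (plateau_half_homo q).
have i1 : rintable leb half (\1_(`[2^-1 - h, 2^-1] : set (measurableTypeR R)) : R -> R).
  apply: integrableS (measurableT) measurable_half _ _ => //.
  by apply: integrable_indic_itv.
have h2 : h <= 2^-1 by rewrite -hL ler_peMl ?(ltW h0)// ler1n.
apply: (@lt_le_trans _ _ (\int[leb]_(t in half)
    (\1_(`[2^-1 - h, 2^-1] : set (measurableTypeR R)) t))).
  rewrite /Rintegral integral_indic//.
  have -> : `[2^-1 - h, 2^-1]%classic `&` half = `[2^-1 - h, 2^-1]%classic.
    apply/setIidPl => t; rewrite /= !in_itv/= => /andP[t1 ->].
    by rewrite andbT (le_trans _ t1)// subr_ge0.
  have := @lebesgue_measure_itv R `[2^-1 - h, 2^-1]; rewrite /= => ->.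
  by rewrite lte_fin ltrBlDl ltrDr h0/= opprB addrCA subrr addr0.
apply: rint_le; [exact: measurable_half|exact: i1| |].
  exact/continuous_rintable_half/ramp_continuous.
move=> t /=; rewrite in_itv/= => /andP[t1 t2]; rewrite indicE.
case: (boolP (_ \in _)) => [|_]; last exact: ramp_ge0.
rewrite inE/= in_itv/= => /andP[t3 _]; rewrite ramp_eq1//.
by rewrite /lnode mul1r.
Qed.

Lemma chain_mass_plateau_ge0 q : 0 <= chain_mass plateau_half q.
Proof.
by case: q => [|q] /=; rewrite ?subr_ge0 ?plateau_half_homo// ltW// plateau_half_gt0.
Qed.

(** Increments of the ramps: bumps around the nodes whose sum is the outermost ramp and whose
    integrals are the masses of the chain. *)
Definition hat (q : nat) (t : R) : R := chain_mass (ramp^~ t) q.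

Lemma hat_ge0 q t : 0 <= hat q t.
Proof. by case: q => [|q]; rewrite /hat/= ?ramp_ge0// subr_ge0 ramp_homo. Qed.

Lemma hat_continuous q : continuous (hat q).
Proof.
case: q => [|q] t; first exact: ramp_continuous.
by apply: cvgB; exact: ramp_continuous.
Qed.

Lemma rint_hat q : \int[leb]_(t in half) hat q t = chain_mass plateau_half q.
Proof.
case: q => [//|q]; rewrite /hat/= rintB//.
- exact/continuous_rintable_half/ramp_continuous.
- exact/continuous_rintable_half/ramp_continuous.
Qed.

Lemma hat_out q t : t <= 2^-1 -> hat q t != 0 -> `|t - lnode q| <= h.
Proof.
move=> t2; have [tl|tl] := leP t (lnode q.+1).
  case: q tl => [|q] tl; rewrite /hat/= !ramp_eq0 ?subrr ?eqxx//.
  by apply: le_trans tl _; rewrite [leRHS]lnodeS lerDl ltW.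
move=> H; have tb : t <= lnode q + h.
  case: q tl H => [|q] tl H; first by rewrite -lnode0E.
  rewrite -lnodeS leNgt; apply/negP => qt.
  by move: H; rewrite /hat/= !ramp_eq1 ?subrr ?eqxx//;
    have := lnodeS q; have := h0; lra.
by have := lnodeS q; rewrite ler_distlC => e; apply/andP; split; lra.
Qed.

(** On a cell of length [h], [derive1 (ramp q)] is a probability density, and by the mean value
    theorem the difference quotient of [G] is a value of [dG]. Two averages of [dG] over the same
    cell differ by at most [C * h]. *)
Lemma half_spring (G dG : R -> R) (C : R) q :
  (forall t : R, is_derive t 1 G (dG t)) -> continuous dG ->
  (forall s t, `|dG s - dG t| <= C * `|s - t|) -> (q < L)%N ->
  `|\int[leb]_(t in half) (dG t * derive1 (ramp q) t) -
    (G (lnode q) - G (lnode q.+1)) / h| <= C * h.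
Proof.
move=> dGG cdG lG qL.
have C0 : 0 <= C by have := le_trans (normr_ge0 _) (lG 1 0); rewrite subr0 normr1 mulr1.
have ll : lnode q.+1 < lnode q by rewrite [ltRHS]lnodeS ltrDl.
have [x xl ->] : exists2 x, x \in `]lnode q.+1, lnode q[ &
    (G (lnode q) - G (lnode q.+1)) / h = dG x.
  have cG : {within `[lnode q.+1, lnode q], continuous G}.
    apply: continuous_subspaceT => t; apply: differentiable_continuous.
    by apply/derivable1_diffP; have [] := dGG t.
  have [x xl ->] := MVT ll (fun t _ => dGG t) cG.
  by exists x => //; rewrite (lnodeS q) [_ + h]addrC addrK mulfK// gt_eqF.
have xE a : a = a * \int[leb]_(t in half) derive1 (ramp q) t.
  by rewrite rint_derive1_ramp// mulr1.
rewrite [dG x]xE.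
have cr := @derive1_ramp_continuous q.
have i1 : rintable leb half (fun t => dG t * derive1 (ramp q) t).
  by apply: continuous_rintable_half => t; apply: cvgM; [exact: cdG|exact: cr].
have i2 := continuous_rintable_half cr.
have mh := measurable_half.
rewrite -rintZ// -rintB//; last exact: rintableZ.
apply: le_trans (le_norm_rint _ _) _ => //.
  by apply: rintableB => //; exact: rintableZ.
rewrite [leRHS]xE -rintZ//; apply: rint_le => //.
- by apply: rintable_norm; apply: rintableB => //; exact: rintableZ.
- exact: rintableZ.
move=> t _; rewrite -mulrBl normrM (ger0_norm (derive1_ramp_ge0 _ _)).
have [tl|tl] := boolP (lnode q.+1 < t <= lnode q); last by rewrite derive1_ramp_out// !mulr0.
rewrite ler_wpM2r ?derive1_ramp_ge0//; apply: le_trans (lG _ _) _.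
rewrite ler_wpM2l// ler_distlC.
by have := lnodeS q; move: xl tl; rewrite in_itv/= => /andP[? ?] /andP[? ?] ?;
  apply/andP; split; lra.
Qed.

(** [hat q] is concentrated within [h] of node [q], so replacing [G] by its value there costs at
    most [C * h] per unit of mass. *)
Lemma half_mass (G : R -> R) (C : R) q : continuous G -> 0 <= C ->
  (forall s t, `|G s - G t| <= C * `|s - t|) ->
  `|\int[leb]_(t in half) (G t * hat q t) -
    chain_mass plateau_half q * G (lnode q)| <= C * h * chain_mass plateau_half q.
Proof.
move=> cG C0 lG; rewrite -!rint_hat [X in _ - X]mulrC.
have mh := measurable_half.
have ch := @hat_continuous q.
have i1 : rintable leb half (fun t => G t * hat q t).
  by apply: continuous_rintable_half => t; apply: cvgM; [exact: cG|exact: ch].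
have i2 := continuous_rintable_half ch.
rewrite -!rintZ// -rintB//; last exact: rintableZ.
apply: le_trans (le_norm_rint _ _) _ => //.
  by apply: rintableB => //; exact: rintableZ.
apply: rint_le => //.
- by apply: rintable_norm; apply: rintableB => //; exact: rintableZ.
- exact: rintableZ.
move=> t; rewrite /= in_itv/= => /andP[_ t2].
rewrite -mulrBl normrM (ger0_norm (hat_ge0 _ _)).
have [->|ht] := eqVneq (hat q t) 0; first by rewrite !mulr0.
rewrite ler_wpM2r ?hat_ge0//; apply: le_trans (lG _ _) _.
by rewrite ler_wpM2l// hat_out.
Qed.

Definition plateau (q : nat) (t : R) : R := ramp q t * ramp q (1 - t).

Lemma plateau_sym q t : plateau q (1 - t) = plateau q t.
Proof. by rewrite /plateau mulrC opprB addrCA subrr addr0. Qed.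

Lemma plateau_ramp q t : t < 2^-1 + h -> plateau q t = ramp q t.
Proof.
move=> t2; rewrite /plateau (@ramp_eq1 q (1 - t)) ?mulr1//.
by have := lnode_le_half q; lra.
Qed.

Lemma plateau_continuous q : continuous (plateau q).
Proof.
move=> t; apply: cvgM; first exact: ramp_continuous.
exact: (continuous_onem (@ramp_continuous q)).
Qed.

Lemma is_derive_plateau q (t : R) : is_derive t 1 (plateau q)
  (derive1 (ramp q) t * ramp q (1 - t) - ramp q t * derive1 (ramp q) (1 - t)).
Proof.
have d1 : is_derive t 1 (ramp q) (derive1 (ramp q) t).
  by apply: DeriveDef; [exact: derivable_ramp|rewrite derive1E].
have d2 : is_derive (1 - t) 1 (ramp q) (derive1 (ramp q) (1 - t)).
  by apply: DeriveDef; [exact: derivable_ramp|rewrite derive1E].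
have d3 : is_derive t 1 (fun t : R => 1 - t) (-1).
  have -> : (fun t : R => 1 - t) = cst 1 - id by [].
  by apply: is_derive_eq; rewrite sub0r.
have d4 := @is_derive1_comp R (ramp q) (fun t : R => 1 - t) t _ _ d2 d3.
have -> : plateau q = ramp q * (ramp q \o (fun t : R => 1 - t)) by [].
by apply: (is_derive_eq (is_deriveM d1 d4)); rewrite /GRing.scale/=; ring.
Qed.

Lemma derivable_plateau q (t : R) : derivable (plateau q) t 1.
Proof. by have [] := is_derive_plateau q t. Qed.

Lemma derive1_plateauE q t : derive1 (plateau q) t =
  derive1 (ramp q) t * ramp q (1 - t) - ramp q t * derive1 (ramp q) (1 - t).
Proof. by have [_ e] := is_derive_plateau q t; rewrite derive1E e. Qed.

Lemma derive1_plateau_continuous q : continuous (derive1 (plateau q)).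
Proof.
have -> : derive1 (plateau q) = fun t =>
  derive1 (ramp q) t * ramp q (1 - t) - ramp q t * derive1 (ramp q) (1 - t).
  by apply/funext => t; exact: derive1_plateauE.
have c1 := @derive1_ramp_continuous q; have c2 := @ramp_continuous q.
move=> t; apply: cvgB; apply: cvgM; [exact: c1|exact: continuous_onem c2 _|exact: c2|].
exact: continuous_onem c1 _.
Qed.

Lemma derive1_plateau_sym q t :
  derive1 (plateau q) (1 - t) = - derive1 (plateau q) t.
Proof.
rewrite !derive1_plateauE (_ : 1 - (1 - t) = t); first by ring.
by rewrite opprB addrCA subrr addr0.
Qed.

Lemma derive1_plateau_ramp q t : t <= 2^-1 ->
  derive1 (plateau q) t = derive1 (ramp q) t.
Proof.
move=> t2; rewrite derive1_plateauE (@ramp_eq1 q (1 - t)); last first.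
  by have := lnode_le_half q; have := h0; lra.
rewrite (@derive1_ramp_out q (1 - t)) ?mulr0 ?subr0 ?mulr1// negb_and -!ltNge -leNgt.
by apply/orP; right; have := lnode_le_half q; have := h0; lra.
Qed.

End one_dim.

(** * Symmetric plateaus on the whole fiber *)

Section full_interval.
Context {R : realType}.
Notation leb := (@lebesgue_measure R).
Notation I01 := (`]0, 1[%classic : set (measurableTypeR R)).
Notation half := (`[0, 2^-1]%classic : set (measurableTypeR R)).
Variables (L : nat) (h : R).
Hypotheses (h0 : 0 < h) (hL : L.+1%:R * h = 2^-1).
Notation r := (plateau_half h).
Notation l := (lnode h).

(** The plateaus are symmetric about 1/2, so integrals against them see only the even part of [g];
    this is the value of that part at node [q]. *)
Definition node (g : R -> R) (q : nat) : R := (g (l q) + g (1 - l q)) / 2.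

Definition full_hat (q : nat) (t : R) : R := chain_mass (plateau h ^~ t) q.

Lemma full_hat_sym q t : full_hat q (1 - t) = full_hat q t.
Proof. by case: q => [|q]; rewrite /full_hat/= !plateau_sym. Qed.

Lemma full_hat_half q t : t <= 2^-1 -> full_hat q t = hat h q t.
Proof.
by move=> t2; case: q => [|q]; rewrite /full_hat /hat/= !plateau_ramp//;
  have := h0; lra.
Qed.

Lemma full_hat_ge0 q t : 0 <= full_hat q t.
Proof.
have [t2|t2] := leP t 2^-1; first by rewrite full_hat_half// hat_ge0.
by rewrite -full_hat_sym full_hat_half ?hat_ge0//; lra.
Qed.

Lemma full_hat_continuous q : continuous (full_hat q).
Proof.
case: q => [|q] t; first exact: plateau_continuous.
by apply: cvgB; exact: plateau_continuous.
Qed.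

Lemma full_spring (g dg : R -> R) (C : R) q :
  (forall t : R, is_derive t 1 g (dg t)) -> continuous dg ->
  (forall s t, `|dg s - dg t| <= C * `|s - t|) -> (q < L)%N ->
  `|\int[leb]_(t in I01) (dg t * derive1 (plateau h q) t) -
    2 / h * (node g q - node g q.+1)| <= 2 * C * h.
Proof.
move=> dgg cdg lg qL.
have cp := @derive1_plateau_continuous R h q.
rewrite fold_half; last by move=> t; apply: cvgM; [exact: cdg|exact: cp].
have -> : \int[leb]_(t in half) (dg t * derive1 (plateau h q) t +
      dg (1 - t) * derive1 (plateau h q) (1 - t)) =
    \int[leb]_(t in half) ((dg t - dg (1 - t)) * derive1 (ramp h q) t).
  apply: eq_Rintegral => t /set_mem; rewrite /= in_itv/= => /andP[_ t2].
  by rewrite derive1_plateau_sym mulrN -mulrBl derive1_plateau_ramp.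
have := @half_spring R L h h0 hL (fun t => g t + g (1 - t))
  (fun t => dg t - dg (1 - t)) (2 * C) q.
rewrite (_ : 2 / h * (node g q - node g q.+1) = (g (l q) + g (1 - l q) -
    (g (l q.+1) + g (1 - l q.+1))) / h); last first.
  by rewrite /node; field; rewrite gt_eqF.
apply => //.
- move=> t; have d3 : is_derive t 1 (fun t : R => 1 - t) (-1).
    have -> : (fun t : R => 1 - t) = cst 1 - id by [].
    by apply: is_derive_eq; rewrite sub0r.
  have d4 := @is_derive1_comp R g (fun t : R => 1 - t) t _ _ (dgg (1 - t)) d3.
  have := is_deriveD (dgg t) d4.
  by rewrite mulrN1.
- by move=> t; apply: cvgB; [exact: cdg|exact: (continuous_onem cdg)].
- move=> s t; have := lg s t; have := lg (1 - s) (1 - t).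
  rewrite (_ : 1 - s - (1 - t) = - (s - t)) ?normrN; last by ring.
  move=> h1 h2; rewrite (_ : _ - _ - _ = (dg s - dg t) - (dg (1 - s) - dg (1 - t))); last by ring.
  by apply: le_trans (ler_normB _ _) _; lra.
Qed.

Lemma full_mass (g : R -> R) (C : R) q : continuous g -> 0 <= C ->
  (forall s t, `|g s - g t| <= C * `|s - t|) ->
  `|\int[leb]_(t in I01) (g t * full_hat q t) -
    2 * (chain_mass r q * node g q)| <= 2 * C * h * chain_mass r q.
Proof.
move=> cg C0 lg; have cp := @full_hat_continuous q.
rewrite fold_half; last by move=> t; apply: cvgM; [exact: cg|exact: cp].
have -> : \int[leb]_(t in half) (g t * full_hat q t + g (1 - t) * full_hat q (1 - t)) =
    \int[leb]_(t in half) ((g t + g (1 - t)) * hat h q t).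
  apply: eq_Rintegral => t /set_mem; rewrite /= in_itv/= => /andP[_ t2].
  by rewrite full_hat_sym -mulrDl full_hat_half.
have := @half_mass R h h0 (fun t => g t + g (1 - t)) (2 * C) q.
rewrite (_ : 2 * (chain_mass r q * node g q) = chain_mass r q * (g (l q) + g (1 - l q)));
  last by rewrite /node; field.
apply.
- by move=> t; apply: cvgD; [exact: cg|exact: (continuous_onem cg)].
- by rewrite mulr_ge0.
- move=> s t; have := lg s t; have := lg (1 - s) (1 - t).
  rewrite (_ : 1 - s - (1 - t) = - (s - t)) ?normrN; last by ring.
  move=> h1 h2; rewrite (_ : _ - _ = (g s - g t) + (g (1 - s) - g (1 - t))); last by ring.
  by apply: le_trans (ler_normD _ _) _; lra.
Qed.

Lemma rint_full_hat q : \int[leb]_(t in I01) full_hat q t = 2 * chain_mass r q.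
Proof.
rewrite fold_half; last exact: full_hat_continuous.
have mh := @measurable_half R.
rewrite -rint_hat// -rintZ//; last first.
  by apply: continuous_rintable_half; exact: hat_continuous.
apply: eq_Rintegral => t /set_mem; rewrite /= in_itv/= => /andP[_ t2].
by rewrite full_hat_sym full_hat_half//; ring.
Qed.

Lemma rint_plateau q : \int[leb]_(t in I01) plateau h q t = 2 * r q.
Proof.
rewrite fold_half; last exact: plateau_continuous.
have mh := @measurable_half R.
rewrite -rintZ//; last first.
  by apply: continuous_rintable_half; exact: ramp_continuous.
apply: eq_Rintegral => t /set_mem; rewrite /= in_itv/= => /andP[_ t2].
have t3 : t < 2^-1 + h by have := h0; lra.
by rewrite plateau_sym plateau_ramp//; ring.
Qed.

Lemma sum_full_hat n t : \sum_(q < n.+1) full_hat q t = plateau h n t.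
Proof. exact: sum_chain_mass. Qed.

Lemma plateau_le1 q t : plateau h q t <= 1.
Proof. by rewrite mulr_ile1// ?ramp_ge0 ?ramp_le1. Qed.

Lemma continuous_sqr (F : R -> R) : continuous F -> continuous (fun t => F t ^+ 2).
Proof.
move=> cF; have -> : (fun t => F t ^+ 2) = fun t => F t * F t.
  by apply/funext => t; rewrite expr2.
by move=> t; apply: cvgM; exact: cF.
Qed.

(** On each half of the fiber one factor is at most [B / h] and the other integrates to 1. *)
Lemma rint_derive1_plateau_sqr (B : R) q : (forall t, `|derive1 (@step R) t| <= B) ->
  (q < L)%N ->
  \int[leb]_(t in I01) (derive1 (plateau h q) t ^+ 2) <= 2 * B / h.
Proof.
move=> sB qL; have mh := @measurable_half R.
have cp := @derive1_plateau_continuous R h q.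
have cr := @derive1_ramp_continuous R h q.
have cr2 : rintable leb half (fun t => derive1 (ramp h q) t ^+ 2).
  exact/continuous_rintable_half/continuous_sqr.
rewrite fold_half; last exact: continuous_sqr.
have -> : \int[leb]_(t in half) (derive1 (plateau h q) t ^+ 2 +
      derive1 (plateau h q) (1 - t) ^+ 2) =
    2 * \int[leb]_(t in half) (derive1 (ramp h q) t ^+ 2).
  rewrite -(rintZ mh 2 cr2).
  apply: eq_Rintegral => t /set_mem; rewrite /= in_itv/= => /andP[_ t2].
  by rewrite derive1_plateau_sym sqrrN derive1_plateau_ramp//; ring.
rewrite -mulrA ler_pM2l//.
have -> : B / h = B / h * \int[leb]_(t in half) derive1 (ramp h q) t.
  by rewrite (rint_derive1_ramp h0 hL)// mulr1.
have cr1 := continuous_rintable_half cr.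
rewrite -rintZ//; apply: rint_le => //; first exact: rintableZ.
move=> t _; rewrite expr2 ler_wpM2r ?derive1_ramp_ge0// derive1_rampE//.
by rewrite ler_pM2r ?invr_gt0//; apply: le_trans (ler_norm _) (sB _).
Qed.

(** Different plateaus rise in disjoint cells. This orthogonality makes the vertical energy a
    diagonal quadratic form in the coefficients. *)
Lemma derive1_plateau_disjoint p q t : p != q ->
  derive1 (plateau h p) t * derive1 (plateau h q) t = 0.
Proof.
wlog t2 : t / t <= 2^-1.
  move=> H pq; have [t2|t2] := leP t 2^-1; first exact: H.
  have := H (1 - t) _ pq; rewrite !derive1_plateau_sym mulrNN; apply.
  by lra.
wlog pq : p q / (p < q)%N.
  move=> H npq; have := npq; rewrite neq_ltn => /orP[pq|pq]; first exact: H.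
  by rewrite mulrC; apply: H => //; rewrite eq_sym.
move=> _; rewrite !derive1_plateau_ramp//.
have [tp|tp] := boolP (l p.+1 < t <= l p); last by rewrite derive1_ramp_out// mul0r.
rewrite [X in _ * X]derive1_ramp_out ?mulr0// negb_and -leNgt -!ltNge.
apply/orP; right; case/andP: tp => tp _; apply: le_lt_trans tp.
by rewrite /lnode lerD2l lerN2 ler_pM2r// ler_nat.
Qed.

End full_interval.

(** * Energy estimates on a single fiber *)

Section slice_estimates.
Context {R : realType}.
Notation leb := (@lebesgue_measure R).
Notation I01 := (`]0, 1[%classic : set (measurableTypeR R)).
Variables (K : nat) (h : R).
Notation L := K.+1.
Hypotheses (h0 : 0 < h) (hL : L.+1%:R * h = 2^-1).
Notation r := (plateau_half h).
Notation w := (chain_weight r).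

Let mI := @measurable_I01 R.

Lemma young (a b : R) : 2 * (a * b) <= a ^+ 2 + b ^+ 2.
Proof. by have := sqr_ge0 (a - b); nra. Qed.

Lemma hK : h * L%:R <= 2^-1.
Proof. by rewrite -hL mulrC ler_pM2r// ler_nat. Qed.

Lemma rint_sumZ (d : nat -> R) (F : nat -> R -> R) n :
  (forall q, rintable leb I01 (F q)) ->
  \int[leb]_(t in I01) (\sum_(q < n) d q * F q t) =
  \sum_(q < n) d q * \int[leb]_(t in I01) F q t.
Proof.
move=> Fi; rewrite (rint_sum mI); last by move=> q; exact: rintableZ.
by apply: eq_bigr => q _; rewrite rintZ.
Qed.

Lemma continuous_sum n (F : nat -> R -> R) : (forall q, continuous (F q)) ->
  continuous (fun t => \sum_(q < n) F q t).
Proof.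
move=> cF; elim: n => [|n ih].
  by under eq_fun do rewrite big_ord0; move=> t; exact: cvg_cst.
under eq_fun do rewrite big_ord_recr/=.
by move=> t; apply: cvgD; [exact: ih|exact: cF].
Qed.

Definition spring_form (d : nat -> R) (t : R) : R :=
  \sum_(q < L) d q * derive1 (plateau h q) t.

(** Young's inequality splits the quadrature error [2 * C * h * |d q|] of each cell. The part in
    [d q ^+ 2] will be absorbed thanks to [chain_spring_trunc]; the part in [C] is of order [h^3]
    per cell, hence [h^2] in all, because [h * L <= 1/2]. *)
Lemma spring_pairing (g dg : R -> R) (C : R) (d : nat -> R) :
  (forall t : R, is_derive t 1 g (dg t)) -> continuous dg -> 0 <= C ->
  (forall s t, `|dg s - dg t| <= C * `|s - t|) ->
  2 / h * \sum_(q < L) d q * (node h g q - node h g q.+1) -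
  (h^-1 * \sum_(q < L) d q ^+ 2 + C ^+ 2 * h ^+ 2) <=
  \int[leb]_(t in I01) (dg t * spring_form d t).
Proof.
move=> dgg cdg C0 lg.
have Fi q : rintable leb I01 (fun t => dg t * derive1 (plateau h q) t).
  apply: continuous_rintable01 => t; apply: cvgM; first exact: cdg.
  exact: derive1_plateau_continuous.
have -> : \int[leb]_(t in I01) (dg t * spring_form d t) =
    \sum_(q < L) d q * \int[leb]_(t in I01) (dg t * derive1 (plateau h q) t).
  rewrite -(@rint_sumZ d (fun q t => dg t * derive1 (plateau h q) t))//.
  apply: eq_Rintegral => t _.
  by rewrite /spring_form mulr_sumr; apply: eq_bigr => q _; rewrite mulrCA.
have H (q : 'I_L) : 2 / h * (d q * (node h g q - node h g q.+1)) -
    (h^-1 * d q ^+ 2 + C ^+ 2 * h ^+ 3) <=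
    d q * \int[leb]_(t in I01) (dg t * derive1 (plateau h q) t).
  have := full_spring h0 hL dgg cdg lg (ltn_ord q).
  move: (\int[leb]_(t in I01) _) (node h g q - node h g q.+1) => I a Ia.
  have : `|d q * (I - 2 / h * a)| <= h^-1 * d q ^+ 2 + C ^+ 2 * h ^+ 3.
    rewrite normrM; apply: le_trans (ler_wpM2l (normr_ge0 _) Ia) _.
    rewrite -[d q ^+ 2]real_normK ?num_real//.
    have -> : `|d q| = `|d q| / h * h by rewrite divfK ?gt_eqF.
    move: (`|d q| / h) => x.
    have -> : h^-1 * (x * h) ^+ 2 = h * x ^+ 2 by field; rewrite gt_eqF.
    by have := young x (C * h) => /(ler_wpM2l (ltW h0)); rewrite exprMn; lra.
  by rewrite ler_norml => /andP[+ _]; lra.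
apply: le_trans (ler_sum _ (fun q _ => H q)).
rewrite big_split/= -mulr_sumr sumrN big_split/= -mulr_sumr lerD2l lerN2 lerD2l.
rewrite sumr_const card_ord -mulr_natr -mulrA ler_wpM2l ?sqr_ge0//.
rewrite exprSr -mulrA ler_piMr ?sqr_ge0//; have := hK.
by move/le_trans; apply; rewrite invf_le1// ler1n.
Qed.

Lemma spring_energy (B : R) (d : nat -> R) :
  (forall t, `|derive1 (@step R) t| <= B) ->
  \int[leb]_(t in I01) (spring_form d t ^+ 2) <= 2 * B / h * \sum_(q < L) d q ^+ 2.
Proof.
move=> sB.
have Fi q : rintable leb I01 (fun t => derive1 (plateau h q) t ^+ 2).
  apply: continuous_rintable01; apply: continuous_sqr.
  exact: derive1_plateau_continuous.
have -> : \int[leb]_(t in I01) (spring_form d t ^+ 2) =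
    \sum_(q < L) d q ^+ 2 * \int[leb]_(t in I01) (derive1 (plateau h q) t ^+ 2).
  rewrite -(@rint_sumZ (fun q => d q ^+ 2)
    (fun q t => derive1 (plateau h q) t ^+ 2))//; apply: eq_Rintegral => t _.
  rewrite expr2 /spring_form mulr_suml; apply: eq_bigr => q _.
  rewrite mulr_sumr (bigD1 q)//= big1 ?addr0; first by ring.
  move=> p pq; rewrite mulrACA (derive1_plateau_disjoint h0) ?mulr0//.
  by rewrite eq_sym.
rewrite mulr_sumr; apply: ler_sum => q _.
rewrite mulrC ler_wpM2r ?sqr_ge0//.
exact: (rint_derive1_plateau_sqr h0 hL sB).
Qed.

Definition mass_form (s : nat -> R) (t : R) : R :=
  \sum_(q < L) (s q - s q.+1) * plateau h q t.

(** Summation by parts: coefficients given as differences of nodal values turn the plateaus into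
    hats, and [s L = 0] removes the boundary term. *)
Lemma mass_formE s t : s L = 0 ->
  mass_form s t = \sum_(q < L) s q * full_hat h q t.
Proof.
move=> sL; rewrite /mass_form.
suff H n : \sum_(q < n.+1) (s q - s q.+1) * plateau h q t =
    \sum_(q < n.+1) s q * full_hat h q t - s n.+1 * plateau h n t.
  by rewrite H sL mul0r subr0.
elim: n => [|n ih]; first by rewrite !big_ord1 /full_hat/=; ring.
by rewrite big_ord_recr/= ih [in RHS]big_ord_recr/= /full_hat/=; ring.
Qed.

Lemma mass_form_continuous s : continuous (mass_form s).
Proof.
apply: (@continuous_sum L (fun q t => (s q - s q.+1) * plateau h q t)) => q t.
by apply: cvgM; [exact: cvg_cst|exact: plateau_continuous].
Qed.

Lemma mass_pairing (g : R -> R) (C : R) (s : nat -> R) :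
  continuous g -> 0 <= C -> (forall s t, `|g s - g t| <= C * `|s - t|) ->
  s L = 0 ->
  2 * \sum_(q < L) chain_mass r q * (node h g q * s q) -
  (\sum_(q < L) chain_mass r q * s q ^+ 2 + C ^+ 2 * h ^+ 2) <=
  \int[leb]_(t in I01) (g t * mass_form s t).
Proof.
move=> cg C0 lg sL.
have Fi q : rintable leb I01 (fun t => g t * full_hat h q t).
  apply: continuous_rintable01 => t; apply: cvgM; first exact: cg.
  exact: full_hat_continuous.
have -> : \int[leb]_(t in I01) (g t * mass_form s t) =
    \sum_(q < L) s q * \int[leb]_(t in I01) (g t * full_hat h q t).
  rewrite -(@rint_sumZ s (fun q t => g t * full_hat h q t))//.
  apply: eq_Rintegral => t _.
  by rewrite mass_formE// mulr_sumr; apply: eq_bigr => q _; rewrite mulrCA.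
have H (q : 'I_L) : 2 * (chain_mass r q * (node h g q * s q)) -
    (chain_mass r q * s q ^+ 2 + C ^+ 2 * h ^+ 2 * chain_mass r q) <=
    s q * \int[leb]_(t in I01) (g t * full_hat h q t).
  have := @full_mass R h h0 g C q cg C0 lg.
  have m0 := @chain_mass_plateau_ge0 R L h h0 hL q.
  move: (\int[leb]_(t in I01) _) (chain_mass r q) (node h g q) m0 => I o a o0 Ia.
  have : `|s q * (I - 2 * (o * a))| <= o * s q ^+ 2 + C ^+ 2 * h ^+ 2 * o.
    rewrite normrM; apply: le_trans (ler_wpM2l (normr_ge0 _) Ia) _.
    rewrite -[s q ^+ 2]real_normK ?num_real//.
    have := young `|s q| (C * h) => /(ler_wpM2l o0).
    by rewrite exprMn; nra.
  by rewrite ler_norml => /andP[+ _]; lra.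
apply: le_trans (ler_sum _ (fun q _ => H q)).
rewrite big_split/= -mulr_sumr sumrN big_split/= -mulr_sumr lerD2l lerN2 lerD2l.
rewrite sum_chain_mass ler_piMr//; first by rewrite mulr_ge0 ?sqr_ge0.
apply: le_trans (plateau_half_le h K) _.
by rewrite invf_le1// ler1n.
Qed.

Lemma mass_energy (s : nat -> R) : s L = 0 ->
  \int[leb]_(t in I01) (mass_form s t ^+ 2) <=
  2 * \sum_(q < L) chain_mass r q * s q ^+ 2.
Proof.
move=> sL.
have Fi q : rintable leb I01 (full_hat h q).
  by apply: continuous_rintable01; exact: full_hat_continuous.
have -> : 2 * \sum_(q < L) chain_mass r q * s q ^+ 2 =
    \sum_(q < L) s q ^+ 2 * \int[leb]_(t in I01) full_hat h q t.
  by rewrite mulr_sumr; apply: eq_bigr => q _; rewrite (rint_full_hat h0); ring.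
rewrite -(@rint_sumZ (fun q => s q ^+ 2) (full_hat h))//.
apply: rint_le => //.
- by apply: continuous_rintable01; apply: continuous_sqr; exact: mass_form_continuous.
- by apply: rintable_sum => // q; exact: rintableZ.
move=> t _; rewrite mass_formE//.
(* Jensen's inequality for the sub-probability weights [full_hat h q t] *)
have [m mE] : exists m, \sum_(q < L) s q * full_hat h q t = m by eexists.
rewrite mE.
have E : 0 <= \sum_(q < L) (s q - m) ^+ 2 * full_hat h q t.
  by apply: sumr_ge0 => q _; rewrite mulr_ge0 ?sqr_ge0// full_hat_ge0.
have : \sum_(q < L) (s q - m) ^+ 2 * full_hat h q t =
    \sum_(q < L) s q ^+ 2 * full_hat h q t - 2 * m * m +
    m ^+ 2 * plateau h K t.
  have -> : 2 * m * m = \sum_(q < L) 2 * m * (s q * full_hat h q t).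
    by rewrite -mulr_sumr mE.
  rewrite -sum_full_hat mulr_sumr -sumrB -big_split/=.
  by apply: eq_bigr => q _; ring.
have := plateau_le1 h K t; have := sqr_ge0 m; nra.
Qed.

Section monotone.
Variable b : R -> R.
Hypotheses (b0 : b 0 = 0)
  (b_lip : forall s t, s <= t -> 0 <= b t - b s <= t - s).

Let b_pos y : 0 <= (y - b y) * b y.
Proof.
have [y0|y0] := leP 0 y.
  have /andP[] := b_lip y0; rewrite b0 !subr0 => h1 h2.
  by rewrite mulr_ge0// subr_ge0.
have /andP[] := b_lip (ltW y0); rewrite b0 !sub0r => h1 h2.
by rewrite -mulrNN mulr_ge0// oppr_ge0 ?subr_le0; lra.
Qed.

Let b_mono y y' : 0 <= ((y' - b y') - (y - b y)) * (b y' - b y).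
Proof.
have [yy|yy] := leP y y'.
  by have /andP[h1 h2] := b_lip yy; rewrite mulr_ge0//; lra.
have /andP[h1 h2] := b_lip (ltW yy).
by rewrite -mulrNN mulr_ge0//; lra.
Qed.

(** The average [M q / w q] is truncated and not the moment, because [chain_spring_ge0] compares
    averages at successive nodes. At [q = 0] the weight vanishes and so does the value. *)
Definition chain_trunc (M : nat -> R) (q : nat) : R := w q * b (M q / w q).

(** Inverts the recursion of [chain_moment]: these are the drops [f q - f q.+1] of nodal values
    whose moments have the increments of [F]. *)
Definition chain_slope (F : nat -> R) (q : nat) : R := (F q.+1 - F q) / r q.

Let r0 q : 0 < r q. Proof. exact: (plateau_half_gt0 h0 hL). Qed.

(** Both [y - b y] and [b y] are nondecreasing in [y] and vanish at 0. They thus have equal signs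
    and increments of equal sign, which is what [chain_spring_ge0] requires. *)
Lemma chain_spring_trunc (N : nat -> R)
    (d := chain_slope (chain_trunc (chain_moment r N))) :
  \sum_(q < L) d q ^+ 2 <= \sum_(q < L) d q * (N q - N q.+1).
Proof.
set M := chain_moment r N.
pose y q := M q / w q.
have wy q : w q * y q = M q.
  case: q => [|q]; first by rewrite /M /= mul0r.
  by rewrite /y mulrC divfK// gt_eqF// chain_weight_gt0.
have H := @chain_spring_ge0 R r (fun q => y q - b (y q)) (fun q => b (y q)) L r0
  (fun q _ => b_pos _) (fun q => b_mono _ _).
rewrite -subr_ge0 -sumrB; apply: le_trans H _.
apply: ler_sum => q _; rewrite le_eqVlt; apply/orP; left; apply/eqP.
have -> : N q - N q.+1 = (w q.+1 * y q.+1 - w q * y q) / r q.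
  rewrite !wy (_ : M q.+1 = M q + r q * (N q - N q.+1))//.
  by field; rewrite gt_eqF.
rewrite /d /chain_slope /chain_trunc -/M -/(y q) -/(y q.+1).
by field; rewrite gt_eqF.
Qed.

(** The pairing contains the cross sum with factor [2 / h]. By [chain_spring_trunc] one copy pays
    for the quadrature error and the other bounds the energy. *)
Lemma spring_estimate (B C : R) (g dg : R -> R)
    (d := chain_slope (chain_trunc (chain_moment r (node h g)))) :
  (forall t, `|derive1 (@step R) t| <= B) ->
  (forall t : R, is_derive t 1 g (dg t)) -> continuous dg -> 0 <= C ->
  (forall s t, `|dg s - dg t| <= C * `|s - t|) ->
  \int[leb]_(t in I01) (spring_form d t ^+ 2) <=
  2 * B * (\int[leb]_(t in I01) (dg t * spring_form d t) + C ^+ 2 * h ^+ 2).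
Proof.
move=> sB dgg cdg C0 lg.
have B0 : 0 <= B by apply: le_trans (sB 0).
apply: le_trans (spring_energy _ sB) _.
rewrite -!mulrA ler_wpM2l// ler_wpM2l//.
have := spring_pairing d dgg cdg C0 lg.
have hh : 0 < h^-1 by rewrite invr_gt0.
have := chain_spring_trunc (node h g); rewrite -/d.
by move=> /(ler_wpM2l (ltW hh)); lra.
Qed.
End monotone.

Let r0 q : 0 < r q. Proof. exact: (plateau_half_gt0 h0 hL). Qed.

Lemma chain_momentB (f g : nat -> R) q :
  chain_moment r (fun q => f q - g q) q = chain_moment r f q - chain_moment r g q.
Proof. by elim: q => [|q ih] /=; rewrite ?subr0// ih; ring. Qed.

(** [bt q] stands for the derivative of the truncation. The moments of [node h g - s] and of [s] are
    [1 - bt q] and [bt q] times the same number, so their product is nonnegative and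
    [chain_mass_ge0] applies. *)
Lemma mass_estimate (C : R) (g : R -> R) (s bt : nat -> R) :
  continuous g -> 0 <= C -> (forall s t, `|g s - g t| <= C * `|s - t|) ->
  node h g L = 0 -> s L = 0 -> (forall q, 0 <= bt q <= 1) ->
  (forall q, (q <= L)%N ->
    chain_moment r s q = bt q * chain_moment r (node h g) q) ->
  \int[leb]_(t in I01) (mass_form s t ^+ 2) <=
  2 * (\int[leb]_(t in I01) (g t * mass_form s t) + C ^+ 2 * h ^+ 2).
Proof.
move=> cg C0 lg gL sL bt01 sM.
apply: le_trans (mass_energy sL) _; rewrite ler_pM2l//.
have := mass_pairing cg C0 lg sL.
have : 0 <= \sum_(q < L) chain_mass r q * ((node h g q - s q) * s q).
  have m0 q : 0 <= chain_mass r q by exact: (chain_mass_plateau_ge0 h0 hL).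
  have f0 : (fun q => node h g q - s q) L = 0 by rewrite /= gL sL subrr.
  apply: (@chain_mass_ge0 R r (fun q => node h g q - s q) s K r0 m0 f0 sL) => q qL; rewrite chain_momentB sM//; have /andP[t0 t1] := bt01 q.
  set m := chain_moment _ _ _.
  have -> : (m - bt q * m) * (bt q * m) = (1 - bt q) * bt q * m ^+ 2 by ring.
  by rewrite mulr_ge0 ?sqr_ge0// mulr_ge0// subr_ge0.
have -> : \sum_(q < L) chain_mass r q * ((node h g q - s q) * s q) =
    \sum_(q < L) chain_mass r q * (node h g q * s q) -
    \sum_(q < L) chain_mass r q * s q ^+ 2.
  by rewrite -sumrB; apply: eq_bigr => q _; ring.
lra.
Qed.

End slice_estimates.

(** * Truncation of the fiber means of a test function *)

Section key.
Context {R : realType} {m : nat}.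
Notation leb := (@lebesgue_measure R).
Notation I01 := (`]0, 1[%classic : set (measurableTypeR R)).
Implicit Types (f g : 'rV[R]_m.+1 -> R) (x : 'rV[R]_m).

Lemma fiber_lipschitz g (C : R) x : smooth g ->
  (forall y, `|partial ord_max g y| <= C) ->
  forall s t : R, `|g (row_snoc (x, s)) - g (row_snoc (x, t))| <= C * `|s - t|.
Proof.
move=> sg gC.
have H (s t : R) : s <= t ->
    `|g (row_snoc (x, t)) - g (row_snoc (x, s))| <= C * `|t - s|.
  move=> st; have dg (z : R) : is_derive z 1 (fun u : R => g (row_snoc (x, u)))
      (partial ord_max g (row_snoc (x, z))).
    by apply: DeriveDef; [exact: derivable_fiber|rewrite -derive1E derive1_fiber].
  have cg : {within `[s, t], continuous (fun u : R => g (row_snoc (x, u)))}.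
    by apply: continuous_subspaceT; apply: continuous_fiber; exact: smooth_continuous.
  have [z _ ->] := MVT_segment st (fun z _ => dg z) cg.
  by rewrite normrM ler_wpM2r.
move=> s t; have [st|st] := leP s t; last exact/H/ltW.
by rewrite distrC [`|s - t|]distrC; exact: H.
Qed.

Variables (K : nat) (h c e : R).
Notation L := K.+1.
Hypotheses (h0 : 0 < h) (hL : L.+1%:R * h = 2^-1) (c0 : 0 <= c) (e0 : 0 < e).
Notation r := (plateau_half h).
Notation w := (chain_weight r).

Definition node_row g (q : nat) x : R := node h (fun t => g (row_snoc (x, t))) q.

Definition moment_row g (q : nat) x : R :=
  chain_moment r (fun p => node_row g p x) q.

(** The scale is chosen at the last node: there twice the truncated moment is [soft] of twice the
    moment, that is, of the approximate fiber mean. Scaling argument and value alike keeps the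
    Lipschitz constant 1. *)
Definition soft_scaled (y : R) : R := soft c e (2 * w L * y) / (2 * w L).

Definition trunc_row g (q : nat) x : R :=
  chain_trunc h soft_scaled (fun p => moment_row g p x) q.

Definition slope_row g (q : nat) x : R :=
  chain_slope h (fun p => trunc_row g p x) q.

Definition test_of g (y : 'rV[R]_m.+1) : R :=
  \sum_(q < L) slope_row g q (col' ord_max y) * plateau h q (y ord0 ord_max).

Let r0 q : 0 < r q. Proof. exact: (plateau_half_gt0 h0 hL). Qed.
Let wL0 : 0 < 2 * w L. Proof. by rewrite mulr_gt0// chain_weight_gt0. Qed.

Lemma soft_scaled0 : soft_scaled 0 = 0.
Proof. by rewrite /soft_scaled mulr0 soft0 mul0r. Qed.

Lemma soft_scaled_lip s t : s <= t ->
  0 <= soft_scaled t - soft_scaled s <= t - s.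
Proof.
move=> st; rewrite /soft_scaled -mulrBl.
have /(@soft_lipschitz R c e e0)/andP[h1 h2] : 2 * w L * s <= 2 * w L * t by rewrite ler_pM2l.
rewrite divr_ge0 ?(ltW wL0)//= ler_pdivrMr// (le_trans h2)//.
by rewrite -mulrBr mulrC.
Qed.

Lemma smooth_node_row g q : smooth g -> smooth (node_row g q).
Proof.
move=> sg; rewrite /node_row /node; under eq_fun do rewrite mulrC.
by apply: smoothZ; apply: smoothD; exact: smooth_slice.
Qed.

Lemma partial_node_row g q j x : smooth g ->
  partial j (node_row g q) x = node_row (partial (lift ord_max j) g) q x.
Proof.
move=> sg; have s1 t := smooth_slice t sg.
have -> : node_row g q = (fun x => 2^-1 * (g (row_snoc (x, lnode h q)) +
    g (row_snoc (x, 1 - lnode h q)))).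
  by apply/funext => z; rewrite mulrC.
rewrite partialZ; last first.
  by move=> z; apply: smooth_differentiable; exact: smoothD.
rewrite partialD; [|by move=> z; exact: smooth_differentiable..].
by rewrite !partial_slice mulrC.
Qed.

Lemma moment_rowS g q : moment_row g q.+1 = (fun x => moment_row g q x +
  r q * (node_row g q x - node_row g q.+1 x)).
Proof. by []. Qed.

Lemma smooth_moment_row g q : smooth g -> smooth (moment_row g q).
Proof.
move=> sg; elim: q => [|q ih]; first exact: smooth_cst.
rewrite moment_rowS; apply: smoothD => //; apply: smoothZ.
by apply: smoothB; exact: smooth_node_row.
Qed.

Lemma partial_moment_row g q j x : smooth g ->
  partial j (moment_row g q) x = moment_row (partial (lift ord_max j) g) q x.
Proof.
move=> sg; elim: q => [|q ih]; first exact: derive_cst.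
have sn p := smooth_node_row p sg; have sM := smooth_moment_row q sg.
rewrite moment_rowS partialD; last 2 first.
- by move=> z; exact: smooth_differentiable.
- by move=> z; apply: smooth_differentiable; apply: smoothZ; exact: smoothB.
rewrite partialZ; last by move=> z; apply: smooth_differentiable; exact: smoothB.
by rewrite partialB// ih !partial_node_row.
Qed.

Lemma smooth_trunc_row g q : smooth g -> smooth (trunc_row g q).
Proof.
move=> sg; apply: smoothZ; rewrite /soft_scaled.
under eq_fun do rewrite mulrC.
apply: smoothZ; apply: (@smooth_soft _ c e e0 _ (fun x => 2 * w L * (moment_row g q x / w q))).
apply: smoothZ; under eq_fun do rewrite mulrC.
by apply: smoothZ; exact: smooth_moment_row.
Qed.

(** The weights cancel in the chain rule, and what remains is a factor between 0 and 1: the [bt] of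
    [mass_estimate]. *)
Lemma partial_trunc_row g q j x : smooth g ->
  partial j (trunc_row g q) x =
  dsoft c e (2 * w L * (moment_row g q x / w q)) *
  moment_row (partial (lift ord_max j) g) q x.
Proof.
move=> sg; rewrite -partial_moment_row//.
(* Index 0 is separate because its weight is 0; there both sides vanish. *)
case: q => [|q].
  rewrite (_ : trunc_row g 0 = cst 0); last first.
    by apply/funext => z; rewrite /trunc_row /chain_trunc/= mul0r.
  have -> : partial j (moment_row g 0) x = 0 by exact: derive_cst.
  by rewrite mulr0.
have wq : w q.+1 != 0 by rewrite gt_eqF// chain_weight_gt0.
have sM := smooth_moment_row q.+1 sg.
pose a := 2 * w L / w q.+1.
have -> : trunc_row g q.+1 =
    fun x => w q.+1 / (2 * w L) * (soft c e \o (fun x => a * moment_row g q.+1 x)) x.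
  apply/funext => z; rewrite /trunc_row /chain_trunc /soft_scaled /comp.
  rewrite (_ : a * moment_row g q.+1 z = 2 * w L * (moment_row g q.+1 z / w q.+1)).
    by move: (soft c e _) => b; ring.
  by rewrite /a; ring.
have sa : smooth (fun x => a * moment_row g q.+1 x) by exact: smoothZ.
rewrite partialZ; last first.
  by move=> z; apply: smooth_differentiable; exact: smooth_soft.
rewrite partial_soft// partialZ; last by move=> z; exact: smooth_differentiable.
rewrite (_ : a * moment_row g q.+1 x = 2 * w L * (moment_row g q.+1 x / w q.+1)).
  move: (dsoft c e _) (partial j _ x) => b p; rewrite /a.
  have := wL0; rewrite pmulr_rgt0// => /lt0r_neq0.
  by move: (w L) (w q.+1) wq => W V V0 W0; field; rewrite V0 W0.
by rewrite /a mulrAC -mulrA.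
Qed.

Lemma smooth_slope_row g q : smooth g -> smooth (slope_row g q).
Proof.
move=> sg; rewrite /slope_row /chain_slope; under eq_fun do rewrite mulrC.
by apply: smoothZ; apply: smoothB; exact: smooth_trunc_row.
Qed.

Lemma partial_slope_row g q j x : smooth g ->
  partial j (slope_row g q) x =
  chain_slope h (fun p => partial j (trunc_row g p) x) q.
Proof.
move=> sg; have sT p := smooth_trunc_row p sg.
have -> : slope_row g q = (fun x => (r q)^-1 * (trunc_row g q.+1 x - trunc_row g q x)).
  by apply/funext => z; rewrite mulrC.
rewrite partialZ; last by move=> z; apply: smooth_differentiable; exact: smoothB.
by rewrite partialB// mulrC.
Qed.

Lemma smooth_plateau q : smooth (fun y : 'rV[R]_m.+1 => plateau h q (y ord0 ord_max)).
Proof.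
have sl (t0 : R) : smooth (fun y : 'rV[R]_m.+1 => (y ord0 ord_max - t0) / h).
  under eq_fun do rewrite mulrC.
  by apply: smoothZ; apply: smoothB; [exact: smooth_coord|exact: smooth_cst].
have sr (t0 : R) : smooth (fun y : 'rV[R]_m.+1 => (1 - y ord0 ord_max - t0) / h).
  under eq_fun do rewrite mulrC.
  apply: smoothZ; apply: smoothB; last exact: smooth_cst.
  by apply: smoothB; [exact: smooth_cst|exact: smooth_coord].
by apply: smoothM; [exact: (smooth_step (sl _))|exact: (smooth_step (sr _))].
Qed.

Lemma smooth_test_of g : smooth g -> smooth (test_of g).
Proof.
move=> sg; apply: (@smooth_sum _ _ _ _ (fun (q : 'I_L) y =>
  slope_row g q (col' ord_max y) * plateau h q (y ord0 ord_max))) => q.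
apply: smoothM; last exact: smooth_plateau.
exact: (smooth_col' (smooth_slope_row q sg)).
Qed.

Lemma test_of_snoc g x t :
  test_of g (row_snoc (x, t)) = \sum_(q < L) slope_row g q x * plateau h q t.
Proof. by rewrite /test_of; under eq_bigr do rewrite col'_row_snoc row_snoc_max. Qed.

Lemma partial_max_test_of g x t :
  partial ord_max (test_of g) (row_snoc (x, t)) =
  spring_form K h (fun q => slope_row g q x) t.
Proof.
rewrite -derive1_fiber.
have -> : (fun s : R => test_of g (row_snoc (x, s))) =
    \sum_(q < L) (slope_row g q x *: plateau h q).
  by apply/funext => s; rewrite test_of_snoc fct_sumE.
rewrite derive1E derive_sum; last first.
  by move=> q; apply: derivableZ; exact: derivable_plateau.
apply: eq_bigr => q _; rewrite deriveZ; last exact: derivable_plateau.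
by rewrite derive1E.
Qed.

Lemma partial_lift_test_of g j x t : smooth g ->
  partial (lift ord_max j) (test_of g) (row_snoc (x, t)) =
  \sum_(q < L) partial j (slope_row g q) x * plateau h q t.
Proof.
move=> sg; rewrite -partial_slice.
have -> : (fun s => test_of g (row_snoc (s, t))) =
    \sum_(q < L) (plateau h q t *: slope_row g q).
  apply/funext => s; rewrite test_of_snoc fct_sumE.
  by apply: eq_bigr => q _; rewrite mulrC.
have ds q : derivable (slope_row g q) x (delta_mx ord0 j).
  by apply: diff_derivable; apply: smooth_differentiable; exact: smooth_slope_row.
rewrite /partial derive_sum; last by move=> q; exact: derivableZ.
by apply: eq_bigr => q _; rewrite deriveZ// [LHS]mulrC.
Qed.

Lemma node_row_out (A : set 'rV[R]_m) g x : test_function (cylinder A) g ->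
  node_row g L x = 0.
Proof.
move=> tg; rewrite /node_row /node (lnodeL hL) subr0.
have out t : ~~ (0 < t < 1) -> g (row_snoc (x, t)) = 0.
  by move=> /negP nt; apply: (test_function_out tg) => /cylinder_snoc[_].
by rewrite !out ?ltxx ?andbF// addr0 mul0r.
Qed.

Lemma moment_row_sum (A : set 'rV[R]_m) g x : test_function (cylinder A) g ->
  moment_row g L x = \sum_(q < L) chain_mass r q * node_row g q x.
Proof.
by move=> tg; rewrite /moment_row chain_momentE (node_row_out x tg) mulr0 subr0.
Qed.

(** There is no quadrature error here: [plateau q] has integral [2 * r q], which cancels the
    denominator of the slope, and the truncated moments telescope. *)
Lemma fiber_test_of g x : fiber_integral (test_of g) x = soft c e (2 * moment_row g L x).
Proof.
rewrite /fiber_integral; under eq_Rintegral do rewrite test_of_snoc.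
rewrite (@rint_sumZ R (fun q => slope_row g q x) (plateau h)); last first.
  by move=> q; apply: continuous_rintable01; exact: plateau_continuous.
transitivity (2 * \sum_(q < L) (trunc_row g q.+1 x - trunc_row g q x)).
  rewrite mulr_sumr; apply: eq_bigr => q _; rewrite (rint_plateau h0).
  by rewrite /slope_row /chain_slope mulrCA divfK// gt_eqF.
have -> : \sum_(q < L) (trunc_row g q.+1 x - trunc_row g q x) = trunc_row g L x.
  rewrite -(big_mkord xpredT (fun q => trunc_row g q.+1 x - trunc_row g q x)).
  have t0 : trunc_row g 0 x = 0 by rewrite /trunc_row /chain_trunc mul0r.
  transitivity (trunc_row g L x - trunc_row g 0 x); last by rewrite t0 subr0.
  exact: (telescope_sumr (fun q => trunc_row g q x) (leq0n L)).
rewrite /trunc_row /chain_trunc /soft_scaled.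
have wn : w L != 0 by rewrite gt_eqF// chain_weight_gt0.
move: (w L) wn => W wn; move: (moment_row _ _ _) => M.
have -> : 2 * W * (M / W) = 2 * M by field.
by move: (soft _ _ _) => S; field.
Qed.

(** Two errors of at most [C * h] each. The outermost plateau differs from 1 only within [h] of the
    ends, where [|g| <= C * h]; and passing from hats to nodal values costs [2 * C * h] times a
    total mass of at most 1/2. *)
Lemma fiber_moment (A : set 'rV[R]_m) g (C : R) x :
  test_function (cylinder A) g -> (forall y, `|partial ord_max g y| <= C) ->
  `|fiber_integral g x - 2 * moment_row g L x| <= 2 * C * h.
Proof.
move=> tg gC; have [sg _] := tg.
have lg := fiber_lipschitz x sg gC.
have C0 : 0 <= C by apply: le_trans (gC 0).
have cg := @continuous_fiber R m g x (smooth_continuous sg).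
have cK := @plateau_continuous R h K.
have out t : ~~ (0 < t < 1) -> g (row_snoc (x, t)) = 0.
  by move=> /negP nt; apply: (test_function_out tg) => /cylinder_snoc[_].
have mI := @measurable_I01 R.
have i1 := continuous_rintable01 cg.
have i2 : rintable leb I01 (fun t => g (row_snoc (x, t)) * plateau h K t).
  by apply: continuous_rintable01 => t; apply: cvgM; [exact: cg|exact: cK].
pose P := \int[leb]_(t in I01) (g (row_snoc (x, t)) * plateau h K t).
have e1 : `|fiber_integral g x - P| <= C * h.
  rewrite /fiber_integral /P -(rintB mI i1 i2).
  apply: le_trans (le_norm_rint mI _) _; first exact: rintableB.
  have ih : rintable leb I01 (fun=> C * h).
    by apply: continuous_rintable01 => t; exact: cvg_cst.
  apply: (@le_trans _ _ (\int[leb]_(t in I01) (C * h))).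
    apply: rint_le => //; first by apply: rintable_norm; exact: rintableB.
    move=> t; rewrite /= in_itv/= => /andP[t0 t1].
    rewrite -{1}[g _]mulr1 -mulrBr normrM.
    have P01 : `|1 - plateau h K t| <= 1.
      rewrite ger0_norm ?subr_ge0 ?plateau_le1// gerBl.
      by rewrite mulr_ge0 ?ramp_ge0.
    have [t2|t2] := leP t h.
      have H := lg t 0; rewrite (out 0) ?ltxx// !subr0 (gtr0_norm t0) in H.
      rewrite -[leRHS]mulr1 ler_pM//; apply: le_trans H _.
      by rewrite ler_wpM2l.
    have [t3|t3] := leP (1 - h) t.
      have H := lg t 1; rewrite (out 1) ?ltxx ?andbF// subr0 in H.
      rewrite [`|t - 1|]distrC [`|1 - t|]ger0_norm ?subr_ge0 ?(ltW t1)// in H.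
      rewrite -[leRHS]mulr1 ler_pM//; apply: le_trans H _.
      by rewrite ler_wpM2l//; lra.
    have lK : lnode h K = h by rewrite lnodeS// (lnodeL hL) add0r.
    rewrite /plateau !(ramp_eq1 h0) ?lK ?(ltW t2)//; last by lra.
    by rewrite mulr1 subrr normr0 mulr0 mulr_ge0// ltW.
  rewrite Rintegral_cst//; have := @lebesgue_measure_itv R `]0, 1[; rewrite /= => ->.
  by rewrite lte_fin ltr01/= subr0 mulr1.
have e2 : `|P - 2 * moment_row g L x| <= C * h.
  have Fi q : rintable leb I01 (fun t => g (row_snoc (x, t)) * full_hat h q t).
    apply: continuous_rintable01 => t; apply: cvgM; first exact: cg.
    exact: full_hat_continuous.
  have -> : P = \sum_(q < L)
      \int[leb]_(t in I01) (g (row_snoc (x, t)) * full_hat h q t).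
    rewrite -(rint_sum mI)//; apply: eq_Rintegral => t _.
    by rewrite -mulr_sumr sum_full_hat.
  rewrite (moment_row_sum x tg) mulr_sumr -sumrB.
  apply: le_trans (ler_norm_sum _ _ _) _.
  apply: (@le_trans _ _ (\sum_(q < L) 2 * C * h * chain_mass r q)).
    by apply: ler_sum => q _; exact: (full_mass h0).
  rewrite -mulr_sumr sum_chain_mass.
  have := plateau_half_le h K; have : 0 <= C * h by rewrite mulr_ge0// ltW.
  by move=> p0 /(ler_wpM2l p0); lra.
rewrite (_ : _ - _ = (fiber_integral g x - P) + (P - 2 * moment_row g L x)); last by ring.
by apply: le_trans (ler_normD _ _) _; lra.
Qed.

End key.

Section key_lemma.
Context {R : realType} {m : nat}.
Notation leb := (@lebesgue_measure R).
Notation I01 := (`]0, 1[%classic : set (measurableTypeR R)).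
Implicit Types (f g : 'rV[R]_m.+1 -> R) (x : 'rV[R]_m).

Lemma closed_row_cube_compact n (M : R) (A : set 'rV[R]_n) :
  closed A -> A `<=` row_cube n M -> compact A.
Proof.
move=> cA AM.
have cM : compact [set v : 'rV[R]_n | forall i, v ord0 i \in `[(- M), M]].
  by apply: (@rV_compact _ _ (fun=> `[(- M), M]%classic)) => _; exact: segment_compact.
by apply: subclosed_compact cA cM _ => v /AM Mv i; exact: (Mv i I).
Qed.

Section support.
Variables (K : nat) (h c e : R).
Notation L := K.+1.
Hypotheses (h0 : 0 < h) (hL : L.+1%:R * h = 2^-1) (c0 : 0 <= c) (e0 : 0 < e).

Lemma plateau_out q t : (q < L)%N -> ~~ (h / 3 <= t <= 1 - h / 3) ->
  plateau h q t = 0.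
Proof.
move=> qL nt.
have r0 s : s < h / 3 -> ramp h q s = 0.
  move=> sh; rewrite /ramp step_eq0// ler_pdivrMr// mulrC.
  by have := lnode_le h0 hL (qL : (q.+1 <= L)%N); lra.
move: nt; rewrite negb_and -!ltNge => /orP[t1|t1].
  by rewrite /plateau r0// mul0r.
by rewrite /plateau [X in _ * X]r0 ?mulr0//; lra.
Qed.

Lemma test_of_test_function (D : set 'rV[R]_m) g :
  test_function (cylinder D) g -> test_function (cylinder D) (test_of K h c e g).
Proof.
move=> [sg [Q [cQ QD gQ]]]; split; first exact: smooth_test_of.
pose P := (fun y : 'rV[R]_m.+1 => col' ord_max y) @` Q.
have cP : compact P.
  apply: continuous_compact => //; apply: continuous_subspaceT.
  exact: col'_continuous.
have PD x : P x -> D x by move=> [y /QD[Dy _] <-].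
have [M PM] := bounded_row_cube (compact_bounded cP).
exists [set y : 'rV[R]_m.+1 | P (col' ord_max y) /\ h / 3 <= y ord0 ord_max <= 1 - h / 3].
have h3 : 0 < h / 3 by rewrite divr_gt0.
split.
- apply: (@closed_row_cube_compact _ (Num.max M 1)).
    have -> : [set y : 'rV[R]_m.+1 | P (col' ord_max y) /\
        h / 3 <= y ord0 ord_max <= 1 - h / 3] =
      (fun y : 'rV[R]_m.+1 => col' ord_max y) @^-1` P `&`
      (fun y : 'rV[R]_m.+1 => y ord0 ord_max) @^-1` `[h / 3, 1 - h / 3].
      by apply/seteqP; split => y /=; rewrite in_itv.
    apply: closedI; apply: preimage_closed.
    + by move=> y _; exact: col'_continuous.
    + by apply: compact_closed => //; exact: norm_hausdorff.
    + by move=> y _; exact: coord_continuous.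
    + exact: interval_closed.
  move=> y [Py /andP[y1 y2]] i _ /=; rewrite /row_coord in_itv/=.
  have M1 : M <= Num.max M 1 by rewrite le_max lexx.
  have M2 : 1 <= Num.max M 1 by rewrite le_max lexx orbT.
  case: (unliftP ord_max i) => [j|] ->; last by apply/andP; split; lra.
  have := PM _ Py j I; rewrite /= /row_coord in_itv/= !mxE => /andP[m1 m2].
  by apply/andP; split; lra.
- move=> y [/PD Dy /andP[y1 y2]]; split => //.
  by apply/andP; split; lra.
move=> y ny; rewrite /test_of big1// => q _.
have [Py|nP] := pselect (P (col' ord_max y)).
  rewrite plateau_out ?mulr0//; apply/negP => y12; exact: ny.
(* On a fiber that misses the support of [g] all nodal values vanish, and the truncation fixes 0, so
   all slopes vanish too. *)
have gy t : g (row_snoc (col' ord_max y, t)) = 0.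
  apply: gQ => Qy; apply: nP; exists (row_snoc (col' ord_max y, t)) => //.
  by rewrite col'_row_snoc.
have nr p : node_row h g p (col' ord_max y) = 0.
  by rewrite /node_row /node !gy addr0 mul0r.
have mr p : moment_row h g p (col' ord_max y) = 0.
  rewrite /moment_row; elim: p => //= p ->.
  by rewrite !nr subrr mulr0 addr0.
have tr p : trunc_row K h c e g p (col' ord_max y) = 0.
  by rewrite /trunc_row /chain_trunc mr mul0r soft_scaled0 mulr0.
by rewrite /slope_row /chain_slope !tr subrr !mul0r.
Qed.

Lemma spring_row_estimate (D : set 'rV[R]_m) g (B C : R) x :
  (forall t, `|derive1 (@step R) t| <= B) ->
  test_function (cylinder D) g ->
  (forall i y, `|partial ord_max (partial i g) y| <= C) ->
  fiber_integral (fun y => partial ord_max (test_of K h c e g) y ^+ 2) x <=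
  2 * B * (fiber_integral
    (fun y => partial ord_max g y * partial ord_max (test_of K h c e g) y) x +
    C ^+ 2 * h ^+ 2).
Proof.
move=> sB [sg _] gC; have C0 : 0 <= C by exact: le_trans (gC ord_max 0).
rewrite /fiber_integral.
under eq_Rintegral do rewrite partial_max_test_of.
under [X in _ <= _ * (X + _)]eq_Rintegral do rewrite partial_max_test_of.
apply: (@spring_estimate R K h h0 hL (soft_scaled K h c e) (soft_scaled0 K h c e)
  (@soft_scaled_lip R K h c e h0 hL e0) B C (fun t => g (row_snoc (x, t)))) => //.
- move=> t; apply: DeriveDef; first exact: derivable_fiber.
  by rewrite -derive1E derive1_fiber.
- by apply: continuous_fiber; apply/smooth_continuous/smooth_partial.
- by apply: fiber_lipschitz; [exact: smooth_partial|exact: gC].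
Qed.

Lemma mass_row_estimate (D : set 'rV[R]_m) g (C : R) j x :
  test_function (cylinder D) g ->
  (forall i y, `|partial ord_max (partial i g) y| <= C) ->
  fiber_integral (fun y => partial (lift ord_max j) (test_of K h c e g) y ^+ 2) x <=
  2 * (fiber_integral (fun y => partial (lift ord_max j) g y *
    partial (lift ord_max j) (test_of K h c e g) y) x + C ^+ 2 * h ^+ 2).
Proof.
move=> tg gC; have [sg _] := tg; have C0 : 0 <= C by exact: le_trans (gC ord_max 0).
have tp := test_function_partial (lift ord_max j) tg.
have r0 q : 0 < plateau_half h q by exact: (plateau_half_gt0 h0 hL).
pose F q := partial j (trunc_row K h c e g q) x.
(* Nodal values of the horizontal derivative of the test function, summed inwards from the value 0
   at the end of the fiber. *)
pose s q := \sum_(q <= p < L) chain_slope h F p.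
have sS q : (q < L)%N -> s q - s q.+1 = chain_slope h F q.
  by move=> qL; rewrite /s big_ltn// addrK.
have sE t : partial (lift ord_max j) (test_of K h c e g) (row_snoc (x, t)) =
    mass_form K h s t.
  rewrite partial_lift_test_of//; apply: eq_bigr => q _.
  by rewrite sS// partial_slope_row.
rewrite /fiber_integral.
under eq_Rintegral do rewrite sE.
under [X in _ <= _ * (X + _)]eq_Rintegral do rewrite sE.
pose bt q := dsoft c e (2 * chain_weight (plateau_half h) L *
  (moment_row h g q x / chain_weight (plateau_half h) q)).
apply: (@mass_estimate R K h h0 hL C
  (fun t => partial (lift ord_max j) g (row_snoc (x, t))) s bt) => //.
- by apply: continuous_fiber; exact/smooth_continuous/smooth_partial.
- by apply: fiber_lipschitz; [exact: smooth_partial|exact: gC].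
- exact: (node_row_out hL x tp).
- by rewrite /s big_geq.
- by move=> q; rewrite dsoft_ge0//= dsoft_le1.
move=> q qL; transitivity (F q); last by rewrite /F partial_trunc_row.
elim: q qL => [|q ih] qL.
  by rewrite /F partial_trunc_row// [moment_row h _ 0 x](_ : _ = 0)// mulr0.
rewrite [LHS]/= ih; last exact: ltnW.
rewrite sS// /chain_slope mulrC divfK; last by rewrite gt_eqF.
by rewrite addrC subrK.
Qed.

End support.

Lemma exists_test_function (B : R) : (forall t, `|derive1 (@step R) t| <= B) -> 1 <= B ->
  forall (D : set 'rV[R]_m) g (c : R), test_function (cylinder D) g -> 0 <= c ->
  forall d : R, 0 < d ->
  exists2 psi, test_function (cylinder D) psi &
    (forall x, `|fiber_integral psi x - Num.max (fiber_integral g x - c) 0| <= d) /\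
    (forall x, \sum_i fiber_integral (fun y => partial i psi y ^+ 2) x <=
      2 * B * \sum_i fiber_integral (fun y => partial i g y * partial i psi y) x + d).
Proof.
move=> sB B1 D g c tg c0 d d0.
have [C1 C10 gC1] := test_function_bounded (test_function_partial ord_max tg).
have [C C0 gC] : exists2 C : R, 0 < C &
    forall i y, `|partial ord_max (partial i g) y| <= C.
  have H (i : 'I_m.+1) : exists C : R, 0 < C /\
      forall y, `|partial ord_max (partial i g) y| <= C.
    have [C C0 gC] := test_function_bounded
      (test_function_partial ord_max (test_function_partial i tg)).
    by exists C.
  have [Cf Cfp] := choice H.
  have Cf0 i : 0 <= Cf i by apply/ltW; have [] := Cfp i.
  exists (1 + \sum_i Cf i); first by rewrite ltr_wpDr//; apply: sumr_ge0.
  move=> i y; have [_ /(_ y)/le_trans] := Cfp i; apply.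
  by rewrite (bigD1 i)//= addrCA lerDl addr_ge0//; apply: sumr_ge0.
(* The mesh will satisfy [a * h <= 1/2]. The three summands control, in turn, the error of the fiber
   mean, the total quadrature error of the energies, and [h] itself. *)
pose a := 4 * C1 / d + 2 * B * m.+1%:R * C ^+ 2 / d + 1.
have B0 : 0 < B by exact: lt_le_trans B1.
have X0 : 0 <= 4 * C1 / d by rewrite divr_ge0 ?mulr_ge0 ?(ltW C10) ?(ltW d0).
have P0 : 0 <= 2 * B * m.+1%:R * C ^+ 2.
  apply: mulr_ge0; last exact: sqr_ge0.
  by apply: mulr_ge0 => //; apply: mulr_ge0 => //; exact: ltW.
have Y0 : 0 <= 2 * B * m.+1%:R * C ^+ 2 / d by apply: divr_ge0 => //; exact: ltW.
have a1 : 1 <= a by rewrite /a lerDr addr_ge0.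
pose K := Num.bound a.
have Ka : a < K.+2%:R.
  apply: lt_trans (archi_boundP (le_trans ler01 a1)) _.
  by rewrite ltr_nat ltnS leqW.
pose h := (2 * K.+2%:R)^-1 : R.
have K0 : 0 < K.+2%:R :> R by rewrite ltr0n.
have h0 : 0 < h by rewrite invr_gt0 mulr_gt0.
have hL : K.+2%:R * h = 2^-1 by rewrite /h invfM mulrCA mulfV ?mulr1// gt_eqF.
have ah : a * h <= 2^-1 by rewrite -hL ler_pM2r// ltW.
have h1 : h <= 1 by have := ler_wpM2r (ltW h0) a1; lra.
have hC1 : 2 * C1 * h <= d / 4.
  have : 4 * C1 / d * h <= 2^-1.
    apply: le_trans ah; rewrite ler_pM2r// /a; lra.
  by rewrite mulrAC ler_pdivrMr//; lra.
have hC : 2 * B * m.+1%:R * C ^+ 2 * h ^+ 2 <= d.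
  have : 2 * B * m.+1%:R * C ^+ 2 / d * h <= 2^-1.
    apply: le_trans ah; rewrite ler_pM2r// /a; lra.
  rewrite mulrAC ler_pdivrMr// => H.
  have Z0 : 0 <= 2 * B * m.+1%:R * C ^+ 2 * h by apply: mulr_ge0 => //; exact: ltW.
  rewrite (expr2 h) mulrA; apply: le_trans (ler_piMr Z0 h1) _; lra.
have e0 : 0 < d / 2 by rewrite divr_gt0.
pose psi := test_of K h c (d / 2) g.
exists psi; first exact: test_of_test_function.
split=> x.
  have M1 := @fiber_moment R m K h h0 hL D g C1 x tg gC1.
  rewrite /psi fiber_test_of//.
  have := soft_approx c0 e0 (2 * moment_row h g K.+1 x).
  move: M1; move: (moment_row _ _ _ _) (fiber_integral g x) (soft _ _ _) => M V S M1 S1.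
  have mx : `|Num.max (2 * M - c) 0 - Num.max (V - c) 0| <= `|V - 2 * M|.
    have H u v : u <= v -> 0 <= Num.max v 0 - Num.max u (0 : R) <= v - u.
      move=> uv; have [v0|v0] := leP v 0; have [u0|u0] := leP u 0; lra.
    have [VM|VM] := leP V (2 * M).
      have /H/andP[p1 p2] : V - c <= 2 * M - c by rewrite lerD2r.
      by rewrite ger0_norm// distrC ger0_norm ?subr_ge0//; lra.
    have /H/andP[p1 p2] : 2 * M - c <= V - c by rewrite lerD2r ltW.
    by rewrite distrC ger0_norm// ger0_norm ?subr_ge0 ?(ltW VM)//; lra.
  rewrite (_ : S - _ = (S - Num.max (2 * M - c) 0) +
    (Num.max (2 * M - c) 0 - Num.max (V - c) 0)); last by ring.
  apply: le_trans (ler_normD _ _) _; lra.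
have H (i : 'I_m.+1) : fiber_integral (fun y => partial i psi y ^+ 2) x <=
    2 * B * (fiber_integral (fun y => partial i g y * partial i psi y) x +
    C ^+ 2 * h ^+ 2).
  case: (unliftP ord_max i) => [j|] ->; last first.
    exact: (@spring_row_estimate K h c (d / 2) h0 hL e0 D g B C x sB tg gC).
  have E := @mass_row_estimate K h c (d / 2) h0 hL e0 D g C j x tg gC.
  (* Enlarging the constant 2 to [2 * B] needs a nonnegative bracket; the estimate itself provides
     it, its left side being an integral of squares. *)
  apply: le_trans E _; rewrite -mulrA ler_pM2l// ler_peMl//.
  suff : 0 <= 2 * (fiber_integral (fun y => partial (lift ord_max j) g y *
     partial (lift ord_max j) (test_of K h c (d / 2) g) y) x + C ^+ 2 * h ^+ 2).
    by rewrite pmulr_rge0.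
  apply: le_trans (@mass_row_estimate K h c (d / 2) h0 hL e0 D g C j x tg gC).
  by apply: Rintegral_ge0 => t _; exact: sqr_ge0.
apply: le_trans (ler_sum _ (fun i _ => H i)) _.
rewrite -mulr_sumr big_split/= sumr_const card_ord -[_ *+ m.+1]mulr_natr mulrDr lerD2l.
by apply: le_trans hC; rewrite le_eqVlt; apply/orP; left; apply/eqP; ring.
Qed.

End key_lemma.

(** * Sobolev functions and the variational inequality *)

Section L2.
Context {R : realType} {n : nat}.
Variable A : set 'rV[R]_n.
Hypothesis mA : measurable A.
Implicit Types u g : 'rV[R]_n -> R.
Notation mu := (lebesgue_row n).

Lemma poweR_Lnorm_sqr g :
  ('N[mu]_2%:E[EFin \o g] `^ 2 = \int[mu]_x (g x ^+ 2)%:E)%E.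
Proof.
rewrite poweR_Lnorm//; apply: eq_integral => x _ /=.
by rewrite powR_mulrn ?normr_ge0// real_normK ?num_real.
Qed.

Lemma square_integrableP u : square_integrable A u <-> sqintable mu A u.
Proof.
split=> [|[mu_ iu]].
  move=> Lu; have iu := Lfun2_integrable_sqr Lu.
  have mu_ : measurable_fun [set: 'rV[R]_n] (u \_ A).
    by move: Lu; rewrite /square_integrable inE => /andP[]; rewrite inE.
  split; first exact: (measurable_restrictT _ mA).2 mu_.
  apply: (iffRL (integrable_mkcond _ mA)).
  apply: eq_integrable iu => // x _; rewrite /patch/=.
  by case: ifPn => //= _; rewrite expr0n.
rewrite /square_integrable inE; apply/andP; split.
  by rewrite inE/=; exact: (measurable_restrictT _ mA).1 mu_.
rewrite inE/= /finite_norm.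
have := iffLR (integrable_mkcond _ mA) iu => /integrable_lty => /(_ measurableT).
rewrite (_ : (\int[mu]_x _ = \int[mu]_x ((u \_ A) x ^+ 2)%:E)%E); last first.
  apply: eq_integral => x _; rewrite /patch/=.
  by case: ifPn => //= _; rewrite expr0n.
rewrite -poweR_Lnorm_sqr => H.
apply: (@lty_poweRy _ _ 2) => //.
Qed.

Lemma L2norm_lt u (e : R) : 0 < e -> sqintable mu A u -> (L2norm A u < e%:E)%E ->
  \int[mu]_(x in A) (u x ^+ 2) <= e ^+ 2.
Proof.
move=> e0 [_ iu] ue; rewrite -lee_fin /Rintegral fineK; last exact: integrable_fin_num.
have -> : (\int[mu]_(x in A) (u x ^+ 2)%:E = \int[mu]_x ((u \_ A) x ^+ 2)%:E)%E.
  rewrite integral_mkcond; apply: eq_integral => x _; rewrite /patch/=.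
  by case: ifPn => //= _; rewrite expr0n.
rewrite -poweR_Lnorm_sqr -[X in (_ <= X%:E)%E]powR_mulrn ?(ltW e0)// -poweR_EFin.
rewrite gt0_ler_poweR// ?in_itv/= ?leey ?Lnorm_ge0 ?andbT//; last exact: ltW.
by rewrite lee_fin ltW.
Qed.

Lemma L2norm0 : L2norm A (fun=> 0) = 0%E.
Proof.
rewrite /L2norm -(@Lnorm0 _ _ _ mu 2%:E)//; apply: eq_Lnorm => x /=.
by rewrite /patch; case: ifP.
Qed.

End L2.

Section sobolev_lemmas.
Context {R : realType} {n : nat}.
Variable A : set 'rV[R]_n.
Hypotheses (mA : measurable A) (Aoo : (lebesgue_row n A < +oo)%E).
Implicit Types (u g phi psi : 'rV[R]_n -> R) (G H : 'I_n -> 'rV[R]_n -> R).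
Notation mu := (lebesgue_row n).

Lemma test_sqintable psi : test_function A psi -> sqintable mu A psi.
Proof. exact: test_function_sqintable. Qed.

Lemma W12_sqintable u G : W12 A u G -> sqintable mu A u.
Proof. by move=> [/(square_integrableP mA)]. Qed.

Lemma W12_grad_sqintable u G i : W12 A u G -> sqintable mu A (G i).
Proof. by move=> [_ /(_ i)[/(square_integrableP mA)]]. Qed.

Lemma W12_test psi : test_function A psi -> W12 A psi (fun i => partial i psi).
Proof.
move=> tp; split; first exact/square_integrableP/test_sqintable.
move=> i; split; last exact: test_function_weak_partial.
exact/square_integrableP/test_sqintable/test_function_partial.
Qed.

Lemma W12D u G v H : W12 A u G -> W12 A v H ->
  W12 A (fun x => u x + v x) (fun i x => G i x + H i x).
Proof.
move=> wu wv; split.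
  by apply/square_integrableP => //; apply: sqintableD => //;
    [exact: W12_sqintable wu|exact: W12_sqintable wv].
move=> i; split.
  by apply/square_integrableP => //; apply: sqintableD => //;
    [exact: W12_grad_sqintable wu|exact: W12_grad_sqintable wv].
move=> phi tp.
have tpi := test_function_partial i tp.
have sp := test_sqintable tp; have spi := test_sqintable tpi.
have [_ /(_ i)[_ /(_ _ tp) e1]] := wu; have [_ /(_ i)[_ /(_ _ tp) e2]] := wv.
under eq_Rintegral do rewrite mulrDl.
rewrite rintD//; [|exact: sqintableM (W12_sqintable wu) spi|exact: sqintableM (W12_sqintable wv) spi].
under [X in _ = - X]eq_Rintegral do rewrite mulrDl.
rewrite rintD//; [|exact: sqintableM (W12_grad_sqintable i wu) sp|exact: sqintableM (W12_grad_sqintable i wv) sp].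
by rewrite e1 e2 opprD.
Qed.

Lemma W12_cst (a : R) : W12 A (fun=> a) (fun _ _ => 0).
Proof.
have sc (b : R) : sqintable mu A (fun=> b).
  by apply: (@bounded_sqintable _ _ _ _ _ mA Aoo _ `|b|).
split; first exact/square_integrableP.
move=> i; split; first exact/square_integrableP.
move=> phi tp; have tpi := test_function_partial i tp.
rewrite rintZ//; last exact: sqintable_rintable (test_sqintable tpi).
rewrite (rint_partial0 i tp) mulr0.
under eq_Rintegral do rewrite mul0r.
by rewrite Rintegral_cst// mul0r oppr0.
Qed.

Lemma W12_pairing_unique u G H i psi : W12 A u G -> W12 A u H ->
  test_function A psi ->
  \int[mu]_(x in A) (G i x * psi x) = \int[mu]_(x in A) (H i x * psi x).
Proof.
move=> [_ /(_ i)[_ wG]] [_ /(_ i)[_ wH]] tp.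
by apply: oppr_inj; rewrite -wG// -wH.
Qed.

Lemma W12_0D_test u psi : W12_0 A u -> test_function A psi ->
  W12_0 A (fun x => u x + psi x).
Proof.
move=> [G wG aG] tp; exists (fun i x => G i x + partial i psi x).
  exact: W12D wG (W12_test tp).
move=> e /aG[phi tphi [h1 h2]]; exists (fun x => phi x + psi x).
  exact: test_functionD.
have sd f : test_function A f -> forall x, differentiable f x.
  by move=> [sf _] x; exact: smooth_differentiable.
split=> [|i].
  by under eq_fun do rewrite opprD addrACA subrr addr0.
rewrite partialD; [|exact: sd..].
by under eq_fun do rewrite opprD addrACA subrr addr0; exact: h2.
Qed.

End sobolev_lemmas.

Section variational.
Context {R : realType} {m : nat}.
Variable D : set 'rV[R]_m.
Notation mu := (lebesgue_row m).
Notation nu := (lebesgue_row m.+1).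
Notation Om := (cylinder D).
Hypotheses (mD : measurable D) (Doo : (mu D < +oo)%E) (Ooo : (nu Om < +oo)%E).
Implicit Types (u psi w : 'rV[R]_m.+1 -> R) (G : 'I_m.+1 -> 'rV[R]_m.+1 -> R).

Let mO : measurable Om. Proof. exact: cylinder_measurable. Qed.

Definition dirichlet G H : R := \sum_i \int[nu]_(x in Om) (G i x * H i x).

Lemma rintable_posfun (v : 'rV[R]_m -> R) : rintable mu D v ->
  rintable mu D (fun x => Num.max (v x) 0).
Proof.
move=> vi; apply: (@le_rintable _ _ _ mu D mD _ (fun x => `|v x|)).
- by apply: measurable_maxr => //; exact: rintable_measurable vi.
- by move=> x _; rewrite /Num.max; case: ifPn => h; rewrite ?normr0 ?normr_ge0.
- exact: rintable_norm.
Qed.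

Lemma W12_fiber_rintable u G : W12 Om u G -> rintable mu D (fiber_integral u).
Proof.
move=> wu; apply: fiber_rintable => //.
by apply: sqintable_rintable => //; exact: W12_sqintable wu.
Qed.

Lemma J_E u G : W12 Om u G -> J D u G =
  (dirichlet G G + 2 * \int[mu]_(x in D) Num.max (fiber_integral u x) 0)%:E.
Proof.
move=> wu; have sG i := W12_grad_sqintable mO i wu.
have iG : rintable nu Om (fun x => \sum_i G i x ^+ 2).
  by apply: rintable_sum => // i; have [] := sG i.
have iv := rintable_posfun (W12_fiber_rintable wu).
rewrite EFinD EFinM; congr (_ + _ * _)%E.
  rewrite /dirichlet.
  under eq_bigr do under eq_Rintegral do rewrite -expr2.
  rewrite -(rint_sum mO); last by move=> i; have [] := sG i.
  by rewrite /Rintegral fineK//; exact: integrable_fin_num.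
by rewrite /Rintegral fineK//; exact: integrable_fin_num.
Qed.

Lemma fiberD_ae u w : rintable nu Om u -> rintable nu Om w ->
  {ae mu, forall x, D x ->
    fiber_integral (fun y => u y + w y) x = fiber_integral u x + fiber_integral w x}.
Proof.
move=> iu iw; apply: filterS2 (ae_fiber_rintable mD iu) (ae_fiber_rintable mD iw).
move=> x h1 h2 Dx; rewrite /fiber_integral rintD//; [exact: h1|exact: h2].
Qed.

(** Minimality against [u + psi], with the square expanded: [dirichlet G G] is finite and
    cancels. *)
Lemma minimizer_variation alpha u G psi :
  admissible D alpha u -> W12 Om u G ->
  (forall w H, admissible D alpha w -> W12 Om w H -> (J D u G <= J D w H)%E) ->
  test_function Om psi ->
  2 * \int[mu]_(x in D) Num.max (fiber_integral u x) 0 <=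
  2 * dirichlet G (fun i => partial i psi) +
  dirichlet (fun i => partial i psi) (fun i => partial i psi) +
  2 * \int[mu]_(x in D) Num.max (fiber_integral u x + fiber_integral psi x) 0.
Proof.
move=> au wu minu tp; have wp := W12_test mO Ooo tp.
have wup := W12D mO Ooo wu wp.
have aup : admissible D alpha (fun x => u x + psi x).
  have := W12_0D_test mO Ooo au tp; rewrite /admissible.
  by under eq_fun do rewrite addrAC.
have := minu _ _ aup wup; rewrite !J_E// lee_fin.
have iu := sqintable_rintable mO Ooo (W12_sqintable mO wu).
have ip := sqintable_rintable mO Ooo (W12_sqintable mO wp).
have fu := W12_fiber_rintable wu; have fp := W12_fiber_rintable wp.
have -> : \int[mu]_(x in D) Num.max (fiber_integral (fun y => u y + psi y) x) 0 =
    \int[mu]_(x in D) Num.max (fiber_integral u x + fiber_integral psi x) 0.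
  apply: rint_ae_eq => //.
  - exact: rintable_measurable (rintable_posfun (W12_fiber_rintable wup)).
  - exact: rintable_measurable (rintable_posfun (rintableD mD fu fp)).
  by apply: filterS (fiberD_ae iu ip) => x h Dx; rewrite h.
have -> : dirichlet (fun i x => G i x + partial i psi x)
    (fun i x => G i x + partial i psi x) = dirichlet G G +
    (2 * dirichlet G (fun i => partial i psi) +
     dirichlet (fun i => partial i psi) (fun i => partial i psi)).
  rewrite /dirichlet mulr_sumr -!big_split/=; apply: eq_bigr => i _.
  have sG := W12_grad_sqintable mO i wu; have sp := W12_grad_sqintable mO i wp.
  have i1 := sqintableM mO sG sG; have i2 := sqintableM mO sG sp.
  have i3 := sqintableM mO sp sp.
  rewrite -(rintZ mO 2 i2) -(rintD mO (rintableZ mO 2 i2) i3).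
  rewrite -(rintD mO i1 (rintableD mO (rintableZ mO 2 i2) i3)).
  by apply: eq_Rintegral => x _; ring.
by lra.
Qed.

End variational.

(** * Exchange between two minimizers *)

Section comparison.
Context {R : realType} {m : nat}.
Variable D : set 'rV[R]_m.
Notation mu := (lebesgue_row m).
Notation nu := (lebesgue_row m.+1).
Notation Om := (cylinder D).
Hypotheses (mD : measurable D) (Doo : (mu D < +oo)%E) (Ooo : (nu Om < +oo)%E).
Implicit Types (u psi w : 'rV[R]_m.+1 -> R) (G : 'I_m.+1 -> 'rV[R]_m.+1 -> R).

Let mO : measurable Om. Proof. exact: cylinder_measurable. Qed.

(** If [s] is the positive part of [a - b], the two arguments either stay or move towards each other
    between [b] and [a] with the same sum, so convexity of the positive part applies. For other [s]
    its Lipschitz constant 1 is used twice. *)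
Lemma posfun_exchange (a b s e : R) : 0 <= e <= 1 ->
  Num.max (a - e * s) 0 + Num.max (b + e * s) 0 <=
  Num.max a 0 + Num.max b 0 + 2 * e * `|s - Num.max (a - b) 0|.
Proof.
move=> /andP[e0 e1]; set p := Num.max (a - b) 0.
have p0 : 0 <= p by rewrite le_max lexx orbT.
have H (x y : R) : Num.max x 0 <= Num.max y 0 + `|x - y|.
  have := ler_norm (x - y); have := normr_ge0 (x - y).
  have [x0|x0] := leP x 0; have [y0|y0] := leP y 0; lra.
have h1 := H (a - e * s) (a - e * p).
have h2 := H (b + e * s) (b + e * p).
have e3 : `|a - e * s - (a - e * p)| = e * `|s - p|.
  by rewrite (_ : _ - _ - _ = e * (p - s)); [rewrite normrM (ger0_norm e0) distrC|ring].
have e4 : `|b + e * s - (b + e * p)| = e * `|s - p|.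
  by rewrite (_ : _ - (b + _) = e * (s - p)); [rewrite normrM (ger0_norm e0)|ring].
rewrite e3 in h1; rewrite e4 in h2.
suff : Num.max (a - e * p) 0 + Num.max (b + e * p) 0 <= Num.max a 0 + Num.max b 0 by lra.
have ep0 : 0 <= e * p by exact: mulr_ge0.
have ep1 : e * p <= p by rewrite ler_piMl.
move: (e * p) ep0 ep1 => q q0 q1.
have : p = 0 \/ p = a - b.
  by rewrite /p; have [|] := leP (a - b) 0; [left|right].
case=> pE.
  have -> : q = 0 by lra.
  by rewrite subr0 addr0.
have [?|?] := leP (a - q) 0; have [?|?] := leP (b + q) 0;
  have [?|?] := leP a 0; have [?|?] := leP b 0; lra.
Qed.

Lemma ler_small_slope (P Q S : R) : 0 <= Q ->
  (forall e, 0 < e -> e <= 1 -> P <= e * Q + S) -> P <= S.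
Proof.
move=> Q0 H; apply/ler_addgt0Pr => d d0.
pose e := Num.min 1 (d / (Q + 1)).
have Q1 : 0 < Q + 1 by rewrite ltr_wpDl.
have e0 : 0 < e by rewrite lt_min ltr01 divr_gt0.
apply: le_trans (H e e0 _) _; first by rewrite ge_min lexx.
rewrite addrC lerD2l.
apply: (@le_trans _ _ (d / (Q + 1) * Q)).
  by rewrite ler_wpM2r// ge_min lexx orbT.
by rewrite mulrAC ler_pdivrMr// ler_pM2l// lerDl.
Qed.

Lemma slope_bound (e P1 P2 Q d1 d2 A1 A2 S : R) : 0 < e ->
  2 * A1 <= 2 * (- e * d1) + - e * (- e * Q) + 2 * P1 ->
  2 * A2 <= 2 * (e * d2) + e * (e * Q) + 2 * P2 ->
  P1 + P2 <= A1 + A2 + 2 * e * S -> d1 - d2 <= e * Q + 2 * S.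
Proof. by move=> e0 h1 h2 h3; rewrite -(ler_pM2l (mulr_gt0 (ltr0Sn R 1) e0)); lra. Qed.

Lemma dirichletZr G H (a : R) :
  (forall i, sqintable nu Om (G i)) -> (forall i, sqintable nu Om (H i)) ->
  dirichlet D G (fun i x => a * H i x) = a * dirichlet D G H.
Proof.
move=> sG sH; rewrite /dirichlet mulr_sumr; apply: eq_bigr => i _.
rewrite -(rintZ mO a (sqintableM mO (sG i) (sH i))).
by apply: eq_Rintegral => x _; ring.
Qed.

Lemma dirichletZl G H (a : R) :
  (forall i, sqintable nu Om (G i)) -> (forall i, sqintable nu Om (H i)) ->
  dirichlet D (fun i x => a * G i x) H = a * dirichlet D G H.
Proof.
move=> sG sH; rewrite /dirichlet mulr_sumr; apply: eq_bigr => i _.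
rewrite -(rintZ mO a (sqintableM mO (sG i) (sH i))).
by apply: eq_Rintegral => x _; ring.
Qed.

Lemma partial_scaled (a : R) psi : test_function Om psi ->
  (fun i => partial i (fun x => a * psi x)) = (fun i x => a * partial i psi x).
Proof.
move=> [sp _]; apply/funext => i; rewrite partialZ// => x.
exact: smooth_differentiable.
Qed.

Lemma fiberZ (a : R) psi x : continuous psi ->
  fiber_integral (fun y => a * psi y) x = a * fiber_integral psi x.
Proof.
move=> cp; rewrite /fiber_integral rintZ//.
by apply: continuous_rintable01; exact: continuous_fiber.
Qed.

Variables (a1 a2 : R) (u1 u2 : 'rV[R]_m.+1 -> R).
Variables (G1 G2 : 'I_m.+1 -> 'rV[R]_m.+1 -> R).
Hypotheses (adm1 : admissible D a1 u1) (adm2 : admissible D a2 u2).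
Hypotheses (w1 : W12 Om u1 G1) (w2 : W12 Om u2 G2).
Hypothesis min1 : forall w H, admissible D a1 w -> W12 Om w H -> (J D u1 G1 <= J D w H)%E.
Hypothesis min2 : forall w H, admissible D a2 w -> W12 Om w H -> (J D u2 G2 <= J D w H)%E.

Notation v1 := (fiber_integral u1).
Notation v2 := (fiber_integral u2).
Notation p := (fun x => Num.max (v1 x - v2 x) 0).

(* Exchanging [eps * psi] between [u1] and [u2] does not lower the sum of the
   two energies, while it does not raise the sum of the positive parts when
   the fiber integral of [psi] is [p]. *)
Lemma exchange_inequality psi : test_function Om psi ->
  dirichlet D G1 (fun i => partial i psi) - dirichlet D G2 (fun i => partial i psi) <=
  2 * \int[mu]_(x in D) `|fiber_integral psi x - p x|.
Proof.
move=> tp; set dp := fun i => partial i psi.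
have wp := W12_test mO Ooo tp.
have sp i := W12_grad_sqintable mO i wp.
have sG1 i := W12_grad_sqintable mO i w1; have sG2 i := W12_grad_sqintable mO i w2.
have f1 := W12_fiber_rintable mD Ooo w1; have f2 := W12_fiber_rintable mD Ooo w2.
have fp := W12_fiber_rintable mD Ooo wp.
have iP : rintable mu D p by apply: rintable_posfun => //; exact: rintableB.
have iS : rintable mu D (fun x => `|fiber_integral psi x - p x|).
  by apply: rintable_norm => //; exact: rintableB.
have Q0 : 0 <= dirichlet D dp dp.
  by apply: sumr_ge0 => i _; apply: rint_ge0 => x _; rewrite -expr2 sqr_ge0.
have [cp _] : continuous psi * True by split=> //; exact: test_function_continuous tp.
(* After division by [e] the quadratic term still carries a factor [e], which tends to 0. *)
apply: (ler_small_slope Q0) => e e0 e1.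
have t1 := test_functionZ (- e) tp; have t2 := test_functionZ e tp.
have m1 := minimizer_variation mD Ooo adm1 w1 min1 t1.
have m2 := minimizer_variation mD Ooo adm2 w2 min2 t2.
rewrite !partial_scaled// in m1 m2.
rewrite !(dirichletZr _ sG1 sp, dirichletZr _ sG2 sp) in m1 m2.
have sZ (a : R) i : sqintable nu Om (fun x => a * partial i psi x).
  by apply: sqintableZ => //; exact: sp.
rewrite !(dirichletZr _ (sZ _) sp, dirichletZl _ sp sp) -/dp in m1 m2.
have E : \int[mu]_(x in D) Num.max (v1 x + fiber_integral (fun y => - e * psi y) x) 0 +
    \int[mu]_(x in D) Num.max (v2 x + fiber_integral (fun y => e * psi y) x) 0 <=
    \int[mu]_(x in D) Num.max (v1 x) 0 + \int[mu]_(x in D) Num.max (v2 x) 0 +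
    2 * e * \int[mu]_(x in D) `|fiber_integral psi x - p x|.
  have fZ (a : R) : rintable mu D (fun x => a * fiber_integral psi x) by exact: rintableZ.
  under eq_Rintegral do rewrite (fiberZ _ _ cp).
  under [X in _ + X <= _]eq_Rintegral do rewrite (fiberZ _ _ cp).
  have i1 := rintable_posfun mD (rintableD mD f1 (fZ (- e))).
  have i2 := rintable_posfun mD (rintableD mD f2 (fZ e)).
  have i3 := rintable_posfun mD f1; have i4 := rintable_posfun mD f2.
  have i5 := rintableZ mD (2 * e) iS.
  rewrite -(rintD mD i1 i2) -(rintD mD i3 i4) -(rintZ mD (2 * e) iS).
  rewrite -(rintD mD (rintableD mD i3 i4) i5).
  apply: rint_le => //; [exact: rintableD|exact: rintableD (rintableD mD i3 i4) i5|].
  move=> x _; rewrite mulNr; apply: posfun_exchange.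
  by rewrite (ltW e0).
exact: slope_bound e0 m1 m2 E.
Qed.

End comparison.

(** * Bounds on a fiber by the vertical energy *)

Section fiber_bound.
Context {R : realType} {m : nat}.
Notation leb := (@lebesgue_measure R).
Notation I01 := (`]0, 1[%classic : set (measurableTypeR R)).

Lemma rint01_cc (F : R -> R) : continuous F ->
  \int[leb]_(t in I01) F t = \int[leb]_(t in `[0, 1]) F t.
Proof.
move=> cF; rewrite (Rintegral_itv_bndo_bndc (continuous_rintable01 cF)).
apply: Rintegral_itv_obnd_cbnd.
apply: integrableS (continuous_rintable_cc 0 1 cF) => // t.
by rewrite /= !in_itv/= => /andP[t0 ->]; rewrite ltW.
Qed.

Lemma rint01_cst (a : R) : \int[leb]_(t in I01) a = a.
Proof.
rewrite Rintegral_cst//; have := @lebesgue_measure_itv R `]0, 1[; rewrite /= => ->.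
by rewrite lte_fin ltr01/= subr0 mulr1.
Qed.

(** The derivative [F] is integrated from the base, where [psi] vanishes, and
    [|F| <= a + F^2 / (4 a)]. The free parameter [a] takes the place of a square root from the
    Cauchy-Schwarz inequality. *)
Lemma test_slice_bound (D : set 'rV[R]_m) (psi : 'rV[R]_m.+1 -> R) x (t a : R) :
  test_function (cylinder D) psi -> 0 < t -> t < 1 -> 0 < a ->
  `|psi (row_snoc (x, t))| <=
  a * t + (4 * a)^-1 * fiber_integral (fun y => partial ord_max psi y ^+ 2) x.
Proof.
move=> tp t0 t1 a0; have tpm := test_function_partial ord_max tp.
pose F (s : R) := partial ord_max psi (row_snoc (x, s)).
have cF : continuous F.
  by apply: continuous_fiber; exact: test_function_continuous tpm.
have cF2 : continuous (fun s => F s ^+ 2) by exact: continuous_sqr.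
have sp : smooth psi by case: tp.
have p0 : psi (row_snoc (x, 0)) = 0.
  by apply: (test_function_out tp) => /cylinder_snoc[_]; rewrite ltxx.
have E : psi (row_snoc (x, t)) = \int[leb]_(s in `[0, t]) F s.
  rewrite /Rintegral (@continuous_FTC2 R F (fun s => psi (row_snoc (x, s))) 0 t t0).
  - by rewrite p0 sube0.
  - exact: continuous_subspaceT.
  - split; first by move=> s _; exact: derivable_fiber.
    + by apply: cvg_at_right_filter; apply: continuous_fiber; exact: smooth_continuous.
    + by apply: cvg_at_left_filter; apply: continuous_fiber; exact: smooth_continuous.
  - by move=> s _; rewrite derive1_fiber.
have mt : measurable (`[0, t]%classic : set (measurableTypeR R)) by exact: measurable_itv.
have iF := continuous_rintable_cc 0 t cF.
have iF2 := continuous_rintable_cc 0 t cF2.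
have ia : rintable leb (`[0, t]%classic : set (measurableTypeR R)) (fun=> a).
  by apply: continuous_rintable_cc => s; exact: cvg_cst.
rewrite E; apply: le_trans (le_norm_rint mt iF) _.
apply: (@le_trans _ _ (\int[leb]_(s in `[0, t]) (a + (4 * a)^-1 * F s ^+ 2))).
  apply: rint_le => //; first exact: rintable_norm.
    by apply: rintableD => //; exact: rintableZ.
  move=> s _; rewrite -(ler_pM2l (_ : 0 < 4 * a)) ?mulr_gt0//.
  rewrite mulrDr mulrA mulfV ?mul1r; last by rewrite gt_eqF// mulr_gt0.
  have := sqr_ge0 (`|F s| - 2 * a); rewrite -[F s ^+ 2]real_normK ?num_real//; nra.
have ic := rintableZ mt (4 * a)^-1 iF2.
rewrite (rintD mt ia ic) (rintZ mt _ iF2) lerD//.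
  rewrite Rintegral_cst//; have := @lebesgue_measure_itv R `[0, t]; rewrite /= => ->.
  by rewrite lte_fin t0/= subr0.
rewrite ler_wpM2l//; first by rewrite invr_ge0 mulr_ge0// ltW.
rewrite /fiber_integral (rint01_cc cF2) -subr_ge0.
have iF01 := continuous_rintable_cc 0 1 cF2.
rewrite (@Rintegral_itvB _ (fun s => F s ^+ 2) (BLeft 0) (BRight 1) t iF01) ?bnd_simp ?(ltW t0) ?(ltW t1)//.
by apply: Rintegral_ge0 => s _; exact: sqr_ge0.
Qed.

Lemma test_fiber_bound (D : set 'rV[R]_m) (psi : 'rV[R]_m.+1 -> R) x (a : R) :
  test_function (cylinder D) psi -> 0 < a ->
  `|fiber_integral psi x| <=
  a + (4 * a)^-1 * fiber_integral (fun y => partial ord_max psi y ^+ 2) x.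
Proof.
move=> tp a0; set X := _ * fiber_integral _ _.
have mI := @measurable_I01 R.
have ci : rintable leb I01 (fun t => psi (row_snoc (x, t))).
  by apply/continuous_rintable01/continuous_fiber; exact: test_function_continuous tp.
apply: le_trans (le_norm_rint mI ci) _; rewrite -[leRHS]rint01_cst.
apply: rint_le => //; first exact: rintable_norm.
  by apply: continuous_rintable01 => t; exact: cvg_cst.
move=> t; rewrite /= in_itv/= => /andP[t0 t1].
apply: le_trans (test_slice_bound x tp t0 t1 a0) _.
by rewrite lerD2r ler_piMr// ltW.
Qed.

End fiber_bound.

(** [Num.max (f x) (g x)] agrees with [g x] almost everywhere and dominates [f x] everywhere, which
    reduces the claim to [rint_le]. *)
Lemma rint_ae_le {R : realType} d (T : measurableType d)
    (mu : {measure set T -> \bar R}) (A : set T) (f g : T -> R) :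
  measurable A -> rintable mu A f -> rintable mu A g ->
  {ae mu, forall x, A x -> f x <= g x} ->
  \int[mu]_(x in A) f x <= \int[mu]_(x in A) g x.
Proof.
move=> mA fi gi fg; pose M x := Num.max (f x) (g x).
have mf := rintable_measurable fi; have mg := rintable_measurable gi.
have mM : measurable_fun A M by exact: measurable_maxr.
have -> : \int[mu]_(x in A) g x = \int[mu]_(x in A) M x.
  by apply: rint_ae_eq => //; apply: filterS fg => x h Ax; rewrite /M max_r// h.
apply: rint_le => // [|x _]; last by rewrite /M le_max lexx.
apply: (@le_rintable _ _ _ mu A mA _ (fun x => `|f x| + `|g x|)) => //.
  move=> x _; rewrite /M; have := normr_ge0 (f x); have := normr_ge0 (g x).
  by have [h|h] := leP (f x) (g x) => g0 f0; rewrite ?lerDr ?lerDl.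
by apply: rintableD => //; exact: rintable_norm.
Qed.

(** * Approximation of admissible functions by test functions *)

Section approximation.
Context {R : realType} {m : nat}.
Variable D : set 'rV[R]_m.
Notation mu := (lebesgue_row m).
Notation nu := (lebesgue_row m.+1).
Notation Om := (cylinder D).
Hypotheses (mD : measurable D) (Doo : (mu D < +oo)%E) (Ooo : (nu Om < +oo)%E).

Let mO : measurable Om. Proof. exact: cylinder_measurable. Qed.

(** Two weak gradients are in play: [G], which enters [J], and [G'], which the definition of [W12_0]
    approximates. They are compared through pairings with test functions, the only form in which the
    exchange inequality uses [G]. *)
Lemma admissible_approx (a : R) u G : admissible D a u -> W12 Om u G ->
  exists G', [/\ forall i, sqintable nu Om (G' i),
    forall i chi, test_function Om chi ->
      \int[nu]_(x in Om) (G i x * chi x) = \int[nu]_(x in Om) (G' i x * chi x) &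
    forall e : R, 0 < e -> exists2 phi, test_function Om phi &
      \int[nu]_(x in Om) ((u x - a - phi x) ^+ 2) <= e ^+ 2 /\
      forall i, \int[nu]_(x in Om) ((G' i x - partial i phi x) ^+ 2) <= e ^+ 2].
Proof.
move=> [G' wG' aG'] wu; exists G'.
have sG' i := W12_grad_sqintable mO i wG'.
split=> // [i chi tchi|e e0].
  have wc := W12D mO Ooo wu (W12_cst mO Ooo (- a)).
  rewrite -(W12_pairing_unique i wc wG' tchi).
  by under [RHS]eq_Rintegral do rewrite addr0.
have [phi tphi [h1 h2]] := aG' e e0; exists phi => //.
have su := W12_sqintable mO wG'.
have sp := test_sqintable mO Ooo tphi.
split=> [|i].
  by apply: L2norm_lt => //; exact: sqintableB.
apply: L2norm_lt => //; apply: sqintableB => //.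
exact/(test_sqintable mO Ooo)/test_function_partial.
Qed.

(** Integrate [|k| <= e + k^2 / (4 e)]. *)
Lemma rint_abs_le (k : 'rV[R]_m.+1 -> R) (e : R) : sqintable nu Om k -> 0 < e ->
  \int[nu]_(x in Om) (k x ^+ 2) <= (2 * e) ^+ 2 ->
  \int[nu]_(x in Om) `|k x| <= e * (fine (nu Om) + 1).
Proof.
move=> sk e0 ke; have ik := sqintable_rintable mO Ooo sk.
have [_ ik2] := sk.
have ic := rintableZ mO (4 * e)^-1 ik2.
have ie : rintable nu Om (fun=> e) by exact: rintable_cst.
apply: (@le_trans _ _ (\int[nu]_(x in Om) (e + (4 * e)^-1 * k x ^+ 2))).
  apply: rint_le => //; [exact: rintable_norm|exact: rintableD|].
  move=> x _; rewrite -(ler_pM2l (_ : 0 < 4 * e)) ?mulr_gt0//.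
  rewrite mulrDr mulrA mulfV ?mul1r; last by rewrite gt_eqF// mulr_gt0.
  have := sqr_ge0 (`|k x| - 2 * e); rewrite -[k x ^+ 2]real_normK ?num_real//; nra.
rewrite (rintD mO ie ic) (rintZ mO _ ik2) Rintegral_cst// mulrDr mulr1 lerD2l.
rewrite ler_pdivrMl ?mulr_gt0//; apply: le_trans ke _.
by rewrite le_eqVlt; apply/orP; left; apply/eqP; ring.
Qed.

Lemma norm_fiber_le (k : 'rV[R]_m.+1 -> R) : rintable nu Om k ->
  \int[mu]_(x in D) `|fiber_integral k x| <= \int[nu]_(x in Om) `|k x|.
Proof.
move=> ik; have ik' := rintable_norm ik.
rewrite (rint_fiber mD ik').
have f1 := fiber_rintable mD ik; have f2 := fiber_rintable mD ik'.
apply: rint_ae_le => //; first exact: rintable_norm.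
apply: filterS (ae_fiber_rintable mD ik) => x h Dx.
by apply: le_norm_rint (h Dx); exact: measurable_I01.
Qed.

Lemma sqrB_le2 (a b : R) : (a - b) ^+ 2 <= 2 * a ^+ 2 + 2 * b ^+ 2.
Proof.
rewrite -subr_ge0 (_ : _ - _ = (a + b) ^+ 2); first exact: sqr_ge0.
by ring.
Qed.

Lemma rint_sqrB_le (k1 k2 : 'rV[R]_m.+1 -> R) (e : R) :
  sqintable nu Om k1 -> sqintable nu Om k2 ->
  \int[nu]_(x in Om) (k1 x ^+ 2) <= e ^+ 2 ->
  \int[nu]_(x in Om) (k2 x ^+ 2) <= e ^+ 2 ->
  \int[nu]_(x in Om) ((k1 x - k2 x) ^+ 2) <= (2 * e) ^+ 2.
Proof.
move=> s1 s2 h1 h2; have [_ i1] := s1; have [_ i2] := s2.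
have [_ i12] := sqintableB mO s1 s2.
have ii := rintableD mO (rintableZ mO 2 i1) (rintableZ mO 2 i2).
apply: le_trans (rint_le mO i12 ii (fun x _ => sqrB_le2 _ _)) _.
rewrite (rintD mO (rintableZ mO 2 i1) (rintableZ mO 2 i2)).
by rewrite (rintZ mO 2 i1) (rintZ mO 2 i2) exprMn; lra.
Qed.

(** [X] is the energy of the test function; the half of it that Young's inequality creates is moved
    to the left. *)
Lemma absorb_energy (B X P S A W r : R) : 0 <= B -> 0 <= W ->
  X <= 2 * B * P + r -> 2 * B * P <= 4 * B * S + 2^-1 * X + 2 * W -> S <= A ->
  X <= 8 * B * A + 16 * W + 2 * r.
Proof.
move=> B0 W0 h1 h2 SA; have := ler_wpM2l (mulr_ge0 (ler0n _ 4) B0) SA; lra.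
Qed.

Lemma young_pairing (B s h f : R) : 2 * B * (f * s) <=
  2 * B * (h * s) + (2^-1 * s ^+ 2 + 2 * B ^+ 2 * (h - f) ^+ 2).
Proof.
rewrite -subr_ge0 (_ : _ - _ = 2^-1 * (s + 2 * B * (h - f)) ^+ 2).
  by rewrite mulr_ge0// sqr_ge0.
by field.
Qed.

Lemma rint_young_pairing (B Q : R) (s h f : 'rV[R]_m.+1 -> R) :
  sqintable nu Om s -> sqintable nu Om h -> sqintable nu Om f ->
  \int[nu]_(x in Om) ((h x - f x) ^+ 2) <= Q ->
  2 * B * \int[nu]_(x in Om) (f x * s x) <=
  2 * B * \int[nu]_(x in Om) (h x * s x) +
  (2^-1 * \int[nu]_(x in Om) (s x ^+ 2) + 2 * B ^+ 2 * Q).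
Proof.
move=> ss sh sf hQ; have [_ is2] := ss; have [_ ihf] := sqintableB mO sh sf.
have ifs := sqintableM mO sf ss; have ihs := sqintableM mO sh ss.
have j1 := rintableZ mO (2 * B) ihs; have j2 := rintableZ mO 2^-1 is2.
have j3 := rintableZ mO (2 * B ^+ 2) ihf.
rewrite -(rintZ mO _ ifs).
apply: le_trans (rint_le mO (rintableZ mO _ ifs) (rintableD mO j1 (rintableD mO j2 j3))
  (fun x _ => young_pairing _ _ _ _)) _.
rewrite (rintD mO j1 (rintableD mO j2 j3)) (rintD mO j2 j3).
rewrite (rintZ mO _ ihs) (rintZ mO _ is2) (rintZ mO _ ihf) lerD2l lerD2l.
by rewrite ler_wpM2l// mulr_ge0// sqr_ge0.
Qed.

End approximation.

(** * Comparison of the fiber integrals *)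

Section comparison_theorem.
Context {R : realType} {m : nat}.
Variable D : set 'rV[R]_m.
Notation mu := (lebesgue_row m).
Notation nu := (lebesgue_row m.+1).
Notation Om := (cylinder D).
Hypotheses (mD : measurable D) (Doo : (mu D < +oo)%E) (Ooo : (nu Om < +oo)%E).

Let mO : measurable Om. Proof. exact: cylinder_measurable. Qed.

Lemma max0_lip (x y : R) : `|Num.max x 0 - Num.max y 0| <= `|x - y|.
Proof.
have H u v : u <= v -> 0 <= Num.max v 0 - Num.max u (0 : R) <= v - u.
  move=> uv; have [v0|v0] := leP v 0; have [u0|u0] := leP u 0; lra.
have [xy|xy] := leP x y.
  have /andP[p1 p2] := H _ _ xy.
  by rewrite distrC ger0_norm// distrC ger0_norm ?subr_ge0.
have /andP[p1 p2] := H _ _ (ltW xy).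
by rewrite ger0_norm// ger0_norm ?subr_ge0// ltW.
Qed.

(** The total error with approximation accuracy [l^2]: the energy is then of order [l^2], and
    dividing it by [4 l] still leaves order [l]. *)
Lemma small_error (A d B N l : R) : 0 <= A -> 0 <= d -> 0 <= B -> 0 <= N ->
  0 < l -> l <= 1 ->
  l ^+ 2 * A + l * d + (4 * l)^-1 * (8 * B * (l ^+ 2 * A) +
    16 * B ^+ 2 * (2 * l ^+ 2) ^+ 2 * N + 2 * l ^+ 2 * d) <=
  l * (A + d + (2 * B * A + 16 * B ^+ 2 * N + d)).
Proof.
move=> A0 d0 B0 N0 l0 l1.
have -> : (4 * l)^-1 * (8 * B * (l ^+ 2 * A) +
    16 * B ^+ 2 * (2 * l ^+ 2) ^+ 2 * N + 2 * l ^+ 2 * d) =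
    l * (2 * B * A) + l * (16 * B ^+ 2 * N) * l ^+ 2 + l * (2^-1 * d).
  by field; rewrite gt_eqF.
have l2 : l ^+ 2 <= l by rewrite expr2 ler_piMr// ltW.
have t1 : l ^+ 2 * A <= l * A by rewrite ler_wpM2r.
have t2 : l * (16 * B ^+ 2 * N) * l ^+ 2 <= l * (16 * B ^+ 2 * N).
  rewrite ler_piMr//; last exact: le_trans l1.
  by rewrite mulr_ge0 ?(ltW l0)// mulr_ge0// mulr_ge0// sqr_ge0.
have t3 : 0 <= l * d by rewrite mulr_ge0// ltW.
lra.
Qed.

(** In [key], [e] is the accuracy of the approximation by test functions and [l] the free parameter
    of [test_fiber_bound]. The distance [S] of the mean of [psi] to [p] is of order [e]. By the
    exchange inequality so is the energy [X] of [psi], up to terms that are absorbed. The mean of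
    [psi], and with it [p], is therefore of order [l + e / l], and [e = l^2] lets everything tend to
    0. *)
Theorem fiber_comparison (a1 a2 : R) u1 u2 : a1 <= a2 ->
  minimizer D a1 u1 -> minimizer D a2 u2 ->
  {ae mu, forall x, D x -> fiber_integral u1 x <= fiber_integral u2 x}.
Proof.
move=> a12 [adm1 [G1 w1 min1]] [adm2 [G2 w2 min2]].
have [H1 [sH1 pH1 ap1]] := admissible_approx mD Ooo adm1 w1.
have [H2 [sH2 pH2 ap2]] := admissible_approx mD Ooo adm2 w2.
have exch := exchange_inequality mD Ooo adm1 adm2 w1 w2 min1 min2.
set v1 := fiber_integral u1; set v2 := fiber_integral u2.
pose p x := Num.max (v1 x - v2 x) 0.
have f1 : rintable mu D v1 := W12_fiber_rintable mD Ooo w1.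
have f2 : rintable mu D v2 := W12_fiber_rintable mD Ooo w2.
have ip : rintable mu D p by apply: rintable_posfun => //; exact: rintableB.
have [B' B'0 sB'] := @derive1_step_bounded R.
pose B := 1 + B'.
have B1 : 1 <= B by rewrite /B lerDl ltW.
have B0 : 0 < B by exact: lt_le_trans B1.
have sB t : `|derive1 (@step R) t| <= B by rewrite (le_trans (sB' t))// /B lerDr.
pose dD := fine (mu D); pose dO := fine (nu Om).
have dD0 : 0 <= dD by exact: fine_ge0.
have dO0 : 0 <= dO by exact: fine_ge0.
have key e l : 0 < e -> 0 < l ->
  \int[mu]_(x in D) p x <= e * (dD + dO + 1) + l * dD +
    (4 * l)^-1 * (8 * B * (e * (dD + dO + 1)) +
      16 * B ^+ 2 * (2 * e) ^+ 2 * m.+1%:R + 2 * e * dD).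
  move=> e0 l0.
  have [phi1 t1 [q1 g1]] := ap1 e e0; have [phi2 t2 [q2 g2]] := ap2 e e0.
  pose g := (fun y => phi1 y - phi2 y).
  have tg : test_function Om g by exact: test_functionB.
  have c0 : 0 <= a2 - a1 by rewrite subr_ge0.
  have [psi tpsi [mean energy]] := exists_test_function sB B1 tg c0 e0.
  have sq f : test_function Om f -> sqintable nu Om f by exact: test_sqintable.
  have dsq f i : test_function Om f -> sqintable nu Om (partial i f).
    by move=> tf; apply: sq; exact: test_function_partial.
  have wpsi := W12_test mO Ooo tpsi.
  have fpsi := W12_fiber_rintable mD Ooo wpsi.
  pose X := \sum_i \int[nu]_(x in Om) (partial i psi x ^+ 2).
  pose S := \int[mu]_(x in D) `|fiber_integral psi x - p x|.
  have iS : rintable mu D (fun x => `|fiber_integral psi x - p x|).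
    by apply: rintable_norm => //; exact: rintableB.
  have ipp i : rintable nu Om (fun x => partial i psi x ^+ 2).
    by have [] := dsq _ i tpsi.
  have igp i : rintable nu Om (fun x => partial i g x * partial i psi x).
    by apply: sqintableM => //; exact: dsq.
  have fpp i := fiber_rintable mD (ipp i); have fgp i := fiber_rintable mD (igp i).
  have ic (c : R) : rintable mu D (fun=> c) by exact: rintable_cst.
  have XE : X <= 2 * B * dirichlet D (fun i => partial i g) (fun i => partial i psi) +
      e * dD.
    pose P i := fiber_integral (fun y => partial i psi y ^+ 2).
    pose Q i := fiber_integral (fun y => partial i g y * partial i psi y).
    have EP : X = \int[mu]_(x in D) \sum_i P i x.
      rewrite (rint_sum mD (index_enum _) (F := P) fpp); apply: eq_bigr => i _.
      exact: (rint_fiber mD (ipp i)).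
    have EQ : dirichlet D (fun i => partial i g) (fun i => partial i psi) =
        \int[mu]_(x in D) \sum_i Q i x.
      rewrite (rint_sum mD (index_enum _) (F := Q) fgp); apply: eq_bigr => i _.
      exact: (rint_fiber mD (igp i)).
    have iP : rintable mu D (fun x => \sum_i P i x) := rintable_sum mD (index_enum _) (F := P) fpp.
    have iQ : rintable mu D (fun x => \sum_i Q i x) := rintable_sum mD (index_enum _) (F := Q) fgp.
    rewrite EP EQ -(rintZ mD _ iQ) -(Rintegral_cst mu mD).
    rewrite -(rintD mD (rintableZ mD _ iQ) (ic e)).
    apply: rint_le => //; first by apply: rintableD => //; exact: rintableZ.
    by move=> x _; exact: energy.
  (* The approximation error. Its fiber mean is the mean of [g] less [c = a2 - a1], less [v1 - v2],
     so truncating the mean of [g] at [c] approximates [p]. *)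
  pose k := (fun y => g y - ((u1 y - a1) - (u2 y - a2))).
  have su a u G : W12 Om u G -> sqintable nu Om (fun y => u y - a).
    move=> wu; apply: sqintableB => //; first exact: W12_sqintable wu.
    by have := W12_sqintable mO (W12_cst mO Ooo a).
  have sk : sqintable nu Om k.
    by apply: sqintableB => //; [exact: sq|apply: sqintableB => //; [exact: su w1|exact: su w2]].
  have ik := sqintable_rintable mO Ooo sk.
  have kE : \int[nu]_(x in Om) (k x ^+ 2) <= (2 * e) ^+ 2.
    rewrite (_ : Rintegral _ _ _ = \int[nu]_(x in Om)
        ((u2 x - a2 - phi2 x - (u1 x - a1 - phi1 x)) ^+ 2)); last first.
      by apply: eq_Rintegral => x _; rewrite /k /g; congr (_ ^+ 2); ring.
    apply: (rint_sqrB_le mD _ _ q2 q1); apply: sqintableB => //.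
    - exact: su w2.
    - exact: sq.
    - exact: su w1.
    - exact: sq.
  have kabs := rint_abs_le mD Ooo sk e0 kE.
  have fib : {ae mu, forall x, D x ->
      fiber_integral k x = fiber_integral g x - (v1 x - v2 x + (a2 - a1))}.
    have ig := sqintable_rintable mO Ooo (sq _ tg).
    have iu1 := sqintable_rintable mO Ooo (W12_sqintable mO w1).
    have iu2 := sqintable_rintable mO Ooo (W12_sqintable mO w2).
    apply: filterS3 (ae_fiber_rintable mD ig) (ae_fiber_rintable mD iu1)
      (ae_fiber_rintable mD iu2) => x r1 r2 r3 Dx.
    have mI := @measurable_I01 R.
    have {}r1 := r1 Dx; have {}r2 := r2 Dx; have {}r3 := r3 Dx.
    have rc (a : R) : rintable lebesgue_measure (`]0, 1[%classic : set (measurableTypeR R)) (fun=> a).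
      by apply: continuous_rintable01 => t; exact: cvg_cst.
    rewrite /v1 /v2 /fiber_integral -(rint01_cst (a2 - a1)) -(rintB mI r2 r3).
    rewrite -(rintD mI (rintableB mI r2 r3) (rc _)).
    rewrite -(rintB mI r1 (rintableD mI (rintableB mI r2 r3) (rc _))).
    by apply: eq_Rintegral => t _; rewrite /k; ring.
  have SE : S <= e * (dD + dO + 1).
    have fk := fiber_rintable mD ik.
    have iek : rintable mu D (fun x => e + `|fiber_integral k x|).
      by apply: rintableD => //; exact: rintable_norm.
    apply: (@le_trans _ _ (\int[mu]_(x in D) (e + `|fiber_integral k x|))).
      apply: rint_ae_le => //; apply: filterS fib => x h Dx.
      have := max0_lip (fiber_integral g x - (a2 - a1)) (v1 x - v2 x).
      rewrite (_ : _ - _ - (_ - _) = fiber_integral k x); last by rewrite h//; ring.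
      have := mean x; rewrite -/(p x) => m1 m2.
      rewrite (_ : _ - p x = (fiber_integral psi x - Num.max (fiber_integral g x - (a2 - a1)) 0) +
        (Num.max (fiber_integral g x - (a2 - a1)) 0 - p x)); last by ring.
      exact: le_trans (ler_normD _ _) (lerD m1 m2).
    rewrite (rintD mD (ic e) (rintable_norm fk)) Rintegral_cst//.
    rewrite -addrA mulrDr lerD2l; exact: le_trans (norm_fiber_le mD ik) kabs.
  have pair i (chi := partial i psi) : test_function Om chi.
    exact: test_function_partial.
  (* Against derivatives of [psi], [G1 - G2] may be replaced by [H1 - H2], which is close in [L^2]
     to the gradient of [g]; Young's inequality pays for the difference with half of [X]. *)
  have DE : 2 * B * dirichlet D (fun i => partial i g) (fun i => partial i psi) <=
      4 * B * S + 2^-1 * X + 2 * B ^+ 2 * (2 * e) ^+ 2 * m.+1%:R.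
    have ex := exch psi tpsi.
    have sG1 i := W12_grad_sqintable mO i w1; have sG2 i := W12_grad_sqintable mO i w2.
    have E0 : dirichlet D G1 (fun i => partial i psi) - dirichlet D G2 (fun i => partial i psi) =
        \sum_i \int[nu]_(x in Om) ((H1 i x - H2 i x) * partial i psi x).
      rewrite /dirichlet -sumrB; apply: eq_bigr => i _.
      rewrite pH1// pH2//.
      have i1 := sqintableM mO (sH1 i) (dsq _ i tpsi); have i2 := sqintableM mO (sH2 i) (dsq _ i tpsi).
      by rewrite -(rintB mO i1 i2); apply: eq_Rintegral => x _; ring.
    have E1 i : 2 * B * \int[nu]_(x in Om) (partial i g x * partial i psi x) <=
        2 * B * \int[nu]_(x in Om) ((H1 i x - H2 i x) * partial i psi x) +
        (2^-1 * \int[nu]_(x in Om) (partial i psi x ^+ 2) + 2 * B ^+ 2 * (2 * e) ^+ 2).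
      have d1 := sqintableB mO (sH1 i) (dsq _ i t1); have d2 := sqintableB mO (sH2 i) (dsq _ i t2).
      apply: rint_young_pairing => //; [exact: dsq|exact: sqintableB|exact: dsq|].
      rewrite (_ : Rintegral _ _ _ = \int[nu]_(x in Om)
          ((H1 i x - partial i phi1 x - (H2 i x - partial i phi2 x)) ^+ 2)).
        have sq12 := rint_sqrB_le mD d1 d2 (g1 i) (g2 i); exact: sq12.
      apply: eq_Rintegral => x _; rewrite /g partialB//; [|by case: t1|by case: t2].
      by congr (_ ^+ 2); ring.
    rewrite /dirichlet mulr_sumr; apply: le_trans (ler_sum _ (fun i _ => E1 i)) _.
    rewrite big_split/= -mulr_sumr -E0 big_split/= -mulr_sumr -/X.
    rewrite sumr_const card_ord -[_ *+ m.+1]mulr_natr addrA lerD2r lerD2r.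
    have -> : 4 * B * S = 2 * B * (2 * S) by ring.
    by rewrite ler_pM2l// mulr_gt0.
  have XB : X <= 8 * B * (e * (dD + dO + 1)) +
      16 * B ^+ 2 * (2 * e) ^+ 2 * m.+1%:R + 2 * e * dD.
    have W0 : 0 <= B ^+ 2 * (2 * e) ^+ 2 * m.+1%:R.
      by apply: mulr_ge0; [apply: mulr_ge0; exact: sqr_ge0|exact: ler0n].
    have W2 c : c * B ^+ 2 * (2 * e) ^+ 2 * m.+1%:R = c * (B ^+ 2 * (2 * e) ^+ 2 * m.+1%:R).
      by rewrite -!mulrA.
    rewrite W2 -[2 * e * dD]mulrA; rewrite W2 in DE.
    exact: absorb_energy (ltW B0) W0 XE DE SE.
  have iap : rintable mu D (fun x => `|fiber_integral psi x|) by exact: rintable_norm.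
  have psiB : \int[mu]_(x in D) `|fiber_integral psi x| <= l * dD + (4 * l)^-1 * X.
    have l4 : 0 <= (4 * l)^-1 by rewrite invr_ge0 mulr_ge0// ltW.
    have X1 : \int[nu]_(x in Om) (partial ord_max psi x ^+ 2) <= X.
      rewrite /X (bigD1 ord_max)//= lerDl; apply: sumr_ge0 => i _.
      by apply: rint_ge0 => x _; exact: sqr_ge0.
    apply: le_trans (lerD (lexx _) (ler_wpM2l l4 X1)).
    rewrite (rint_fiber mD (ipp ord_max)) -(Rintegral_cst mu mD) -(rintZ mD _ (fpp ord_max)).
    rewrite -(rintD mD (ic l) (rintableZ mD _ (fpp ord_max))).
    apply: rint_le => //; first by apply: rintableD => //; exact: rintableZ.
    by move=> x _; have tb := test_fiber_bound x tpsi l0; exact: tb.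
  have pE : \int[mu]_(x in D) p x <= S + \int[mu]_(x in D) `|fiber_integral psi x|.
    rewrite -(rintD mD iS iap); apply: rint_le => //; first exact: rintableD.
    move=> x _; apply: le_trans (ler_norm _) _.
    rewrite -[X in `|X| <= _](subKr (fiber_integral psi x)) [leRHS]addrC; exact: ler_normB.
  apply: le_trans pE _; rewrite -addrA lerD//; apply: le_trans psiB _.
  by rewrite lerD2l ler_wpM2l// invr_ge0 mulr_ge0// ltW.
pose A := dD + dO + 1.
have A0 : 0 <= A by rewrite /A !addr_ge0.
have p0 : \int[mu]_(x in D) p x <= 0.
  have Q0 : 0 <= A + dD + (2 * B * A + 16 * B ^+ 2 * m.+1%:R + dD).
    by rewrite !addr_ge0// !mulr_ge0// ?sqr_ge0// ltW.
  apply: (ler_small_slope Q0) => l l0 l1; rewrite addr0.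
  apply: le_trans (key (l ^+ 2) l (exprn_gt0 2 l0) l0) _; rewrite -/A.
  exact: small_error A0 dD0 (ltW B0) (ler0n _ _) l0 l1.
have pp x : D x -> 0 <= p x by move=> _; rewrite /p le_max lexx orbT.
have := rint_eq0_ae mD ip pp p0; apply: filterS => x h Dx.
have := h Dx; rewrite /p; have [|h1 h2] := leP (v1 x - v2 x) 0; first by rewrite subr_le0.
by move: h1; rewrite h2 ltxx.
Qed.

End comparison_theorem.

(** * The zero set of the fiber integral *)

Section domain.
Context {R : realType} {m : nat}.
Variable D : set 'rV[R]_m.
Notation mu := (lebesgue_row m).
Notation nu := (lebesgue_row m.+1).

(** [D] is the section of the cylinder at height 1/2. *)
Lemma open_cylinder_base_measurable : open (cylinder D) -> measurable D.
Proof.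
move=> /open_row_measurable mO.
have h01 : (0 < (2^-1 : R) < 1)%R by apply/andP; split; lra.
have -> : D = (row_snoc \o (fun x : 'rV[R]_m => (x, 2^-1 : measurableTypeR R))) @^-1` cylinder D.
  apply/seteqP; split=> x /=; last by case/cylinder_snoc.
  by move=> Dx; apply/cylinder_snoc.
rewrite -[X in measurable X]setTI.
have mpair : measurable_fun [set: 'rV[R]_m] (fun x => (x, 2^-1 : measurableTypeR R)).
  by apply: measurable_fun_pair; [exact: measurable_id|exact: measurable_cst].
exact: (measurableT_comp measurable_row_snoc mpair).
Qed.

Lemma lebesgue_row_cylinder : measurable D -> nu (cylinder D) = mu D.
Proof.
move=> mD; rewrite /= /lebesgue_row_step /pushforward.
have -> : row_snoc @^-1` cylinder D = D `*` (`]0, 1[%classic : set (measurableTypeR R)).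
  apply/seteqP; split=> -[x t] /=; rewrite in_itv/=.
    by case/cylinder_snoc.
  by move=> [Dx t01]; apply/cylinder_snoc.
rewrite (product_measure1E _ _ mD (@measurable_I01 R)).
have := @lebesgue_measure_itv R `]0, 1[; rewrite /= => ->.
by rewrite lte_fin ltr01/= sube0 mule1.
Qed.

Lemma fiber_integral0 (x : 'rV[R]_m) : fiber_integral (fun=> 0) x = 0.
Proof. by rewrite /fiber_integral rint01_cst. Qed.

(** [J] is nonnegative and vanishes at 0. This supplies a minimizer with boundary value 0 to be
    compared with the others. *)
Lemma minimizer0 : measurable D -> (nu (cylinder D) < +oo)%E ->
  minimizer D 0 (fun=> 0).
Proof.
move=> mD Ooo; have mO := cylinder_measurable mD.
have w0 (a : R) := W12_cst mO Ooo a.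
split.
  exists (fun _ _ => 0); first exact: w0.
  move=> e e0; exists (fun=> 0).
    by split; [exact: smooth_cst|exists set0; split=> //; exact: compact0].
  have p0 i : partial i (fun=> 0 : R) = (fun=> 0) :> ('rV[R]_m.+1 -> R).
    by apply/funext => x; rewrite /partial derive_cst.
  split=> [|i].
    by under eq_fun do rewrite !subr0; rewrite L2norm0.
  by rewrite p0; under eq_fun do rewrite subr0; rewrite L2norm0.
exists (fun _ _ => 0); first exact: w0.
move=> w H _ wH; rewrite (J_E mD Ooo (w0 0)) (J_E mD Ooo wH) lee_fin.
apply: (@le_trans _ _ 0).
  rewrite /dirichlet big1 ?add0r; last first.
    by move=> i _; under eq_Rintegral do rewrite mul0r; rewrite Rintegral_cst// mul0r.
  under eq_Rintegral do rewrite fiber_integral0 maxxx.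
  by rewrite Rintegral_cst// mul0r mulr0.
rewrite addr_ge0//.
  by apply: sumr_ge0 => i _; apply: rint_ge0 => x _; rewrite -expr2 sqr_ge0.
by rewrite mulr_ge0//; apply: rint_ge0 => x _; rewrite le_max lexx orbT.
Qed.

End domain.

(** * Thin layers at the base of the cylinder *)

Section layer.
Context {R : realType} {m : nat}.
Notation leb := (@lebesgue_measure R).
Notation I01 := (`]0, 1[%classic : set (measurableTypeR R)).

Lemma rintable_subset d (T : measurableType d) (mu : {measure set T -> \bar R})
    (A B : set T) (f : T -> R) : measurable A -> measurable B -> A `<=` B ->
  rintable mu B f -> rintable mu A f.
Proof. by move=> mA mB AB; exact: integrableS. Qed.

Lemma rint_subset d (T : measurableType d) (mu : {measure set T -> \bar R})
    (A B : set T) (f : T -> R) : measurable A -> measurable B -> A `<=` B ->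
  rintable mu B f -> (forall x, B x -> 0 <= f x) ->
  \int[mu]_(x in A) f x <= \int[mu]_(x in B) f x.
Proof.
move=> mA mB AB fi f0; have fiA := rintable_subset mA mB AB fi.
rewrite /Rintegral; apply: fine_le.
- exact: (integrable_fin_num mA fiA).
- exact: (integrable_fin_num mB fi).
apply: ge0_subset_integral => //.
  exact: measurable_int fi.
Qed.

(** If [psi] approximates a function of modulus at least [c] with error [f], integrating over
    heights below [t] gives [c * t]. There [psi] is small by [test_slice_bound], so the error or the
    vertical energy must account for it. *)
Lemma thin_layer (D : set 'rV[R]_m) (psi f : 'rV[R]_m.+1 -> R) x (c t a : R) :
  test_function (cylinder D) psi -> 0 < t -> t <= 1 -> 0 < a ->
  rintable leb I01 (fun s => f (row_snoc (x, s))) ->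
  (forall s, 0 < s < 1 -> 0 <= f (row_snoc (x, s))) ->
  (forall s, 0 < s < 1 -> c <= `|psi (row_snoc (x, s))| + f (row_snoc (x, s))) ->
  c * t <= fiber_integral f x +
    (a * t + (4 * a)^-1 * fiber_integral (fun y => partial ord_max psi y ^+ 2) x) * t.
Proof.
move=> tp t0 t1 a0 fi f0 cf; set X := fiber_integral (fun y => partial _ _ _ ^+ 2) _.
have mI := @measurable_I01 R.
have mJ : measurable (`]0, t[%classic : set (measurableTypeR R)) by exact: measurable_itv.
have JI : (`]0, t[%classic : set (measurableTypeR R)) `<=` I01.
  move=> s; rewrite /= !in_itv/= => /andP[-> st]/=; exact: lt_le_trans st t1.
have Jt : fine (leb (`]0, t[%classic : set (measurableTypeR R))) = t.
  have := @lebesgue_measure_itv R `]0, t[; rewrite /= => ->.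
  by rewrite lte_fin t0/= subr0.
have ic (b : R) : rintable leb (`]0, t[%classic : set (measurableTypeR R)) (fun=> b).
  apply: rintable_cst => //; have := @lebesgue_measure_itv R `]0, t[; rewrite /= => ->.
  by rewrite lte_fin t0/= ltry.
have fJ := rintable_subset mJ mI JI fi.
have E (b : R) : \int[leb]_(s in `]0, t[) b = b * t by rewrite Rintegral_cst// Jt.
rewrite -(E c) -(E (a * t + (4 * a)^-1 * X)).
have f0' s : I01 s -> 0 <= f (row_snoc (x, s)).
  by rewrite /= in_itv/=; exact: f0.
apply: le_trans (lerD (rint_subset mJ mI JI fi f0') (lexx _)).
rewrite -(rintD mJ fJ (ic _)); apply: rint_le => //; first exact: rintableD.
move=> s; rewrite /= in_itv/= => /andP[s0 st].
have s1 : s < 1 by exact: lt_le_trans st t1.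
have s01 : 0 < s < 1 by rewrite s0 s1.
apply: le_trans (cf s s01) _; rewrite addrC lerD2l.
apply: le_trans (test_slice_bound x tp s0 s1 a0) _.
by rewrite lerD2r ler_pM2l// ltW.
Qed.

End layer.

Section layer_argument.
Context {R : realType} {m : nat}.
Variable D : set 'rV[R]_m.
Notation mu := (lebesgue_row m).
Notation nu := (lebesgue_row m.+1).
Notation Om := (cylinder D).
Hypotheses (mD : measurable D) (Doo : (mu D < +oo)%E) (Ooo : (nu Om < +oo)%E).

Let mO : measurable Om. Proof. exact: cylinder_measurable. Qed.

(* [(u1 - a1) - (u2 - a2)] is the positive constant [a2 - a1] on [cylinder Z],
   but an element of [W12_0] is small near the base [t = 0]. *)
Lemma equal_cylinder_null (Z : set 'rV[R]_m) (a1 a2 : R) u1 u2 G1 G2 : a1 < a2 ->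
  admissible D a1 u1 -> admissible D a2 u2 -> W12 Om u1 G1 -> W12 Om u2 G2 ->
  measurable Z -> Z `<=` D ->
  \int[nu]_(x in cylinder Z) `|u1 x - u2 x| = 0 -> mu Z = 0%E.
Proof.
move=> a12 adm1 adm2 w1 w2 mZ ZD Z0.
have [H1 [sH1 _ ap1]] := admissible_approx mD Ooo adm1 w1.
have [H2 [sH2 _ ap2]] := admissible_approx mD Ooo adm2 w2.
have mCZ : measurable (cylinder Z) by exact: cylinder_measurable.
have CZO : cylinder Z `<=` Om by move=> x [/ZD].
have Zoo : (mu Z < +oo)%E.
  by apply: le_lt_trans Doo; apply: le_measure; rewrite ?inE.
pose c := a2 - a1; have c0 : 0 < c by rewrite subr_gt0.
pose dD := fine (mu D); pose dO := fine (nu Om); pose dZ := fine (mu Z).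
have dD0 : 0 <= dD by exact: fine_ge0.
have dO0 : 0 <= dO by exact: fine_ge0.
have dZ0 : 0 <= dZ by exact: fine_ge0.
have dZD : dZ <= dD.
  apply: fine_le; rewrite ?ge0_fin_numE//.
  by apply: le_measure; rewrite ?inE.
have sHd : sqintable nu Om (fun x => H1 ord_max x - H2 ord_max x) by exact: sqintableB.
have [_ iHd] := sHd.
pose I := \int[nu]_(x in Om) ((H1 ord_max x - H2 ord_max x) ^+ 2).
have I0 : 0 <= I by apply: rint_ge0 => x _; exact: sqr_ge0.
(* [2 * I + 8] bounds the vertical energy of the approximant uniformly in [e <= 1]: the 8 is
   [2 * (2 * e) ^+ 2] at [e = 1]. *)
have key e t a : 0 < e -> e <= 1 -> 0 < t -> t <= 1 -> 0 < a ->
    c * t * dZ <= e * (dO + 1) + (a * t * dD + (4 * a)^-1 * (2 * I + 8)) * t.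
  move=> e0 e1 t0 t1 a0.
  have [phi1 tp1 [q1 g1]] := ap1 e e0; have [phi2 tp2 [q2 g2]] := ap2 e e0.
  pose g := (fun y => phi1 y - phi2 y).
  have tg : test_function Om g by exact: test_functionB.
  have tgm := test_function_partial ord_max tg.
  have sg := test_sqintable mO Ooo tg; have sgm := test_sqintable mO Ooo tgm.
  have su1 := W12_sqintable mO w1; have su2 := W12_sqintable mO w2.
  have sc (b : R) : sqintable nu Om (fun=> b) := W12_sqintable mO (W12_cst mO Ooo b).
  have sp1 := test_sqintable mO Ooo tp1; have sp2 := test_sqintable mO Ooo tp2.
  pose k := (fun y => (u2 y - a2 - phi2 y) - (u1 y - a1 - phi1 y)).
  have sk1 := sqintableB mO (sqintableB mO su1 (sc a1)) sp1.
  have sk2 := sqintableB mO (sqintableB mO su2 (sc a2)) sp2.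
  have sk : sqintable nu Om k by exact: sqintableB.
  have kE := rint_sqrB_le mD sk2 sk1 q2 q1.
  have kabs := rint_abs_le mD Ooo sk e0 kE.
  have ik := rintable_norm (sqintable_rintable mO Ooo sk).
  have iu := rintable_norm (sqintable_rintable mO Ooo (sqintableB mO su1 su2)).
  pose f y := `|k y| + `|u1 y - u2 y|.
  have iF : rintable nu Om f by exact: rintableD.
  have [_ igm] := sgm.
  pose F := fiber_integral (fun y => partial ord_max g y ^+ 2).
  have fF : rintable mu D F := fiber_rintable mD igm.
  have fZ := rintable_subset mZ mD ZD fF.
  have ic (b : R) : rintable mu Z (fun=> b) by exact: rintable_cst.
  have ifZ := fiber_rintable mZ (rintable_subset mCZ mO CZO iF).
  have iG : rintable mu Z (fun x => t * (a * t + (4 * a)^-1 * F x)).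
    by apply: rintableZ => //; apply: rintableD => //; exact: rintableZ.
  have pw : {ae mu, forall x, Z x -> c * t <=
      fiber_integral f x + t * (a * t + (4 * a)^-1 * F x)}.
    apply: filterS (ae_fiber_rintable mD iF) => x h /ZD Dx.
    rewrite [t * _]mulrC; apply: (thin_layer tg t0 t1 a0 (h Dx)).
      by move=> s _; rewrite /f addr_ge0.
    move=> s _; move: (row_snoc _) => y; rewrite /f /k /g /c.
    have -> : a2 - a1 = (phi1 y - phi2 y) +
        ((u2 y - a2 - phi2 y - (u1 y - a1 - phi1 y)) * -1 - (u1 y - u2 y)) by ring.
    apply: le_trans (ler_norm _) _; apply: le_trans (ler_normD _ _) _.
    rewrite lerD2l; apply: le_trans (ler_normB _ _) _.
    by rewrite mulrN1 normrN.
  have := rint_ae_le mZ (ic _) (rintableD mZ ifZ iG) pw.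
  rewrite Rintegral_cst// => /le_trans; apply.
  rewrite (rintD mZ ifZ iG) lerD//.
    rewrite -(rint_fiber mZ (rintable_subset mCZ mO CZO iF)).
    rewrite (rintD mCZ (rintable_subset mCZ mO CZO ik) (rintable_subset mCZ mO CZO iu)) Z0 addr0.
    by apply: le_trans (rint_subset mCZ mO CZO ik _) kabs.
  rewrite (rintZ mZ t (rintableD mZ (ic _) (rintableZ mZ _ fZ))) mulrC ler_pM2r//.
  rewrite (rintD mZ (ic _) (rintableZ mZ _ fZ)) (rintZ mZ _ fZ) Rintegral_cst// lerD//.
    by rewrite ler_wpM2l// mulr_ge0// ltW.
  rewrite ler_wpM2l//; first by rewrite invr_ge0 mulr_ge0// ltW.
  apply: (@le_trans _ _ (\int[mu]_(x in D) F x)).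
    by apply: rint_subset => // x _; apply: rint_ge0 => s _; exact: sqr_ge0.
  rewrite -(rint_fiber mD igm).
  have d1 := sqintableB mO (sH1 ord_max) (test_sqintable mO Ooo (test_function_partial ord_max tp1)).
  have d2 := sqintableB mO (sH2 ord_max) (test_sqintable mO Ooo (test_function_partial ord_max tp2)).
  have d12 := rint_sqrB_le mD d1 d2 (g1 ord_max) (g2 ord_max).
  have [_ id12] := sqintableB mO d1 d2.
  have j1 := rintableZ mO 2 iHd; have j2 := rintableZ mO 2 id12.
  apply: (@le_trans _ _ (\int[nu]_(x in Om) (2 * (H1 ord_max x - H2 ord_max x) ^+ 2 +
      2 * (H1 ord_max x - partial ord_max phi1 x - (H2 ord_max x - partial ord_max phi2 x)) ^+ 2))).
    apply: rint_le => //; first exact: rintableD.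
    move=> x _; apply: le_trans (sqrB_le2 _ _).
    rewrite /g partialB//; [|by case: tp1|by case: tp2].
    by rewrite le_eqVlt; apply/orP; left; apply/eqP; ring.
  rewrite (rintD mO j1 j2) (rintZ mO 2 iHd) (rintZ mO 2 id12) lerD2l.
  have -> : (8 : R) = 2 * 2 ^+ 2 by ring.
  rewrite ler_pM2l//; apply: le_trans d12 _.
  by rewrite ler_pXn2r ?nnegrE// ?mulr_ge0// ?(ltW e0)// ler_piMr.
(* Accuracy [e = t^2] makes the approximation error negligible against the height [t] of the layer.
   First [t] tends to 0, and afterwards [a] to infinity. *)
have main a : 0 < a -> c * dZ <= (4 * a)^-1 * (2 * I + 8).
  move=> a0; apply: (@ler_small_slope _ _ (dO + 1 + a * dD)).
    by rewrite !addr_ge0// mulr_ge0// ltW.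
  move=> t t0 t1; rewrite -(ler_pM2l t0).
  have t21 : t ^+ 2 <= 1 by rewrite exprn_ile1// ltW.
  have := key (t ^+ 2) t a (exprn_gt0 2 t0) t21 t0 t1 a0.
  by set X := (4 * a)^-1 * _ => h; apply: le_trans (le_trans _ h) _;
    rewrite le_eqVlt; apply/orP; left; apply/eqP; ring.
have cZ : c * dZ <= 0.
  apply: (@ler_small_slope _ _ (2 * I + 8)); first by rewrite addr_ge0// mulr_ge0.
  move=> l l0 _; rewrite addr0.
  have := main (4 * l)^-1; rewrite invr_gt0 mulr_gt0// => /(_ isT).
  by rewrite invfM invrK mulrA mulVf ?mul1r// pnatr_eq0.
have dZ00 : dZ = 0.
  by apply/eqP; rewrite eq_le dZ0 andbT -(ler_pM2l c0) mulr0.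
by rewrite -[LHS]fineK ?ge0_fin_numE// -/dZ dZ00.
Qed.

End layer_argument.

Section zero_set_comparison.
Context {R : realType} {m : nat}.
Variable D : set 'rV[R]_m.
Notation mu := (lebesgue_row m).
Notation nu := (lebesgue_row m.+1).
Notation Om := (cylinder D).
Hypotheses (mD : measurable D) (Ooo : (nu Om < +oo)%E).

Let mO : measurable Om. Proof. exact: cylinder_measurable. Qed.
Let Doo : (mu D < +oo)%E. Proof. by rewrite -lebesgue_row_cylinder. Qed.

Lemma zero_set_measurable u G : W12 Om u G -> measurable (zero_set D u).
Proof.
move=> wu; have mf := rintable_measurable (W12_fiber_rintable mD Ooo wu).
have -> : zero_set D u = D `&` fiber_integral u @^-1` [set 0] by [].
exact: mf.
Qed.

Lemma fiber_integral_ge0 a u : 0 <= a -> minimizer D a u ->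
  {ae mu, forall x, D x -> 0 <= fiber_integral u x}.
Proof.
move=> a0 mu_u.
have := fiber_comparison mD Doo Ooo a0 (minimizer0 mD Ooo) mu_u.
by apply: filterS => x h /h; rewrite fiber_integral0.
Qed.

Lemma zero_set_sub a1 a2 u1 u2 : 0 <= a1 -> a1 <= a2 ->
  minimizer D a1 u1 -> minimizer D a2 u2 ->
  {ae mu, forall x, zero_set D u2 x -> zero_set D u1 x}.
Proof.
move=> a10 a12 m1 m2.
apply: filterS2 (fiber_integral_ge0 a10 m1) (fiber_comparison mD Doo Ooo a12 m1 m2).
move=> x h1 h2 [Dx v20]; split=> //.
by apply/eqP; rewrite eq_le h1// andbT -v20 h2.
Qed.

(* Equal fiber integrals and [u1 <= u2] force [u1 = u2] on the cylinder. *)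
Lemma zero_set_null a1 a2 u1 u2 : 0 <= a1 -> a1 < a2 ->
  minimizer D a1 u1 -> minimizer D a2 u2 ->
  le_on (cylinder (zero_set D u2)) u1 u2 -> mu (zero_set D u2) = 0%E.
Proof.
move=> a10 a12 m1 m2 u12; set Z := zero_set D u2.
have ZZ := zero_set_sub a10 (ltW a12) m1 m2.
have [adm1 [G1 w1 _]] := m1; have [adm2 [G2 w2 _]] := m2.
have mZ : measurable Z := zero_set_measurable w2.
have ZD : Z `<=` D by move=> x [].
have mCZ : measurable (cylinder Z) by exact: cylinder_measurable.
have CZO : cylinder Z `<=` Om by move=> x [/ZD].
apply: (equal_cylinder_null mD Doo Ooo a12 adm1 adm2 w1 w2 mZ ZD).
have r1 := sqintable_rintable mO Ooo (W12_sqintable mO w1).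
have r2 := sqintable_rintable mO Ooo (W12_sqintable mO w2).
have i1 := rintable_subset mCZ mO CZO r1; have i2 := rintable_subset mCZ mO CZO r2.
have i21 := rintableB mCZ i2 i1; have i12 := rintable_norm (rintableB mCZ i1 i2).
transitivity (\int[nu]_(x in cylinder Z) (u2 x - u1 x)).
  apply: rint_ae_eq => //; [exact: rintable_measurable i12|exact: rintable_measurable i21|].
  by apply: filterS u12 => x h Zx; rewrite distrC ger0_norm// subr_ge0 h.
rewrite (rintB mCZ i2 i1) (rint_fiber mZ i1) (rint_fiber mZ i2).
apply/eqP; rewrite subr_eq0; apply/eqP.
apply: rint_ae_eq => //.
- exact: rintable_measurable (fiber_rintable mZ i2).
- exact: rintable_measurable (fiber_rintable mZ i1).
by apply: filterS ZZ => x h Zx; have [_ ->] := h Zx; case: Zx.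
Qed.

End zero_set_comparison.

Theorem mainTheorem4 (R : realType) (m : nat) (D : set 'rV[R]_m)
    (alpha1 alpha2 : R) (u1 u2 : 'rV[R]_m.+1 -> R) :
  (0 < m)%N ->
  open (cylinder D) -> connected (cylinder D) -> cylinder D !=set0 ->
  bounded_set (cylinder D) -> piecewise_smooth_boundary (cylinder D) ->
  0 < alpha1 -> alpha1 < alpha2 ->
  minimizer D alpha1 u1 -> minimizer D alpha2 u2 ->
  [/\ {ae lebesgue_row m, forall x', zero_set D u2 x' -> zero_set D u1 x'},
      {ae lebesgue_row m, forall x', zero_set D u2 x' ->
         fiber_integral u1 x' = 0 /\ fiber_integral u2 x' = 0} &
      ~ (lebesgue_row m).-negligible (zero_set D u2) ->
      [/\ ~ le_on (cylinder D) u1 u2,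
          ~ le_on (cylinder (zero_set D u2)) u1 u2 &
          ~ eq_on (cylinder (zero_set D u2)) u1 u2]].
Proof.
move=> _ oD _ _ bD _ a10 a12 m1 m2.
have mD := open_cylinder_base_measurable oD.
have Ooo := bounded_row_finite (cylinder_measurable mD) bD.
have ZZ := zero_set_sub mD Ooo (ltW a10) (ltW a12) m1 m2.
split=> // [|nZ].
  by apply: filterS ZZ => x h Zx; split; [case: (h Zx)|case: Zx].
have nle : ~ le_on (cylinder (zero_set D u2)) u1 u2.
  move=> /(zero_set_null mD Ooo (ltW a10) a12 m1 m2) Z0; apply: nZ.
  have [_ [G2 w2 _]] := m2.
  by exists (zero_set D u2); split=> //; exact: zero_set_measurable w2.
split=> // [le12|eq12]; apply: nle.
  by apply: filterS le12 => x h [[Dx _] x01]; apply: h.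
by apply: filterS eq12 => x h /h ->.
Qed.
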